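(* Let $\mu_1,\dots,\mu_n\in\{1,\dots,N\}$, and let $I=I_{\mu_1\cdots\mu_n}$ be the associated partition of $\{1,\dots,n\}$ with $\lambda=(\lambda_1,\dots,\lambda_N)$, $\lambda_l=|I_l|$. For $|p|<|z_1|,\dots,|z_n|<1$, the composition $\phi_{\mu_1\cdots\mu_n}(z_1,\dots,z_n)=\Phi_{\mu_1}(z_1)\cdots\Phi_{\mu_n}(z_n)$ of level-1 type I vertex operator components of $U_{q,p}(\widehat{\mathfrak{sl}}_N)$ is given by $$\phi_{\mu_1\cdots\mu_n}(z_1,\dots,z_n)=\oint_{\mathbb{T}^M}\underline{dt}\ \widetilde\Phi(t,z)\,\omega_{\mu_1\cdots\mu_n}(t,z,\Pi),$$ where $M=\sum_{l=1}^{N-1}\lambda^{(l)}=\sum_{l=1}^{N-1}(N-l)\lambda_l$, $\mathbb{T}^M=\{|t^{(l)}_a|=1\ \forall l,a\}$, $$\underline{dt}=\prod_{j=1}^n a_{\mu_j,N}\prod_{l=1}^{N-1}\prod_{a=1}^{\lambda^{(l)}}\frac{dt^{(l)}_a}{2\pi i\,t^{(l)}_a},$$ \begin{align*}\widetilde\Phi(t,z)=&\ :\Phi_N(z_1)\cdots\Phi_N(z_n):\ :F_{N-1}(t^{(N-1)}_1)\cdots F_{N-1}(t^{(N-1)}_{\lambda^{(N-1)}}):\cdots :F_1(t^{(1)}_1)\cdots F_1(t^{(1)}_{\lambda^{(1)}}):\\ &\times\prod_{1\le k<l\le n}\langle\Phi_N(z_k)\Phi_N(z_l)\rangle^{Sym}\prod_{l=1}^{N-1}\prod_{1\le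 a<b\le\lambda^{(l)}}\langle F_l(t^{(l)}_a)F_l(t^{(l)}_b)\rangle^{Sym},\end{align*} $$\omega_{\mu_1\cdots\mu_n}(t,z,\Pi)=\mu^+(z)\,\widetilde W_I(t,z,\Pi),\qquad \mu^+(z)=\prod_{1\le k<l\le n}(-1)^{\frac{N-1}{N}}z_k^{\frac{r^*(N-1)}{rN}}\frac{\Gamma(q^2z_k/z_l;p,q^{2N})}{\Gamma(q^{2N}z_k/z_l;p,q^{2N})},$$ $$\widetilde W_I(t,z,\Pi)=\mathrm{Sym}_{t^{(1)}}\cdots\mathrm{Sym}_{t^{(N-1)}}\widetilde U_I(t,z,\Pi),$$ \begin{align*}\widetilde U_I(t,z,\Pi)=\prod_{l=1}^{N-1}\prod_{a=1}^{\lambda^{(l)}}\Bigg(&\frac{[v^{(l+1)}_b-v^{(l)}_a+(P+h)_{\mu_s,l+1}-C_{\mu_s,l+1}(s)-\frac12][1]}{[v^{(l+1)}_b-v^{(l)}_a+\frac12][(P+h)_{\mu_s,l+1}-C_{\mu_s,l+1}(s)]}\Bigg|_{i^{(N)}_s=i^{(l+1)}_b=i^{(l)}_a}\\&\times\prod_{\substack{b=1\\ i^{(l+1)}_b>i^{(l)}_a}}^{\lambda^{(l+1)}}\frac{[v^{(l+1)}_b-v^{(l)}_a-\frac12]}{[v^{(l+1)}_b-v^{(l)}_a+\frac12]}\prod_{b=a+1}^{\lambda^{(l)}}\frac{[v^{(l)}_a-v^{(l)}_b-1]}{[v^{(l)}_a-v^{(l)}_b]}\Bigg).\end{align*}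
   Context: **Parameters.** $N\ge2$; $0<|q|<1$ with a fixed branch of $\log q$; $r>1$ generic real; $p=q^{2r}$, $r^*=r-1$, $p^*=q^{2r^*}$. $(x;q_1,\dots,q_m)_\infty=\prod_{k_1,\dots,k_m\ge0}(1-xq_1^{k_1}\cdots q_m^{k_m})$; $\{x\}=(x;p,q^{2N})_\infty$; $\Theta_p(z)=(z;p)_\infty(p/z;p)_\infty(p;p)_\infty$; $[u]=q^{u^2/r-u}\Theta_p(q^{2u})$; $\Gamma(x;s,t)=(st/x;s,t)_\infty/(x;s,t)_\infty$; $[m]_q=(q^m-q^{-m})/(q-q^{-1})$. **Combinatorics.** For $\mu_1,\dots,\mu_n$ put $I_l=\{i:\mu_i=l\}$, $I=I_{\mu_1\cdots\mu_n}=(I_1,\dots,I_N)$, $\lambda_l=|I_l|$, $\lambda^{(l)}=\lambda_1+\cdots+\lambda_l$, $I^{(l)}=I_1\cup\cdots\cup I_l=\{i^{(l)}_1<\cdots<i^{(l)}_{\lambda^{(l)}}\}$. Variables $t=(t^{(l)}_a)_{1\le l\le N-1,1\le a\le\lambda^{(l)}}$, $t^{(l)}_a=q^{2v^{(l)}_a}$, $z_k=q^{2u_k}$, $v^{(N)}_s=u_s$ (and $i^{(N)}_s=s$). $\mathrm{Sym}_{t^{(l)}}$ denotes the procedure of symmetrizing, under the integral, the integration variables $t^{(l)}_1,\dots,t^{(l)}_{\lambda^{(l)}}$ over their permutations. $C_{\mu_s,l+1}(s)=\sum_{j=s+1}^n\langle\bar\epsilon_{\mu_j},h_{\mu_s,l+1}\rangle$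 with $\langle\bar\epsilon_\mu,h_{j,k}\rangle=\delta_{\mu,j}-\delta_{\mu,k}$. The bar $|_{i^{(N)}_s=i^{(l+1)}_b=i^{(l)}_a}$ means that, for given $l,a$, the indices $b$ and $s$ are those determined by these equalities. **Zero modes and representation space.** $\epsilon_1,\dots,\epsilon_N$ orthonormal, $\bar\epsilon_j=\epsilon_j-\frac1N\sum_k\epsilon_k$, $\alpha_j=\epsilon_j-\epsilon_{j+1}$, $\bar\Lambda_a=\bar\epsilon_1+\cdots+\bar\epsilon_a$ ($\bar\Lambda_0=0$), $(a_{ij})$ the Cartan matrix of $\mathfrak{sl}_N$, $\mathcal Q=\oplus\mathbb Z\alpha_j$. $h_\alpha,P_\alpha$ (linear in $\alpha$) commute with each other, $[h_\alpha,\beta]=(\alpha,\beta)$, $[P_\alpha,Q_\beta]=(\alpha,\beta)$; $(P+h)_\alpha=P_\alpha+h_\alpha$, $(P+h)_{j,k}=(P+h)_{\epsilon_j}-(P+h)_{\epsilon_k}$, $\Pi_{j,k}=q^{2(P+h)_{j,k}}$. Auxiliary $e^{\pm\zeta_{\bar\epsilon_j}}$ satisfy $e^{\zeta_{\bar\epsilon_j}}e^{\zeta_{\bar\epsilon_k}}=q^{\mathrm{sgn}(j-k)/r}e^{\zeta_{\bar\epsilon_k}}e^{\zeta_{\bar\epsilon_j}}$, commute with $h,P$ and the bosons; $\zeta_\omega$ is linear in $\omega$, $\widehat\omega=\omega+\zeta_\omega$; $e^{\alpha_i}e^{\alpha_j}=(-1)^{(\alpha_i,\alpha_j)}e^{\alpha_j}e^{\alpha_i}$.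 Bosons $\alpha_{j,m}$ ($1\le j\le N-1$, $m\ne0$): $[\alpha_{i,m},\alpha_{j,n}]=\delta_{m+n,0}\frac{[a_{ij}m]_q[m]_q}{m}\frac{1-p^m}{1-p^{*m}}q^{-m}$; $\alpha'_{j,m}=\frac{1-p^{*m}}{1-p^m}q^m\alpha_{j,m}$; $\mathcal E'^{N}_m=-\frac{1}{(q-q^{-1})[m]_q^2[Nm]_q}\sum_{k=1}^{N-1}[km]_q\alpha'_{k,m}$. With $\mathbb F$ the field of meromorphic functions of the zero modes $P,P+h$ (and $c$), the level-1 module is $\widehat V(\Lambda_a+\nu,\nu)=\bigoplus_{\xi,\eta\in\mathcal Q}\mathbb F\otimes\mathbb C[\alpha_{j,-m}\,(m>0)]\otimes e^{\widehat\Lambda_a+\widehat\xi}\otimes e^{Q_{\nu+\eta}}$. **Currents and vertex operators.** $F_j(t)=:\exp\{\sum_{m\ne0}\frac{1}{[m]_q}\alpha'_{j,m}t^{-m}\}:e^{-\widehat\alpha_j}t^{-h_{\alpha_j}+1}(q^{N-j}t)^{((P+h)_{\alpha_j}-1)/r}$, $\Phi_N(z)=:\exp\{\sum_{m\ne0}(q^m-q^{-m})\mathcal E'^{N}_mz^{-m}\}:e^{-\widehat{\bar\epsilon}_N}(-z)^{-h_{\bar\epsilon_N}}z^{\frac1r(P+h)_{\bar\epsilon_N}}$, and for $1\le\mu\le N-1$ $$\Phi_\mu(z)=a_{\mu,N}\oint_{\mathbb T^{N-\mu}}\prod_{m=\mu}^{N-1}\frac{dt_m}{2\pi it_m}\Phi_N(z)F_{N-1}(t_{N-1})\cdots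 F_\mu(t_\mu)\varphi_\mu,\quad \varphi_\mu=\prod_{m=\mu}^{N-1}\frac{[v_{m+1}-v_m+(P+h)_{\mu,m+1}-\frac12][1]}{[v_{m+1}-v_m+\frac12][(P+h)_{\mu,m+1}]},$$ with $t_m=q^{2v_m}$, $v_N=u$, $z=q^{2u}$; $a_{\mu,N}$ are fixed nonzero constants, $a_{N,N}=1$. They satisfy (in the sense of analytic continuation) $F_{N-1}(t)\Phi_N(z)=\frac{[v-u+1/2]}{[v-u-1/2]}\Phi_N(z)F_{N-1}(t)$, $F_j\Phi_N=\Phi_NF_j$ ($j\le N-2$), $[v-v'+\frac{a_{ij}}2]F_i(t)F_j(t')=[v-v'-\frac{a_{ij}}2]F_j(t')F_i(t)$, and $\Pi_{j,k}\Phi_\mu(z)=\Phi_\mu(z)\Pi_{j,k}q^{-2\langle\bar\epsilon_\mu,h_{j,k}\rangle}$. **Normal ordering.** Products of currents are understood through meromorphically continued contraction functions. Normal ordered products are given by $\Phi_N(z_1)\cdots\Phi_N(z_m)=:\Phi_N(z_1)\cdots\Phi_N(z_m):\prod_{k<l}\langle\Phi_N(z_k)\Phi_N(z_l)\rangle$ and $F_l(t_1)\cdots F_l(t_m)=:F_l(t_1)\cdots F_l(t_m):\prod_{a<b}\langle F_l(t_a)F_l(t_b)\rangle$, where $\langle\Phi_N(z_k)\Phi_N(z_l)\rangle=(-1)^{\frac{N-1}N}z_k^{\frac{r^*(N-1)}{rN}}\frac{\{q^2z_l/z_k\}\{pq^{2N-2}z_l/z_k\}}{\{pz_l/z_k\}\{q^{2N}z_l/z_k\}}$,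 $\langle F_l(t_a)F_l(t_b)\rangle=t_a^{2(r-1)/r}\frac{(q^2t_b/t_a;p)_\infty(t_b/t_a;p)_\infty}{(pt_b/t_a;p)_\infty(pq^{-2}t_b/t_a;p)_\infty}$, and the symmetric parts are $\langle\Phi_N(z_k)\Phi_N(z_l)\rangle^{Sym}=\frac{\{q^2z_k/z_l\}\{q^2z_l/z_k\}}{\{q^{2N}z_k/z_l\}\{q^{2N}z_l/z_k\}}$, $\langle F_l(t_a)F_l(t_b)\rangle^{Sym}=-(qt_at_b)^{1-1/r}\frac{(t_a/t_b;p)_\infty(t_b/t_a;p)_\infty}{(pq^{-2}t_a/t_b;p)_\infty(pq^{-2}t_b/t_a;p)_\infty}$. *)

(* Defs.v *)
From HB Require Import structures.
From mathcomp Require Import all_boot all_order all_algebra fingroup perm.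
From mathcomp Require Import complex.
From mathcomp Require Import all_classical all_reals all_analysis.

Set Implicit Arguments.
Unset Strict Implicit.
Unset Printing Implicit Defensive.

Import Order.TTheory GRing.Theory Num.Theory.
Import numFieldNormedType.Exports.

Local Open Scope classical_set_scope.
Local Open Scope complex_scope.
Local Open Scope ring_scope.

(** * Complex analysis: limits, exponential, torus integrals *)

Section ComplexAnalysis.
Variable R : realType.
Local Notation C := R[i].

Definition ccvg (w : nat -> C) (l : C) : Prop :=
  ((fun k => complex.Re (w k)) @ \oo --> complex.Re l) /\
  ((fun k => complex.Im (w k)) @ \oo --> complex.Im l).

Definition clim (w : nat -> C) : C :=
  lim ((fun k => complex.Re (w k)) @ \oo) +i*
  lim ((fun k => complex.Im (w k)) @ \oo).

Definition cexp (x : C) : C :=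
  (expR (complex.Re x) * cos (complex.Im x)) +i*
  (expR (complex.Re x) * sin (complex.Im x)).

(* (-1)^x, with the branch e^{i pi x} *)
Definition sgnpow (x : C) : C := cexp ('i * (pi : R)%:C * x).

(* The integral of dt/(2 pi i t) over |t| = 1 is the integral of d theta over
   [0,1], where t = e^{2 pi i theta}; integrands are functions of theta. *)
Definition circle_int (f : R -> C) : C :=
  Rintegral lebesgue_measure `[0%R, 1%R] (fun theta => complex.Re (f theta)) +i*
  Rintegral lebesgue_measure `[0%R, 1%R] (fun theta => complex.Im (f theta)).

Definition scons (x : R) (th : nat -> R) : nat -> R :=
  fun i => if i is i'.+1 then th i' else x.

(* Integral over T^M in the angles th 0, ..., th (M-1). *)
Fixpoint torus_int (M : nat) (f : (nat -> R) -> C) : C :=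
  if M is M'.+1
  then circle_int (fun x => torus_int M' (fun th => f (scons x th)))
  else f (fun=> 0).

Definition entire (f : C -> C) : Prop :=
  exists a : nat -> C, forall w,
    ccvg (fun K => \sum_(k < K) a k * w ^+ k) (f w).

(* g is the meromorphic continuation to the plane of the germ at 0 of
   exp (sum_{m >= 1} c_m w^m): a quotient of two entire functions without common
   zeros.  Poles get the value 0 (division by zero), so g is unique. *)
Definition meromorphic_continuation (c : nat -> C) (g : C -> C) : Prop :=
  exists A B : C -> C,
    [/\ entire A, entire B, forall w, ~ (A w = 0 /\ B w = 0),
        forall w, g w = A w / B w &
        exists2 e : R, 0 < e & forall w : C, `|w| < e%:C ->
          B w != 0 /\
          exists2 s : C, ccvg (fun K => \sum_(1 <= m < K) c m * w ^+ m) s &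
                         g w = cexp s].

Definition mero_exp (c : nat -> C) : C -> C :=
  xget (fun=> 0) [set g : C -> C | meromorphic_continuation c g].

End ComplexAnalysis.

(** * q-analogues and theta functions *)

Section QFunctions.
Variable R : realType.
Local Notation C := R[i].
Variables (N : nat) (logq : C) (r : R).

Definition qpow (x : C) : C := cexp (x * logq).
Definition qq : C := qpow 1.
Definition pp : C := qpow (2 * r%:C).
Definition pstar : C := qpow (2 * (r - 1)%:C).

Definition poch1 (x s : C) : C := clim (fun K => \prod_(k < K) (1 - x * s ^+ k)).
Definition poch2 (x s t : C) : C :=
  clim (fun K => \prod_(k < K) \prod_(l < K) (1 - x * s ^+ k * t ^+ l)).

Definition dpoch (x : C) : C := poch2 x pp (qq ^+ (2 * N)).
Definition theta (z : C) : C := poch1 z pp * poch1 (pp / z) pp * poch1 pp pp.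
Definition br (x : C) : C := qpow (x ^+ 2 / r%:C - x) * theta (qpow (2 * x)).
Definition eGamma (x s t : C) : C := poch2 (s * t / x) s t / poch2 x s t.
Definition qint (m : int) : C := (qq ^ m - qq ^ (- m)) / (qq - qq^-1).

(* The point t = e^{2 pi i theta} of the unit circle is q^{2v} for this v. *)
Definition vang (theta : R) : C := 'i * (pi * theta)%:C / logq.

End QFunctions.

(** * Weights.  Labels of components run over 1, ..., N. *)

Section Weights.
Variable R : realType.
Local Notation C := R[i].
Variable N : nat.
Local Notation W := 'rV[C]_N.

Definition dot (x y : W) : C := \sum_i x 0 i * y 0 i.
Definition eps (j : nat) : W := \row_i (i.+1 == j)%:R.
Definition epsbar (j : nat) : W :=
  eps j - (N%:R)^-1 *: \sum_(1 <= k < N.+1) eps k.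
Definition alpha (j : nat) : W := eps j - eps j.+1.
Definition Lambdabar (a : nat) : W := \sum_(1 <= j < a.+1) epsbar j.
Definition cartan (i j : nat) : int :=
  if i == j then 2 else if (i == j.+1) || (j == i.+1) then -1 else 0.

Definition rootlat (x : W) : Prop :=
  exists c : nat -> int, x = \sum_(1 <= j < N) (c j)%:~R *: alpha j.

Definition wlat (x : W) : Prop :=
  exists2 a, (a < N)%N & rootlat (x - Lambdabar a).

(* e^{zeta_x} e^{zeta_y} = q^{zform x y / r} e^{zeta_y} e^{zeta_x}, where zeta
   is linear in the N symbols zeta_{epsbar_j} *)
Definition zform (x y : W) : C :=
  \sum_i \sum_j x 0 i * y 0 j * (Num.sg (i%:Z - j%:Z))%:~R.

End Weights.

Section Bosonization.
Variable R : realType.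
Local Notation C := R[i].
Variables (N : nat) (logq : C) (r : R).
Local Notation W := 'rV[C]_N.
Local Notation qpow := (qpow logq).
Local Notation q := (qq logq).
Local Notation p := (pp logq r).
Local Notation pst := (pstar logq r).
Local Notation "[[ x ]]" := (br logq r x).
Local Notation qint := (qint logq).

(** * Zero modes *)

(* The hatted lattice operators act on the vectors e^{\hat x}, x in the weight
   lattice, by e^{\hat w} e^{\hat x} = kap w x e^{\widehat{w+x}}.  Only
   w = - alpha_j and w = - epsbar_N occur in the currents.  The commutation of
   e^{epsbar_N} with e^{alpha_j} is the one forced by the exchange relations of
   F_j with Phi_N: no sign, only the factor coming from zeta. *)
Definition lattice_rep (kap : W -> W -> C) : Prop :=
  [/\ forall w x, kap w x != 0,
      forall i j x, (1 <= i < N)%N -> (1 <= j < N)%N -> wlat x ->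
        kap (- alpha R N i) (x - alpha R N j) * kap (- alpha R N j) x =
        (-1) ^ cartan i j
        * qpow (zform (alpha R N i) (alpha R N j) / r%:C)
        * (kap (- alpha R N j) (x - alpha R N i) * kap (- alpha R N i) x) &
      forall j x, (1 <= j < N)%N -> wlat x ->
        kap (- alpha R N j) (x - epsbar R N N) * kap (- epsbar R N N) x =
        qpow (zform (alpha R N j) (eps R N N) / r%:C)
        * (kap (- epsbar R N N) (x - alpha R N j) * kap (- alpha R N j) x)].

Variable kap : W -> W -> C.

(* (e^{\hat w})^k *)
Definition kap_iter (k : nat) (w x : W) : C := \prod_(i < k) kap w (x + w *+ i).

(* Eigenvalue of (P+h)_{j,k} on e^{\hat x} (x) e^{Q_y}. *)
Definition Ph (x y : W) (j k : nat) : C := dot (eps R N j - eps R N k) (x + y).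

(** * Bosons *)

(* [alpha_{i,m}, alpha_{j,-m}] *)
Definition bcomm (i j : nat) (m : int) : C :=
  qint (cartan i j * m) * qint m / m%:~R * ((1 - p ^ m) / (1 - pst ^ m))
  * q ^ (- m).

(* alpha'_{j,m} = prime_coef m * alpha_{j,m} *)
Definition prime_coef (m : int) : C := (1 - pst ^ m) / (1 - p ^ m) * q ^ m.

(* Currents are labelled by l: Phi_N for l = N, F_l for 1 <= l <= N-1.
   cur_coef l j m is the coefficient of alpha'_{j,m} z^{-m} in the exponent. *)
Definition cur_coef (l j : nat) (m : int) : C :=
  if l == N
  then (q ^ m - q ^ (- m))
       * (- ((q - q^-1) * qint m ^+ 2 * qint (N%:Z * m))^-1 * qint (j%:Z * m))
  else if j == l then (qint m)^-1 else 0.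

(* Moving the annihilation part of current l, at z, through the creation part of
   current l', at z', yields exp (sum_{m >= 1} contr_coef l l' m (z'/z)^m). *)
Definition contr_coef (l l' m : nat) : C :=
  \sum_(1 <= i < N) \sum_(1 <= j < N)
    cur_coef l i m%:Z * cur_coef l' j (- m%:Z)
    * (prime_coef m%:Z * prime_coef (- m%:Z)) * bcomm i j m%:Z.

Definition contr (l l' : nat) : C -> C := mero_exp (contr_coef l l').

(* Elements of C[alpha_{j,-m}] as polynomial functions of X j m = alpha_{j,-m}. *)
Inductive fock_poly : ((nat -> nat -> C) -> C) -> Prop :=
| FockConst (c : C) : fock_poly (fun=> c)
| FockVar (j m : nat) : (1 <= j < N)%N -> (1 <= m)%N -> fock_poly (fun X => X j m)
| FockAdd f g : fock_poly f -> fock_poly g -> fock_poly (fun X => f X + g X)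
| FockMul f g : fock_poly f -> fock_poly g -> fock_poly (fun X => f X * g X).

(* Currents map the Fock space to its completion, whose elements, power series in
   the alpha_{j,-m}, are represented by their values at the sequences X below; on
   these the infinite sums over modes are finite. *)
Definition finsupp (X : nat -> nat -> C) : Prop :=
  exists K, forall j m, (K <= m)%N -> X j m = 0.

(* Psi x y is the component of Psi along e^{\hat x} (x) e^{Q_y}.  On it h_w acts as
   dot w x and P_w as dot w y, so that functions of P and P+h act by their values. *)
Definition state := W -> W -> (nat -> nat -> C) -> C.

Definition in_Vhat (a : nat) (nu : W) (Psi : state) : Prop :=
  (forall x y, fock_poly (Psi x y)) /\
  exists2 s : seq (W * W),
    (forall xi eta, (xi, eta) \in s -> rootlat xi /\ rootlat eta) &
    (forall x y, Psi x y <> (fun=> 0) ->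
       (x - Lambdabar R N a, y - nu) \in s).

(** * Operators *)

(* The operator  :prod_i X_{l_i}(q^{2v_i}): (bosonic parts only, X_l being the
   current of label l) tensored with  e^{\hat x} (x) e^{Q_y} |-> zcoef x y e^{\widehat{x+wshift}} (x) e^{Q_y},
   where (l_i, v_i) runs over [letters]. *)
Record fop := Fop {
  letters : seq (nat * C);
  wshift : W;
  zcoef : W -> W -> C }.

Definition fone : fop := Fop [::] 0 (fun _ _ => 1).

(* Product of operators, through meromorphically continued contractions. *)
Definition fmul (A B : fop) : fop :=
  Fop (letters A ++ letters B) (wshift A + wshift B)
    (fun x y =>
       (\prod_(c <- letters A) \prod_(d <- letters B)
          contr c.1 d.1 (qpow (2 * d.2) / qpow (2 * c.2)))
       * (zcoef A (x + wshift B) y * zcoef B x y)).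

Definition fscal (c : C) (A : fop) : fop :=
  Fop (letters A) (wshift A) (fun x y => c * zcoef A x y).

(* Multiplication by a function of the zero modes. *)
Definition fzero (g : W -> W -> C) : fop := Fop [::] 0 g.

Definition fop_prod (s : seq fop) : fop := foldr fmul fone s.

(* The creation part multiplies by an exponential in the variables
   X j m = alpha_{j,-m}; the annihilation part, the exponential of a derivation,
   translates these variables. *)
Definition creation (A : fop) (X : nat -> nat -> C) : C :=
  cexp (clim (fun K => \sum_(1 <= m < K) \sum_(1 <= j < N)
    \sum_(c <- letters A)
      cur_coef c.1 j (- m%:Z) * qpow (2 * c.2) ^+ m * prime_coef (- m%:Z) * X j m)).

Definition translation (A : fop) (j m : nat) : C :=
  \sum_(c <- letters A) \sum_(1 <= i < N)
    cur_coef c.1 i m%:Z * qpow (2 * c.2) ^- m * prime_coef m%:Z * bcomm i j m%:Z.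

Definition act (A : fop) (Psi : state) : state := fun x y X =>
  let x0 := x - wshift A in
  zcoef A x0 y * creation A X * Psi x0 y (fun j m => X j m + translation A j m).

(* Phi_N(z) for z = q^{2u}, with (-z)^x = (-1)^x z^x *)
Definition PhiN (u : C) : fop :=
  Fop [:: (N, u)] (- epsbar R N N)
    (fun x y => kap (- epsbar R N N) x
       * (sgnpow (- dot (epsbar R N N) x) * qpow (2 * u * - dot (epsbar R N N) x))
       * qpow (2 * u * (dot (epsbar R N N) (x + y) / r%:C))).

(* F_j(q^{2v}) *)
Definition Fcur (j : nat) (v : C) : fop :=
  Fop [:: (j, v)] (- alpha R N j)
    (fun x y => kap (- alpha R N j) x
       * qpow (2 * v * (- dot (alpha R N j) x + 1))
       * qpow (((N - j)%:R + 2 * v) * ((dot (alpha R N j) (x + y) - 1) / r%:C))).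

(* :Phi_N(z_1) ... Phi_N(z_n): *)
Definition nPhi (us : seq C) : fop :=
  Fop [seq (N, u) | u <- us] (- epsbar R N N *+ size us)
    (fun x y => kap_iter (size us) (- epsbar R N N) x
       * \prod_(u <- us)
           (sgnpow (- dot (epsbar R N N) x) * qpow (2 * u * - dot (epsbar R N N) x)
            * qpow (2 * u * (dot (epsbar R N N) (x + y) / r%:C)))).

(* :F_l(t_1) ... F_l(t_m):, with the zero modes of the t_a to the right.  The
   exponent m (P+h) - m^2 of q^{(N-l)/r} is the product of those of the F_l(t_a),
   namely sum_{a<m} ((P+h) - 1 - 2a); it is what the absence of q^{N-l} from
   <F_l(t_a) F_l(t_b)> amounts to. *)
Definition nF (l : nat) (vs : seq C) : fop :=
  Fop [seq (l, v) | v <- vs] (- alpha R N l *+ size vs)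
    (fun x y => kap_iter (size vs) (- alpha R N l) x
       * \prod_(v <- vs)
           (qpow (2 * v * (- dot (alpha R N l) x + 1))
            * qpow (2 * v * ((dot (alpha R N l) (x + y) - 1) / r%:C)))
       * qpow ((N - l)%:R * (((size vs)%:R * dot (alpha R N l) (x + y)
                              - (size vs)%:R ^+ 2) / r%:C))).

(** * Vertex operators *)

(* iop_coef times the integral over T^iop_dim of an operator-valued integrand *)
Record iop := Iop {
  iop_dim : nat;
  iop_coef : C;
  iop_fun : (nat -> R) -> fop }.

Definition iop_one : iop := Iop 0 1 (fun=> fone).

Definition iop_mul (A B : iop) : iop :=
  Iop (iop_dim A + iop_dim B)%N (iop_coef A * iop_coef B)
    (fun th => fmul (iop_fun A th) (iop_fun B (fun i => th (iop_dim A + i)%N))).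

Definition iact (A : iop) (Psi : state) : state := fun x y X =>
  iop_coef A * torus_int (iop_dim A) (fun th => act (iop_fun A th) Psi x y X).

Definition phi_fun (mu : nat) (v : nat -> C) (x y : W) : C :=
  \prod_(mu <= m < N)
    ([[v m.+1 - v m + Ph x y mu m.+1 - 2^-1]] * [[1]]
     / ([[v m.+1 - v m + 2^-1]] * [[Ph x y mu m.+1]])).

(* Phi_mu(q^{2u}); for mu = N there is no integration.  The angle of t_m,
   mu <= m < N, is th (m - mu). *)
Definition Phi (aN : nat -> C) (mu : nat) (u : C) : iop :=
  Iop (N - mu)%N (aN mu)
    (fun th =>
       let v (m : nat) := if m == N then u else vang logq (th (m - mu)%N) in
       fop_prod [:: PhiN u;
                 fop_prod [seq Fcur m (v m) | m <- rev (index_iota mu N)];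
                 fzero (phi_fun mu v)]).

Definition phi_comp (aN : nat -> C) (mu : seq nat) (u : nat -> C) : iop :=
  foldr iop_mul iop_one
    [seq Phi aN (nth 0%N mu k) (u k) | k <- iota 0 (size mu)].

(** * Combinatorics.  Positions s in {1, ..., n} and indices a of t^{(l)}_a are
   numbered from 0; levels l and labels mu_s are numbered from 1. *)

Section WeightFunction.
Variables (mu : seq nat) (u : nat -> C).
Local Notation n := (size mu).

Definition card_I (l : nat) : nat := count_mem l mu.
Definition Iset (l : nat) : seq nat := [seq s <- iota 0 n | (nth 0 mu s <= l)%N].
Definition lam (l : nat) : nat := size (Iset l).
Definition ipos (l a : nat) : nat := nth 0%N (Iset l) a.
Definition Mdim : nat := (\sum_(1 <= l < N) lam l)%N.

Definition vx (v : nat -> nat -> C) (l a : nat) : C := if l == N then u a else v l a.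

Definition Cshift (j k s : nat) : C :=
  \sum_(s.+1 <= i < n) ((nth 0%N mu i == j)%:R - (nth 0%N mu i == k)%:R).

Definition U_fun (x y : W) (v : nat -> nat -> C) : C :=
  \prod_(1 <= l < N) \prod_(0 <= a < lam l)
    (let s := ipos l a in
     let b := index s (Iset l.+1) in
     let ms := nth 0%N mu s in
     let D := Ph x y ms l.+1 - Cshift ms l.+1 s in
     ([[vx v l.+1 b - vx v l a + D - 2^-1]] * [[1]]
      / ([[vx v l.+1 b - vx v l a + 2^-1]] * [[D]]))
     * \prod_(0 <= b' < lam l.+1 | (ipos l.+1 b' > s)%N)
         ([[vx v l.+1 b' - vx v l a - 2^-1]] / [[vx v l.+1 b' - vx v l a + 2^-1]])
     * \prod_(a.+1 <= b' < lam l)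
         ([[vx v l a - vx v l b' - 1]] / [[vx v l a - vx v l b']])).

Definition permute_level (l m : nat) (s : 'S_m) (v : nat -> nat -> C)
    (l' a : nat) : C :=
  if l' == l then
    if insub a is Some i then v l (s (i : 'I_m)) else v l a
  else v l' a.

(* Average over the permutations of the variables of level l. *)
Definition Symt (l : nat) (f : (nat -> nat -> C) -> C) (v : nat -> nat -> C) : C :=
  ((lam l)`!%:R)^-1 * \sum_(s : 'S_(lam l)) f (permute_level l s v).

Definition W_fun (x y : W) : (nat -> nat -> C) -> C :=
  foldr Symt (U_fun x y) (index_iota 1 N).

Definition zz (k : nat) : C := qpow (2 * u k).

Definition mu_plus : C :=
  \prod_(0 <= l < n) \prod_(0 <= k < l)
    (sgnpow ((N%:R - 1) / N%:R)
     * qpow (2 * u k * ((r - 1)%:C * (N%:R - 1) / (r%:C * N%:R)))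
     * (eGamma (q ^+ 2 * (zz k / zz l)) p (q ^+ (2 * N))
        / eGamma (q ^+ (2 * N) * (zz k / zz l)) p (q ^+ (2 * N)))).

Definition omega (v : nat -> nat -> C) (x y : W) : C := mu_plus * W_fun x y v.

Definition PhiSym (x y : C) : C :=
  dpoch N logq r (q ^+ 2 * (x / y)) * dpoch N logq r (q ^+ 2 * (y / x))
  / (dpoch N logq r (q ^+ (2 * N) * (x / y)) * dpoch N logq r (q ^+ (2 * N) * (y / x))).

(* <F_l(t_a) F_l(t_b)>^{Sym} for t_a = q^{2v}, t_b = q^{2w} *)
Definition FSym (v w : C) : C :=
  let x := qpow (2 * v) / qpow (2 * w) in
  - qpow ((1 + 2 * v + 2 * w) * (1 - (r%:C)^-1))
  * (poch1 x p * poch1 x^-1 p / (poch1 (p / q ^+ 2 * x) p * poch1 (p / q ^+ 2 / x) p)).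

Definition Phi_tilde (v : nat -> nat -> C) : fop :=
  fscal ((\prod_(0 <= l < n) \prod_(0 <= k < l) PhiSym (zz k) (zz l))
         * \prod_(1 <= l < N) \prod_(0 <= b < lam l) \prod_(0 <= a < b)
             FSym (v l a) (v l b))
    (fmul (nPhi [seq u k | k <- iota 0 n])
       (fop_prod [seq nF l [seq v l a | a <- iota 0 (lam l)] | l <- rev (index_iota 1 N)])).

(* The operator  oint_{T^M} dt Phi_tilde(t,z) omega(t,z,Pi).  The integration
   variables t^{(l)}_a are numbered lexicographically in (l, a). *)
Definition phi_integral (aN : nat -> C) : iop :=
  Iop Mdim (\prod_(j <- mu) aN j)
    (fun th =>
       let v l a := vang logq (th (\sum_(1 <= l' < l) lam l' + a)%N) in
       fmul (Phi_tilde v) (fzero (omega v))).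

End WeightFunction.

End Bosonization.

(* Main.v *)
Require Import Defs.
From HB Require Import structures.
From mathcomp Require Import all_boot all_order all_algebra fingroup perm.
From mathcomp Require Import complex ring lra zify.
From mathcomp Require Import all_classical all_reals all_analysis measurable_realfun.

Import Order.TTheory GRing.Theory Num.Theory.
Import numFieldNormedType.Exports.

Set Implicit Arguments.
Unset Strict Implicit.
Unset Printing Implicit Defensive.

Local Open Scope classical_set_scope.
Local Open Scope complex_scope.
Local Open Scope ring_scope.

(** The product of the vertex operators is an integral of a word in the currents Phi_N and
F_l, multiplied on the right by dynamical factors. Sorting the word by level gives the
normal ordered product, and the factors produced by the sorting are, up to
symmetrization, the integrand of the theorem.

Scalars. Moving one current past another multiplies the coefficient by a contraction, which
is the continuation of the exponential of a series in the modes. The series are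
logarithms of products of factors 1 - c x, so that the contractions are quotients of
q-products ([contr_far], [contr_adj], [contr_same], [contr_NN]); they are in lowest terms
because r is irrational. Shift equations of these products turn the ratio of two orders of
a pair of currents into the theta functions of the statement, together with the zero modes
and the commutation factor of the lattice operators ([same_level], [adj_exchange],
[far_exchange], [NN_pair]).

Sorting. A current is labelled by its level l and by the position k of its vertex operator.
The coefficient of a word is a cocycle, a product over pairs of letters, and the zero modes
([zcoef_word]). The product of the vertex operators lists the labels by k, the
normal ordered product lists them by decreasing l, and the pairs that are reversed are
those for which the factors [v - w - 1/2] / [v - w + 1/2] occur in U
([pair_factorE], [pairprod_factor]). The shifts C of the dynamical variables are the weights of the
vertex operators on the right. Hence the two integrands agree, before symmetrization, at all
points of the torus where no function exchanged between levels N and N - 1 vanishes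
([pointwise]). On each of the circles finitely many points are excluded ([finite_bad]).

Integration. On the torus the integrand is measurable and bounded ([nice_act]): the
q-products are bounded away from 0 on circles without zeros ([linf_circle_ge]), the
hypothesis on the contour excludes the poles at |z_k| = |q|, and those at |z_k| = |p / q| are
cancelled by a zero of a contraction ([nice_pole]). Fubini then permits any order of the
variables ([tint_perm], [perm_code]), and the normal ordered product with symmetric
contractions does not change when variables of one level are permuted
([Phi_tilde_sym]). Therefore U may be averaged over these permutations ([tint_Symts]). *)


(** * Moduli, limits and the exponential *)

Section ComplexModulus.
Variable R : realType.
Local Notation C := R[i].

Implicit Types (w : nat -> C) (l : C).

Definition cabs (z : C) : R := complex.Re `|z|.

Lemma cabsE z : `|z| = (cabs z)%:C.
Proof. by rewrite /cabs normc_def. Qed.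

Lemma cabs_ge0 z : 0 <= cabs z.
Proof. by rewrite -ler0c -cabsE normr_ge0. Qed.

Lemma cabsM x y : cabs (x * y) = cabs x * cabs y.
Proof. by apply: complexI; rewrite rmorphM /= -!cabsE normrM. Qed.

Lemma cabs_triangle x y : cabs (x + y) <= cabs x + cabs y.
Proof. by rewrite -lecR rmorphD /= -!cabsE ler_normD. Qed.

Lemma cabs0 : cabs 0 = 0.
Proof. by apply: complexI; rewrite -cabsE normr0. Qed.

Lemma cabs1 : cabs 1 = 1.
Proof. by apply: complexI; rewrite -cabsE normr1. Qed.

Lemma cabsN x : cabs (- x) = cabs x.
Proof. by apply: complexI; rewrite -!cabsE normrN. Qed.

Lemma cabsBC x y : cabs (x - y) = cabs (y - x).
Proof. by rewrite -cabsN opprB. Qed.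

Lemma cabsV x : cabs x^-1 = (cabs x)^-1.
Proof. by apply: complexI; rewrite -cabsE normfV cabsE fmorphV. Qed.

Lemma cabsX x n : cabs (x ^+ n) = cabs x ^+ n.
Proof. by apply: complexI; rewrite -cabsE normrX cabsE rmorphXn. Qed.

Lemma cabs_eq0 x : (cabs x == 0) = (x == 0).
Proof. by rewrite -(inj_eq (@complexI R)) -cabsE normr_eq0. Qed.

Lemma cabs_gt0 x : (0 < cabs x) = (x != 0).
Proof. by rewrite lt_neqAle cabs_ge0 andbT eq_sym cabs_eq0. Qed.

Lemma cabs_real (x : R) : cabs x%:C = `|x|.
Proof. by rewrite /cabs normc_def /= expr0n /= addr0 sqrtr_sqr. Qed.

Lemma cabs_nat n : cabs n%:R = n%:R.
Proof. by rewrite -(rmorph_nat (real_complex R)) cabs_real ger0_norm. Qed.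

Lemma cabs_sqr z : cabs z ^+ 2 = complex.Re z ^+ 2 + complex.Im z ^+ 2.
Proof. by apply: complexI; rewrite rmorphXn /= -cabsE add_Re2_Im2. Qed.

Lemma Re_le_cabs z : `|complex.Re z| <= cabs z.
Proof.
rewrite -(ler_pXn2r (n := 2)) ?nnegrE ?cabs_ge0 // real_normK ?num_real //.
by rewrite cabs_sqr lerDl sqr_ge0.
Qed.

Lemma Im_le_cabs z : `|complex.Im z| <= cabs z.
Proof.
rewrite -(ler_pXn2r (n := 2)) ?nnegrE ?cabs_ge0 // real_normK ?num_real //.
by rewrite cabs_sqr lerDr sqr_ge0.
Qed.

Lemma cabs_le z : cabs z <= `|complex.Re z| + `|complex.Im z|.
Proof.
rewrite -(ler_pXn2r (n := 2)) ?nnegrE ?cabs_ge0 ?addr_ge0 //.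
rewrite cabs_sqr sqrrD !real_normK ?num_real // -addrA lerD2l lerDr.
by rewrite mulrn_wge0 // mulr_ge0.
Qed.

Lemma cabs_sum (I : Type) (s : seq I) (P : pred I) (F : I -> C) :
  cabs (\sum_(i <- s | P i) F i) <= \sum_(i <- s | P i) cabs (F i).
Proof.
elim/big_ind2 : _ => [|x1 x2 y1 y2 h1 h2|//]; first by rewrite cabs0.
by apply: le_trans (cabs_triangle _ _) _; exact: lerD.
Qed.

Lemma cabs_prod (I : Type) (s : seq I) (P : pred I) (F : I -> C) :
  cabs (\prod_(i <- s | P i) F i) = \prod_(i <- s | P i) cabs (F i).
Proof. by apply: (big_morph cabs cabsM cabs1). Qed.

Lemma cabs_lower x y : cabs x - cabs y <= cabs (x - y).
Proof.
by rewrite lerBlDr; apply: le_trans (cabs_triangle _ _); rewrite subrK.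
Qed.

Lemma ReD (x y : C) : complex.Re (x + y) = complex.Re x + complex.Re y.
Proof. by case: x; case: y. Qed.
Lemma ImD (x y : C) : complex.Im (x + y) = complex.Im x + complex.Im y.
Proof. by case: x; case: y. Qed.
Lemma ReN (x : C) : complex.Re (- x) = - complex.Re x.
Proof. by case: x. Qed.
Lemma ImN (x : C) : complex.Im (- x) = - complex.Im x.
Proof. by case: x. Qed.
Lemma ReM (x y : C) : complex.Re (x * y) =
  complex.Re x * complex.Re y - complex.Im x * complex.Im y.
Proof. by case: x; case: y. Qed.
Lemma ImM (x y : C) : complex.Im (x * y) =
  complex.Re x * complex.Im y + complex.Im x * complex.Re y.
Proof. by case: x; case: y. Qed.

Lemma eq_ReIm (x y : C) : complex.Re x = complex.Re y ->
  complex.Im x = complex.Im y -> x = y.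
Proof. by case: x => a b; case: y => c d /= -> ->. Qed.

Lemma ccvgP (w : nat -> C) l :
  ccvg w l <-> (fun k => cabs (w k - l)) @ \oo --> (0 : R).
Proof.
split => [[hr hi]|h].
- have h1 : (fun k => `|complex.Re (w k) - complex.Re l|
               + `|complex.Im (w k) - complex.Im l|) @ \oo --> (0 : R).
    rewrite -(addr0 (0 : R)); apply: cvgD; rewrite -(normr0 R); apply: cvg_norm.
    - by rewrite -(subrr (complex.Re l)); apply: cvgB => //; exact: cvg_cst.
    - by rewrite -(subrr (complex.Im l)); apply: cvgB => //; exact: cvg_cst.
  apply: (squeeze_cvgr _ (cvg_cst (0 : R)) h1).
  near=> k; rewrite cabs_ge0 /=; apply: le_trans (cabs_le _) _.
  by rewrite ReD ImD ReN ImN.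
- have aux (f : nat -> R) (a : R) : (forall k, `|f k - a| <= cabs (w k - l)) ->
    f @ \oo --> a.
    move=> hf; apply/cvgrPdist_le => e e0.
    move/cvgr0Pnorm_le : h => /(_ e e0) [K _ hK]; exists K => // k Kk /=.
    rewrite distrC; apply: le_trans (hf k) _.
    by move: (hK k Kk) => /=; rewrite ger0_norm ?cabs_ge0.
  split; apply: aux => k.
  - by rewrite -ReN -ReD Re_le_cabs.
  - by rewrite -ImN -ImD Im_le_cabs.
Unshelve. all: by end_near.
Qed.

Lemma ccvg_clim w l : ccvg w l -> clim w = l.
Proof.
by case: l => a b [/= h1 h2]; rewrite /clim; congr Complex;
  apply: cvg_lim => //; exact: norm_hausdorff.
Qed.

Lemma ccvg_unique w l l' : ccvg w l -> ccvg w l' -> l = l'.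
Proof. by move=> /ccvg_clim <- /ccvg_clim. Qed.

Lemma ccvg_le w l (b : nat -> R) : (forall k, cabs (w k - l) <= b k) ->
  b @ \oo --> (0 : R) -> ccvg w l.
Proof.
move=> hb b0; apply/ccvgP; apply: (squeeze_cvgr _ (cvg_cst (0 : R)) b0).
by near=> k; rewrite cabs_ge0 hb.
Unshelve. all: by end_near.
Qed.

Lemma ccvg_cst (c : C) : ccvg (fun=> c) c.
Proof. by split; exact: cvg_cst. Qed.

Lemma ccvgD w l (w' : nat -> C) l' : ccvg w l -> ccvg w' l' -> ccvg (fun k => w k + w' k) (l + l').
Proof.
move=> [h1 h2] [h3 h4]; split.
- by rewrite ReD; under eq_fun do rewrite ReD; exact: cvgD.
- by rewrite ImD; under eq_fun do rewrite ImD; exact: cvgD.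
Qed.

Lemma ccvgN w l : ccvg w l -> ccvg (fun k => - w k) (- l).
Proof.
move=> [h1 h2]; split.
- by rewrite ReN; under eq_fun do rewrite ReN; exact: cvgN.
- by rewrite ImN; under eq_fun do rewrite ImN; exact: cvgN.
Qed.

Lemma ccvgM w l (w' : nat -> C) l' : ccvg w l -> ccvg w' l' -> ccvg (fun k => w k * w' k) (l * l').
Proof.
move=> [h1 h2] [h3 h4]; split.
- rewrite ReM; under eq_fun do rewrite ReM.
  by apply: cvgB; apply: cvgM.
- rewrite ImM; under eq_fun do rewrite ImM.
  by apply: cvgD; apply: cvgM.
Qed.

Lemma ccvg_sum (I : Type) (s : seq I) (w : I -> nat -> C) (l : I -> C) :
  (forall i, ccvg (w i) (l i)) -> ccvg (fun k => \sum_(i <- s) w i k) (\sum_(i <- s) l i).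
Proof.
move=> h; elim: s => [|i s IH].
  by rewrite big_nil; under eq_fun do rewrite big_nil; exact: ccvg_cst.
by rewrite big_cons; under eq_fun do rewrite big_cons; exact: ccvgD.
Qed.

Lemma ccvg_shift w l n : ccvg w l -> ccvg (fun k => w (k + n)%N) l.
Proof. by move=> [h1 h2]; split; rewrite (cvg_shiftn n (fun k => _ (w k))). Qed.

Lemma ccvg_unshift w l n : ccvg (fun k => w (k + n)%N) l -> ccvg w l.
Proof. by move=> [h1 h2]; split; rewrite -(cvg_shiftn n (fun k => _ (w k))). Qed.

Lemma ccvg_cabs w l : ccvg w l -> (fun k => cabs (w k)) @ \oo --> cabs l.
Proof.
move=> /ccvgP h; apply/cvgrPdist_le => e e0.
move/cvgr0Pnorm_le : h => /(_ e e0) [K _ hK]; exists K => // k Kk /=.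
have := hK k Kk; rewrite /= ger0_norm ?cabs_ge0 //; apply: le_trans.
by rewrite ler_norml lerNl opprB cabs_lower [X in _ <= X]cabsBC cabs_lower.
Qed.

Lemma ccvg_cabs_le w l b : ccvg w l -> (forall k, cabs (w k) <= b) -> cabs l <= b.
Proof.
by move=> /ccvg_cabs h hb; apply: (cvgr_to_le h); exact: nearW.
Qed.

Lemma ccvg_cabs_ge w l b : ccvg w l -> (forall k, b <= cabs (w k)) -> b <= cabs l.
Proof.
by move=> /ccvg_cabs h hb; apply: (cvgr_to_ge h); exact: nearW.
Qed.

(** The real sequence d is increasing and bounded, hence Cauchy, and so is w; the rate of
   convergence is the limit of cabs (w (k + m) - w k) <= d (k + m) - d k. *)
Lemma dominated_ccvg (w : nat -> C) (d : nat -> R) (S : R) :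
  (forall k, cabs (w k.+1 - w k) <= d k.+1 - d k) -> (forall k, d k <= S) ->
  exists l D, [/\ ccvg w l, d @ \oo --> D & forall k, cabs (l - w k) <= D - d k].
Proof.
move=> hw hS.
have nd : nondecreasing_seq d.
  by apply/nondecreasing_seqP => k; rewrite -subr_ge0; apply: le_trans (hw k); exact: cabs_ge0.
have hd : d @ \oo --> limn d.
  apply: nondecreasing_is_cvgn => //.
  by exists S => _ [k _ <-]; exact: hS.
have hwd k m : cabs (w (k + m)%N - w k) <= d (k + m)%N - d k.
  elim: m => [|m IH]; first by rewrite addn0 !subrr cabs0.
  rewrite addnS.
  rewrite (_ : w (k + m).+1 - _ = (w (k + m).+1 - w (k + m)%N) + (w (k + m)%N - w k)); last by ring.
  apply: le_trans (cabs_triangle _ _) _.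
  rewrite (_ : d (k + m).+1 - _ = (d (k + m).+1 - d (k + m)%N) + (d (k + m)%N - d k)); last by ring.
  exact: lerD.
have aux (f : C -> R) : (forall x y, f (x - y) = f x - f y) ->
    (forall x, `|f x| <= cabs x) -> cvgn (fun k => f (w k)).
  move=> fB fle; apply: cauchy_cvg; apply/cauchy_exP => e e0.
  move/cvgrPdist_lt : hd => /(_ (e / 2)); rewrite divr_gt0 // => /(_ isT) [K _ hK].
  exists (f (w K)); exists K => // k /= Kk.
  rewrite /ball /= distrC -fB; apply: le_lt_trans (fle _) _.
  rewrite -(subnKC Kk); apply: le_lt_trans (hwd _ _) _; rewrite subnKC //.
  have := hK K (leqnn _); have := hK k Kk; rewrite /= !ltr_norml => /andP[a1 a2] /andP[a3 a4].
  lra.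
have cre := aux _ (fun x y => etrans (ReD _ _) (congr1 _ (ReN y))) Re_le_cabs.
have cim := aux _ (fun x y => etrans (ImD _ _) (congr1 _ (ImN y))) Im_le_cabs.
have cw : ccvg w (clim w) by split.
exists (clim w), (limn d); split => // k.
apply: (@ccvg_cabs_le (fun m => w (k + m)%N - w k)).
  apply: ccvgD; last exact: ccvg_cst.
  by under eq_fun do rewrite addnC; exact: ccvg_shift.
move=> m; apply: le_trans (hwd k m) _; rewrite lerD2r.
exact: nondecreasing_cvgn_le.
Qed.

Lemma cexp0 : cexp (0 : C) = 1.
Proof. by rewrite /cexp /= expR0 cos0 sin0 mulr1 mulr0. Qed.

Lemma cexpD (x y : C) : cexp (x + y) = cexp x * cexp y.
Proof.
rewrite /cexp ReD ImD expRD cosD sinD; apply: eq_ReIm; rewrite ?ReM ?ImM /=; ring.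
Qed.

Lemma cexp_neq0 (x : C) : cexp x != 0.
Proof.
apply/negP => /eqP h; have := cexpD x (- x).
by rewrite subrr cexp0 h mul0r => /eqP; rewrite oner_eq0.
Qed.

Lemma cexpN (x : C) : cexp (- x) = (cexp x)^-1.
Proof.
by apply: (mulfI (cexp_neq0 x)); rewrite -cexpD subrr cexp0 mulfV ?cexp_neq0.
Qed.

Lemma cexp_sum (I : Type) (s : seq I) (F : I -> C) :
  cexp (\sum_(i <- s) F i) = \prod_(i <- s) cexp (F i).
Proof. by apply: (big_morph _ cexpD cexp0). Qed.

Lemma cexpMn (x : C) n : cexp (n%:R * x) = cexp x ^+ n.
Proof.
elim: n => [|n IH]; first by rewrite mul0r cexp0 expr0.
by rewrite -natr1 mulrDl mul1r cexpD IH exprSr.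
Qed.

Lemma cabs_cexp (x : C) : cabs (cexp x) = expR (complex.Re x).
Proof.
apply/eqP; rewrite -(eqrXn2 (n := 2)) ?cabs_ge0 ?expR_ge0 //.
by rewrite cabs_sqr /cexp /= !exprMn -mulrDr cos2Dsin2 mulr1.
Qed.

Lemma ccvg_cexp w (l : C) : ccvg w l -> ccvg (fun k => cexp (w k)) (cexp l).
Proof.
move=> [h1 h2]; split => /=; apply: cvgM.
- by apply: (continuous_cvg _ _ h1); exact: continuous_expR.
- by apply: (continuous_cvg _ _ h2); exact: continuous_cos.
- by apply: (continuous_cvg _ _ h1); exact: continuous_expR.
- by apply: (continuous_cvg _ _ h2); exact: continuous_sin.
Qed.

End ComplexModulus.

(** * A local logarithm *)

Section ComplexLog.
Variable R : realType.
Local Notation C := R[i].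

Lemma is_cvg_pseries_le (f : nat -> R) :
  (forall m, `|f m| <= m.+1%:R * (8^-1) ^+ m) -> cvgn (pseries f 2).
Proof.
move=> hf; apply: normed_cvg.
apply: (@series_le_cvg _ _ (geometric 1 (2^-1))) => [n|n|n|] /=.
- exact: normr_ge0.
- by rewrite mul1r exprn_ge0 // invr_ge0.
- rewrite mul1r normrM normrX (ger0_norm (_ : 0 <= 2)) //.
  apply: (@le_trans _ _ ((n.+1%:R * 8^-1 ^+ n) * 2 ^+ n)).
    by rewrite ler_wpM2r ?exprn_ge0.
  rewrite -mulrA -exprMn (_ : 8^-1 * 2 = 2^-1 * 2^-1 :> R); last by field.
  rewrite exprMn mulrA ler_piMl ?exprn_ge0 ?invr_ge0 //.
  rewrite exprVn ler_pdivrMr ?exprn_gt0 // mul1r -natrX ler_nat.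
  exact: ltn_expl.
- by apply: is_cvg_geometric_series; rewrite ger0_norm ?invr_ge0 // invf_lt1 // ltr1n.
Qed.

Section Log.
Variable (y : C).
Hypothesis y8 : cabs y <= 8^-1.

(* [f] stands for the real or for the imaginary part. *)
Section Part.
Variable f : C -> R.
Hypothesis fle : forall x, `|f x| <= cabs x.

Definition log_coef (m : nat) : R := f (y ^+ m) / m%:R.

Lemma cabs_pow_le m n : (m <= n)%N -> cabs (y ^+ n) <= 8^-1 ^+ m.
Proof.
move=> mn; rewrite cabsX; apply: (@le_trans _ _ (8^-1 ^+ n)).
  by rewrite lerXn2r ?nnegrE ?cabs_ge0 ?invr_ge0.
by rewrite ler_wiXn2l // ?invr_ge0 // invf_le1 // ler1n.
Qed.

Lemma coef_le (m j : nat) (c : R) : 0 <= c -> c <= m.+1%:R -> (m <= j)%N ->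
  `|c * f (y ^+ j)| <= m.+1%:R * 8^-1 ^+ m.
Proof.
move=> c0 cm mj; rewrite normrM ger0_norm //; apply: ler_pM => //.
by apply: le_trans (fle _) _; exact: cabs_pow_le.
Qed.

Lemma log_coef_diffs : pseries_diffs log_coef = (fun m => f (y ^+ m.+1)).
Proof. by apply/funext => m; rewrite /pseries_diffs /log_coef mulrC divfK. Qed.

Lemma is_derive_log_series (s : R) : `|s| < 2 ->
  is_derive s (1 : R) (fun x => limn (pseries log_coef x))
    (limn (pseries (fun m => f (y ^+ m.+1)) s)).
Proof.
move=> s2; rewrite -log_coef_diffs; apply: (@pseries_snd_diffs _ _ 2).
- apply: is_cvg_pseries_le => m; rewrite /log_coef mulrC; apply: coef_le => //.
  by case: m => [|m]; rewrite ?invr0 //; apply: (@le_trans _ _ 1); rewrite ?invf_le1 ?ler1n.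
- apply: is_cvg_pseries_le => m; rewrite log_coef_diffs -[f _]mul1r.
  by apply: coef_le; rewrite ?ler1n.
- apply: is_cvg_pseries_le => m; rewrite log_coef_diffs /pseries_diffs.
  by apply: coef_le => //; exact: leqW.
- by rewrite (ger0_norm (_ : 0 <= 2)).
Qed.
End Part.

Lemma geom_den_neq0 (s : R) : `|s| < 2 -> 1 - s%:C * y != 0.
Proof.
move=> s2; rewrite subr_eq0 eq_sym; apply/negP => /eqP e.
have := congr1 (@cabs R) e; rewrite cabsM cabs_real cabs1.
have := cabs_ge0 y; have := normr_ge0 s; move: y8; nra.
Qed.

Lemma ccvg_geom (s : R) : `|s| < 2 ->
  ccvg (fun n => \sum_(0 <= m < n) y ^+ m.+1 * s%:C ^+ m) (y / (1 - s%:C * y)).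
Proof.
move=> s2; have nz := geom_den_neq0 s2.
have e n : \sum_(0 <= m < n) y ^+ m.+1 * s%:C ^+ m =
   y / (1 - s%:C * y) + (- (y / (1 - s%:C * y))) * (s%:C * y) ^+ n.
  apply: (mulIf nz); rewrite mulrDl !mulNr divfK // mulrAC divfK //.
  elim: n => [|n IH]; first by rewrite big_nil mul0r expr0 mulr1 subrr.
  by rewrite big_nat_recr //= mulrDl IH !exprS !exprMn; ring.
under eq_fun do rewrite e.
rewrite -[X in ccvg _ X]addr0; apply: ccvgD; first exact: ccvg_cst.
rewrite -(mulr0 (- (y / (1 - s%:C * y)))); apply: ccvgM; first exact: ccvg_cst.
apply: (@ccvg_le _ _ _ (fun n => 2^-1 ^+ n)); last first.
  have := @cvg_geometric R 1 2^-1; rewrite /geometric /=.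
  under eq_fun do rewrite mul1r.
  by apply; rewrite ger0_norm ?invr_ge0 // invf_lt1 // ltr1n.
move=> n; rewrite subr0 cabsX lerXn2r ?nnegrE ?cabs_ge0 ?invr_ge0 //.
rewrite cabsM cabs_real; move: (cabs_ge0 y) (normr_ge0 s) y8; nra.
Qed.

Lemma lim_Re_geom (s : R) : `|s| < 2 ->
  limn (pseries (fun m => complex.Re (y ^+ m.+1)) s) = complex.Re (y / (1 - s%:C * y)).
Proof.
move=> s2; apply: cvg_lim; first exact: norm_hausdorff.
have [h _] := ccvg_geom s2; apply: cvg_trans h; apply: near_eq_cvg; apply: nearW => n /=.
rewrite (big_morph _ (@ReD R) (erefl : complex.Re 0 = 0)); apply: eq_bigr => i _.
by rewrite ReM -rmorphXn /= mulr0 subr0.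
Qed.

Lemma lim_Im_geom (s : R) : `|s| < 2 ->
  limn (pseries (fun m => complex.Im (y ^+ m.+1)) s) = complex.Im (y / (1 - s%:C * y)).
Proof.
move=> s2; apply: cvg_lim; first exact: norm_hausdorff.
have [_ h] := ccvg_geom s2; apply: cvg_trans h; apply: near_eq_cvg; apply: nearW => n /=.
rewrite (big_morph _ (@ImD R) (erefl : complex.Im 0 = 0)); apply: eq_bigr => i _.
by rewrite ImM -rmorphXn /= mulr0 add0r.
Qed.

Local Notation Lr := (fun s => limn (pseries (log_coef (@complex.Re R)) s)).
Local Notation Li := (fun s => limn (pseries (log_coef (@complex.Im R)) s)).

(** Along the segment from 0 to y, the function (1 - s y) exp (L (s y)) has zero
   derivative, L being the logarithmic series; h is its real part for (a, b) = (1, 0) and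
   its imaginary part for (a, b) = (0, -1). *)
Lemma log_series_ode (h : R -> R) (a b : R) :
  (forall s, h s = (a * (1 - s * complex.Re y) + b * (s * complex.Im y)) * (expR (Lr s) * cos (Li s))
     + (a * (s * complex.Im y) - b * (1 - s * complex.Re y)) * (expR (Lr s) * sin (Li s))) ->
  h 1 = h 0.
Proof.
move=> hE.
have dh s : `|s| < 2 -> is_derive s (1 : R) h 0.
  move=> s2.
  have d1 := is_derive_log_series (@Re_le_cabs R) s2; rewrite lim_Re_geom // in d1.
  have d2 := is_derive_log_series (@Im_le_cabs R) s2; rewrite lim_Im_geom // in d2.
  have dE : is_derive s (1 : R) (expR \o Lr) _ := is_derive1_comp (is_derive_expR (Lr s)) d1.
  have dC : is_derive s (1 : R) (cos \o Li) _ := is_derive1_comp (is_derive_cos (Li s)) d2.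
  have dS : is_derive s (1 : R) (sin \o Li) _ := is_derive1_comp (is_derive_sin (Li s)) d2.
  have dx := @is_derive_id R R s 1.
  have dl c0 c1 : is_derive s (1 : R) (cst c0 + c1 \*: (@id R)) (0 + c1 *: 1).
    exact: is_deriveD.
  have dt := is_deriveD (is_deriveM (dl a (- a * complex.Re y + b * complex.Im y)) (is_deriveM dE dC))
    (is_deriveM (dl (- b) (a * complex.Im y + b * complex.Re y)) (is_deriveM dE dS)).
  have -> : h = (cst a + (- a * complex.Re y + b * complex.Im y) \*: @id R) * ((expR \o Lr) * (cos \o Li))
      + (cst (- b) + (a * complex.Im y + b * complex.Re y) \*: @id R) * ((expR \o Lr) * (sin \o Li)).
    apply/funext => x; rewrite hE.
    rewrite !(fctE) /= /GRing.scale /=; ring.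
  apply: is_derive_eq.
  have := geom_den_neq0 s2.
  set w := y / (1 - s%:C * y) => nz.
  have e : y = w * (1 - s%:C * y) by rewrite /w divfK.
  clearbody w; have e1 := congr1 (@complex.Re R) e; have e2 := congr1 (@complex.Im R) e.
  move: e1 e2; rewrite (ReM w) (ImM w) !ReD !ImD !ReN !ImN (ReM s%:C) (ImM s%:C) /=.
  move: (complex.Re w) (complex.Im w) (complex.Re y) (complex.Im y) => dr di a0 b0 e1 e2.
  rewrite !fctE /= /GRing.scale /=.
  have e1' : dr * (1 - s * a0) + di * (s * b0) = a0 by rewrite [RHS]e1; ring.
  have e2' : di * (1 - s * a0) - dr * (s * b0) = b0 by rewrite [RHS]e2; ring.
  move: (expR _) (cos _) (sin _) => Ex co si.
  transitivity (Ex * (co * (a * ((dr * (1 - s * a0) + di * (s * b0)) - a0)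
      + b * (b0 - (di * (1 - s * a0) - dr * (s * b0))))
    + si * (a * (b0 - (di * (1 - s * a0) - dr * (s * b0)))
      + b * (a0 - (dr * (1 - s * a0) + di * (s * b0)))))); first by ring.
  by rewrite e1' e2' !subrr !mulr0 addr0 mulr0 mulr0 addr0 mulr0.
have cont : {within `[0, 1], continuous h}.
  apply: derivable_within_continuous => s; rewrite in_itv /= => /andP[s0 s1].
  have s2 : `|s| < 2 by rewrite ger0_norm //; lra.
  by case: (dh s s2).
have [|c _] := @MVT R h (fun=> 0) 0 1 ltr01 _ cont.
  move=> s; rewrite in_itv /= => /andP[s0 s1]; apply: dh.
  by rewrite ger0_norm ?(ltW s0) //; lra.
by rewrite mul0r => /eqP; rewrite subr_eq0 => /eqP.
Qed.

Lemma log_series0 (f : C -> R) : limn (pseries (log_coef f) 0) = 0.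
Proof.
apply: cvg_lim; first exact: norm_hausdorff.
have -> : pseries (log_coef f) 0 = cst 0; last exact: cvg_cst.
apply/funext => n; rewrite /pseries /series /=; apply: big1 => i _.
by rewrite /log_coef; case: i => [|i]; rewrite ?invr0 ?mulr0 ?mul0r // expr0n /= mulr0.
Qed.

Lemma complex_log : exists2 l : C,
  ccvg (fun n => \sum_(1 <= m < n) y ^+ m / m%:R) l & 1 - y = cexp (- l).
Proof.
have cv (f : C -> R) : (forall x, `|f x| <= cabs x) -> cvgn (pseries (log_coef f) 1).
  move=> fle; apply: (@is_cvg_pseries_inside _ _ 2); last first.
    by rewrite normr1 ger0_norm // ltr1n.
  apply: is_cvg_pseries_le => m; rewrite /log_coef mulrC; apply: coef_le => //.
  by case: m => [|m]; rewrite ?invr0 //; apply: (@le_trans _ _ 1); rewrite ?invf_le1 ?ler1n.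
have ps (f : C -> R) (f0 : f 0 = 0) (fD : {morph f : x y / x + y})
   (fZ : forall (x : R) z, f (x%:C * z) = x * f z) :
   pseries (log_coef f) 1 = (fun n => f (\sum_(1 <= m < n) y ^+ m / m%:R)).
  apply/funext => n; rewrite /pseries /series /= (big_morph _ fD f0).
  case: n => [|n]; first by rewrite !big_geq.
  rewrite big_ltn // {1}/log_coef invr0 mulr0 mul0r add0r; apply: eq_bigr => i _.
  rewrite expr1n mulr1 /log_coef.
  have -> : y ^+ i / i%:R = (i%:R^-1)%:C * y ^+ i by rewrite mulrC fmorphV rmorph_nat.
  by rewrite fZ mulrC.
have pr := ps (@complex.Re R) erefl (@ReD R) _.
have pi := ps (@complex.Im R) erefl (@ImD R) _.
exists (Lr 1 +i* Li 1).
  split => /=.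
  - by rewrite pr; [rewrite -pr; [exact: cv (@Re_le_cabs R)|]|];
      move=> x z; rewrite ReM /= mul0r subr0.
  - by rewrite pi; [rewrite -pi; [exact: cv (@Im_le_cabs R)|]|];
      move=> x z; rewrite ImM /= mul0r addr0.
have E : (1 - y) * cexp (Lr 1 +i* Li 1) = 1.
  apply: eq_ReIm.
  - have := @log_series_ode (fun s => (1 * (1 - s * complex.Re y) + 0 * (s * complex.Im y)) * (expR (Lr s) * cos (Li s))
     + (1 * (s * complex.Im y) - 0 * (1 - s * complex.Re y)) * (expR (Lr s) * sin (Li s))) 1 0 (fun=> erefl).
    rewrite /= !log_series0 expR0 cos0 sin0 ReM ReD ImD ReN ImN /= => e.
    apply: etrans _ (etrans e _); ring.
  - have := @log_series_ode (fun s => (0 * (1 - s * complex.Re y) + (-1) * (s * complex.Im y)) * (expR (Lr s) * cos (Li s))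
     + (0 * (s * complex.Im y) - (-1) * (1 - s * complex.Re y)) * (expR (Lr s) * sin (Li s))) 0 (-1) (fun=> erefl).
    rewrite /= !log_series0 expR0 cos0 sin0 ImM ReD ImD ReN ImN /= => e.
    apply: etrans _ (etrans e _); ring.
by rewrite cexpN -[LHS](mulfK (cexp_neq0 (Lr 1 +i* Li 1))) E mul1r.
Qed.

End Log.
End ComplexLog.

(** * Infinite products *)

Section InfiniteProducts.
Variable R : realType.
Local Notation C := R[i].
Implicit Types (a b : nat -> seq C) (x : C).

Definition mass a (K : nat) : R := \sum_(j < K) \sum_(c <- a j) cabs c.
Definition summable a : Prop := exists S, forall K, mass a K <= S.
(** The factors are grouped in finite layers, so that simple products and double products
   truncated to squares are both sequences of partial products of this form. *)
Definition lprod a (K : nat) x : C := \prod_(j < K) \prod_(c <- a j) (1 - c * x).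
Definition linf a x : C := clim (fun K => lprod a K x).

Lemma massS a K : mass a K.+1 = mass a K + \sum_(c <- a K) cabs c.
Proof. by rewrite /mass big_ord_recr. Qed.

Lemma mass_ge0 a K : 0 <= mass a K.
Proof. by apply: sumr_ge0 => j _; apply: sumr_ge0 => c _; exact: cabs_ge0. Qed.

Lemma mass_nd a : nondecreasing_seq (mass a).
Proof.
apply/nondecreasing_seqP => K; rewrite massS lerDl.
by apply: sumr_ge0 => c _; exact: cabs_ge0.
Qed.

Lemma lprodS a K x : lprod a K.+1 x = lprod a K x * \prod_(c <- a K) (1 - c * x).
Proof. by rewrite /lprod big_ord_recr. Qed.

Lemma mem_le_mass a j c : c \in a j -> cabs c <= mass a j.+1.
Proof.
move=> ca; rewrite massS; apply: (@le_trans _ _ (\sum_(c <- a j) cabs c)); last first.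
  by rewrite lerDr mass_ge0.
by rewrite (big_rem c) //= lerDl; apply: sumr_ge0 => d _; exact: cabs_ge0.
Qed.

Lemma ler_of_ccvg (w : nat -> C) l (d : nat -> R) (D : R) : ccvg w l -> d @ \oo --> D ->
  (forall k, cabs (w k) <= d k) -> cabs l <= D.
Proof.
move=> /ccvg_cabs hw hd h; rewrite -subr_ge0.
by apply: (cvgr_to_ge (cvgB hd hw)); apply: nearW => k; rewrite subr_ge0.
Qed.


(** Coefficientwise domination reduces estimates of products of factors 1 - c x to those of
   the real products of factors 1 + |c| x. *)
Definition majorizes (P : {poly C}) (D : {poly R}) := forall i, cabs P`_i <= D`_i.

Lemma majorizesM P D P' D' : majorizes P D -> majorizes P' D' ->
  majorizes (P * P') (D * D').
Proof.
move=> h h' i; rewrite !coefM; apply: le_trans (cabs_sum _ _ _) _.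
by apply: ler_sum => j _; rewrite cabsM; apply: ler_pM; rewrite ?cabs_ge0.
Qed.

Lemma majorizesD P D P' D' : majorizes P D -> majorizes P' D' ->
  majorizes (P + P') (D + D').
Proof.
by move=> h h' i; rewrite !coefD; apply: le_trans (cabs_triangle _ _) _; exact: lerD.
Qed.

Lemma majorizes1 : majorizes 1 1.
Proof. by move=> i; rewrite !coef1 cabs_nat. Qed.

Lemma majorizesZX c : majorizes (- c *: 'X) (cabs c *: 'X).
Proof. by move=> i; rewrite !coefZ !coefX cabsM cabsN cabs_nat. Qed.

Lemma majorizes_tail P D n x : majorizes P D ->
  cabs (P.[x] - \sum_(i < n) P`_i * x ^+ i)
  <= D.[cabs x] - \sum_(i < n) D`_i * cabs x ^+ i.
Proof.
move=> h; pose m := maxn n (maxn (size P) (size D)).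
have nm : (n <= m)%N by rewrite leq_maxl.
rewrite (@horner_coef_wide _ m P) ?(@horner_coef_wide _ m D); first last.
- by rewrite /m !leq_max leqnn !orbT.
- by rewrite /m !leq_max leqnn !orbT.
rewrite -!(big_mkord xpredT (fun i => _`_i * _ ^+ i)) /=.
rewrite !(big_cat_nat (leq0n n) nm) /= [X in cabs (X - _)]addrC addrK.
rewrite [X in _ <= X - _]addrC addrK; apply: le_trans (cabs_sum _ _ _) _.
by apply: ler_sum => i _; rewrite cabsM cabsX ler_wpM2r ?exprn_ge0 ?cabs_ge0.
Qed.

Lemma majorizes_horner P D x : majorizes P D -> cabs P.[x] <= D.[cabs x].
Proof. by move=> h; have := majorizes_tail 0 x h; rewrite !big_ord0 !subr0. Qed.

Definition lpoly a K : {poly C} := \prod_(j < K) \prod_(c <- a j) (1 + - c *: 'X).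
Definition mpoly a K : {poly R} := \prod_(j < K) \prod_(c <- a j) (1 + cabs c *: 'X).

Lemma horner_lpoly a K x : (lpoly a K).[x] = lprod a K x.
Proof.
rewrite /lpoly horner_prod; apply: eq_bigr => j _; rewrite horner_prod.
by apply: eq_bigr => c _; rewrite !hornerE mulNr.
Qed.

Lemma majorizes_layer (s : seq C) :
  majorizes (\prod_(c <- s) (1 + - c *: 'X)) (\prod_(c <- s) (1 + cabs c *: 'X)) /\
  majorizes (\prod_(c <- s) (1 + - c *: 'X) - 1) (\prod_(c <- s) (1 + cabs c *: 'X) - 1).
Proof.
elim: s => [|c s [IH1 IH2]].
  by rewrite !big_nil !subrr; split; [exact: majorizes1|move=> i; rewrite !coef0 cabs0].
rewrite !big_cons; split.
  by apply: majorizesM => //; apply: majorizesD; [exact: majorizes1|exact: majorizesZX].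
rewrite !mulrDl !mul1r ![_ + _ * _]addrC -!addrA.
apply: majorizesD => //; apply: majorizesM => //; exact: majorizesZX.
Qed.

Lemma majorizes_lpoly a K : majorizes (lpoly a K) (mpoly a K).
Proof.
elim: K => [|K IH]; first by rewrite /lpoly /mpoly !big_ord0; exact: majorizes1.
by rewrite /lpoly /mpoly !big_ord_recr /=; apply: majorizesM => //; case: (majorizes_layer (a K)).
Qed.

Lemma majorizes_lpolyS a K :
  majorizes (lpoly a K.+1 - lpoly a K) (mpoly a K.+1 - mpoly a K).
Proof.
rewrite /lpoly /mpoly !big_ord_recr /= -/(lpoly a K) -/(mpoly a K).
rewrite -{2}(mulr1 (lpoly a K)) -{2}(mulr1 (mpoly a K)) -!mulrBr.
apply: majorizesM; first exact: majorizes_lpoly.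
by case: (majorizes_layer (a K)).
Qed.

Lemma mpoly_coef_ge0 a K i : 0 <= (mpoly a K)`_i.
Proof. by apply: le_trans (majorizes_lpoly a K i); exact: cabs_ge0. Qed.

Lemma mpoly_le a S K (rho : R) : (forall K, mass a K <= S) -> 0 <= rho ->
  (mpoly a K).[rho] <= expR (S * rho).
Proof.
move=> hS r0; apply: (@le_trans _ _ (expR (mass a K * rho))); last first.
  by rewrite ler_expR ler_wpM2r.
rewrite /mpoly horner_prod /mass mulr_suml expR_sum; apply: ler_prod => j _.
rewrite horner_prod mulr_suml expR_sum prodr_ge0 /=; last first.
  by move=> c _; rewrite !hornerE addr_ge0 // mulr_ge0 ?cabs_ge0.
apply: ler_prod => c _; rewrite !hornerE addr_ge0 ?mulr_ge0 ?cabs_ge0 //=.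
exact: expR_ge1Dx.
Qed.

Lemma lprod_le a S K x : (forall K, mass a K <= S) -> cabs (lprod a K x) <= expR (S * cabs x).
Proof.
move=> hS; rewrite -horner_lpoly; apply: le_trans (majorizes_horner _ (majorizes_lpoly a K)) _.
by apply: mpoly_le => //; exact: cabs_ge0.
Qed.

Lemma lprod_cvg a x : summable a -> exists2 D : R,
  ccvg (fun K => lprod a K x) (linf a x) & (fun K => (mpoly a K).[cabs x]) @ \oo --> D.
Proof.
move=> [S hS].
have [k|k|l [D [h1 h2 _]]] := @dominated_ccvg R (fun K => lprod a K x)
    (fun K => (mpoly a K).[cabs x]) (expR (S * cabs x)).
- rewrite -!horner_lpoly -!hornerN -!hornerD.
  by apply: majorizes_horner; exact: majorizes_lpolyS.
- by apply: mpoly_le => //; exact: cabs_ge0.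
by exists D => //; rewrite /linf (ccvg_clim h1).
Qed.

Lemma lprod_ccvg a x : summable a -> ccvg (fun K => lprod a K x) (linf a x).
Proof. by case/(lprod_cvg x). Qed.

Lemma linf_le a S x : (forall K, mass a K <= S) -> cabs (linf a x) <= expR (S * cabs x).
Proof.
move=> hS; have sa : summable a by exists S.
by apply: (ccvg_cabs_le (lprod_ccvg x sa)) => K; exact: lprod_le.
Qed.

(** The coefficients of the partial products converge because their increments are dominated
   by those of the majorants, and the tails of the expansions are bounded by real tails. *)
Lemma entire_linf a : summable a -> entire (linf a).
Proof.
move=> sa; have [S hS] := sa.
have hc i : exists (l : C) (D : R), [/\ ccvg (fun K => (lpoly a K)`_i) l,
    (fun K => (mpoly a K)`_i) @ \oo --> D & forall K, (mpoly a K)`_i <= D].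
  have [k|k|l [D [h1 h2 h3]]] := @dominated_ccvg R (fun K => (lpoly a K)`_i)
      (fun K => (mpoly a K)`_i) (expR (S * 1)).
  - by rewrite -!coefB; exact: majorizes_lpolyS.
  - apply: le_trans (mpoly_le k hS ler01).
    rewrite (@horner_coef_wide _ (maxn i.+1 (size (mpoly a k)))) ?leq_maxr //.
    have hi : (i < maxn i.+1 (size (mpoly a k)))%N by rewrite leq_max leqnn.
    rewrite (bigD1 (Ordinal hi)) //= expr1n mulr1 lerDl.
    by apply: sumr_ge0 => j _; rewrite expr1n mulr1 mpoly_coef_ge0.
  exists l, D; split=> // K; rewrite -subr_ge0.
  by apply: le_trans (h3 K); exact: cabs_ge0.
pose p i := clim (fun K => (lpoly a K)`_i).
pose Dl i := limn (fun K => (mpoly a K)`_i).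
have hp i : ccvg (fun K => (lpoly a K)`_i) (p i).
  by have [l [D [h _ _]]] := hc i; rewrite /p (ccvg_clim h).
have hD i : (fun K => (mpoly a K)`_i) @ \oo --> Dl i.
  by have [l [D [_ h _]]] := hc i; rewrite /Dl (cvg_lim (@norm_hausdorff _ _) h).
have leD i K : (mpoly a K)`_i <= Dl i.
  by have [l [D [_ h h']]] := hc i; rewrite /Dl (cvg_lim (@norm_hausdorff _ _) h).
exists p => x; have [E cl cE] := lprod_cvg x sa.
pose En n := \sum_(i < n) Dl i * cabs x ^+ i.
have hEn n : (fun K => \sum_(i < n) (mpoly a K)`_i * cabs x ^+ i) @ \oo --> En n.
  elim: n => [|n IH].
    rewrite /En big_ord0; under eq_fun do rewrite big_ord0; exact: cvg_cst.
  rewrite /En big_ord_recr /=; under eq_fun do rewrite big_ord_recr /=.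
  by apply: cvgD => //; apply: cvgM => //; exact: cvg_cst.
have key n : cabs (linf a x - \sum_(i < n) p i * x ^+ i) <= E - En n.
  have c1 : ccvg (fun K => lprod a K x - \sum_(i < n) (lpoly a K)`_i * x ^+ i)
      (linf a x - \sum_(i < n) p i * x ^+ i).
    apply: ccvgD => //; apply: ccvgN; apply: ccvg_sum => i.
    by apply: ccvgM => //; exact: ccvg_cst.
  apply: (ler_of_ccvg c1 (cvgB cE (hEn n))) => K; rewrite -horner_lpoly.
  by apply: majorizes_tail; exact: majorizes_lpoly.
apply: (@ccvg_le _ _ _ (fun n => E - En n)) => [n|]; first by rewrite cabsBC.
apply/cvgr0Pnorm_le => e e0.
move/cvgrPdist_le : cE => /(_ e e0) [K _ hK].
exists (size (mpoly a K)) => // n /= Kn.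
have En_le : En n <= E by rewrite -subr_ge0; apply: le_trans (key n); exact: cabs_ge0.
rewrite ger0_norm ?subr_ge0 //.
have := hK K (leqnn K); rewrite /= ler_norml => /andP[_]; apply: le_trans.
rewrite lerD2l lerN2 (horner_coef_wide _ Kn); apply: ler_sum => i _.
by rewrite ler_wpM2r // exprn_ge0 // cabs_ge0.
Qed.

Lemma lower_layer (s : seq C) x : \sum_(c <- s) cabs c * cabs x <= 1 ->
  1 - \sum_(c <- s) cabs c * cabs x <= cabs (\prod_(c <- s) (1 - c * x)).
Proof.
elim: s => [|c s IH]; first by rewrite !big_nil subr0 cabs1.
rewrite !big_cons cabsM => h.
have hc : 0 <= cabs c * cabs x by rewrite mulr_ge0 ?cabs_ge0.
have hs : 0 <= \sum_(c <- s) cabs c * cabs x.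
  by apply: sumr_ge0 => d _; rewrite mulr_ge0 ?cabs_ge0.
have h1 : 1 - cabs c * cabs x <= cabs (1 - c * x).
  by have := cabs_lower 1 (c * x); rewrite cabs1 cabsM.
have h2 : 1 - \sum_(c <- s) cabs c * cabs x <= cabs (\prod_(c <- s) (1 - c * x)).
  by apply: IH; lra.
move: hc hs h1 h2 h; move: (cabs c * _) (\sum_(_ <- _) _) (cabs (1 - _)) (cabs (\prod_(_ <- _) _)).
by move=> u v P Q; nra.
Qed.

(** From some index K0 on the sum of the |c| rho is at most 1 / 2, and the remaining factors
   satisfy |prod (1 - c x)| >= 1 - sum |c x|. *)
Lemma linf_ge a (rho : R) : summable a -> 0 <= rho ->
  exists K0, forall x, cabs x <= rho -> cabs (lprod a K0 x) / 2 <= cabs (linf a x).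
Proof.
move=> sa r0; have [S hS] := sa.
have cm : mass a @ \oo --> limn (mass a).
  by apply: nondecreasing_is_cvgn; [exact: mass_nd|exists S => _ [k _ <-]].
have e0 : 0 < (2 * (rho + 1))^-1 by rewrite invr_gt0 mulr_gt0 // ltr_wpDl.
move/cvgrPdist_le : cm => /(_ _ e0) [K0 _ hK0].
exists K0 => x xr.
have tl m : (mass a (m + K0) - mass a K0) * rho <= 2^-1.
  have h1 : mass a (m + K0) - mass a K0 <= (2 * (rho + 1))^-1.
    have := hK0 K0 (leqnn _); rewrite /= ler_norml => /andP[_]; apply: le_trans.
    rewrite lerD2r; apply: nondecreasing_cvgn_le; first exact: mass_nd.
    by apply: nondecreasing_is_cvgn; [exact: mass_nd|exists S => _ [k _ <-]].
  apply: (@le_trans _ _ ((2 * (rho + 1))^-1 * rho)); first exact: ler_wpM2r.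
  rewrite invfM -mulrA ler_piMr // ?invr_ge0 // mulrC ler_pdivrMr ?ltr_wpDl //.
  by rewrite mul1r lerDl.
have step m : cabs (lprod a K0 x) * (1 - (mass a (m + K0) - mass a K0) * cabs x)
    <= cabs (lprod a (m + K0) x).
  elim: m => [|m IH]; first by rewrite add0n subrr mul0r subr0 mulr1.
  rewrite addSn lprodS cabsM massS.
  have tS := tl m.+1; rewrite addSn massS in tS.
  have s0 : 0 <= \sum_(c <- a (m + K0)%N) cabs c by apply: sumr_ge0 => c _; exact: cabs_ge0.
  have m0 : 0 <= mass a (m + K0) - mass a K0 by rewrite subr_ge0 mass_nd // leq_addl.
  move: tS IH; rewrite (_ : _ + _ - _ = (mass a (m + K0) - mass a K0)
    + \sum_(c <- a (m + K0)%N) cabs c); last by ring.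
  have hl : (\sum_(c <- a (m + K0)%N) cabs c) * cabs x <= 1 ->
      1 - (\sum_(c <- a (m + K0)%N) cabs c) * cabs x
      <= cabs (\prod_(c <- a (m + K0)%N) (1 - c * x)).
    by rewrite mulr_suml => h; exact: lower_layer.
  move: hl m0 s0; move: (mass a (m + K0) - _) (\sum_(_ <- _) _) (cabs (\prod_(_ <- _) _)) => d t Q.
  move=> hl d0 t0 tS IH.
  have dx : 0 <= d * cabs x by rewrite mulr_ge0 ?cabs_ge0.
  have tx : 0 <= t * cabs x by rewrite mulr_ge0 ?cabs_ge0.
  have dtx : d * cabs x + t * cabs x <= 2^-1.
    by rewrite -mulrDl; apply: le_trans tS; rewrite ler_wpM2l // addr_ge0.
  have {}hl : 1 - t * cabs x <= Q by apply: hl; lra.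
  apply: le_trans (ler_pM _ _ IH hl).
  - rewrite -mulrA ler_wpM2l ?cabs_ge0 // mulrDl.
    move: dx tx; move: (d * _) (t * _) => u v; nra.
  - by rewrite mulr_ge0 ?cabs_ge0 //; lra.
  - lra.
apply: (ccvg_cabs_ge (ccvg_shift K0 (lprod_ccvg x sa))) => m.
apply: le_trans (step m); rewrite ler_wpM2l ?cabs_ge0 //.
have := tl m; have m0 : 0 <= mass a (m + K0) - mass a K0 by rewrite subr_ge0 mass_nd // leq_addl.
move: (ler_wpM2l m0 xr); lra.
Qed.

Lemma linf_neq0 a x : summable a -> (forall j c, c \in a j -> c * x != 1) -> linf a x != 0.
Proof.
move=> sa h; have [K0 hK0] := linf_ge sa (cabs_ge0 x).
rewrite -cabs_gt0; apply: lt_le_trans (hK0 x (lexx _)).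
rewrite divr_gt0 // cabs_gt0 /lprod; apply/prodf_neq0 => j _.
rewrite prodf_seq_neq0; apply/allP => c ca; rewrite /= subr_eq0 eq_sym; exact: h ca.
Qed.

(** On a circle that meets no zero, the partial product in the lower bound is a finite
   product of factors of modulus at least |1 - |c| rho|. *)
Lemma linf_circle_ge a (rho : R) : summable a -> 0 <= rho ->
  (forall j c, c \in a j -> cabs c * rho != 1) ->
  exists2 d, 0 < d & forall x, cabs x = rho -> d <= cabs (linf a x).
Proof.
move=> sa r0 h; have [K0 hK0] := linf_ge sa r0.
exists ((\prod_(j < K0) \prod_(c <- a j) `|1 - cabs c * rho|) / 2).
  rewrite divr_gt0 //; apply: prodr_gt0 => j _.
  rewrite big_seq; apply: prodr_gt0 => c ca; rewrite normr_gt0 subr_eq0 eq_sym; exact: h ca.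
move=> x xr; apply: le_trans (hK0 x _); last by rewrite xr.
rewrite ler_wpM2r ?invr_ge0 // cabs_prod; apply: ler_prod => j _.
rewrite prodr_ge0 //= cabs_prod; apply: ler_prod => c _; rewrite normr_ge0 /= -xr -cabsM.
have h1 := cabs_lower 1 (c * x); have h2 := cabs_lower (c * x) 1.
by rewrite cabsBC cabs1 in h2; rewrite cabs1 in h1; rewrite ler_norml lerNl opprB; apply/andP.
Qed.

Lemma lprod_cat a b K x : lprod (fun j => a j ++ b j) K x = lprod a K x * lprod b K x.
Proof. by rewrite /lprod -big_split /=; apply: eq_bigr => j _; rewrite big_cat. Qed.

Lemma mass_cat a b K : mass (fun j => a j ++ b j) K = mass a K + mass b K.
Proof. by rewrite /mass -big_split /=; apply: eq_bigr => j _; rewrite big_cat. Qed.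

Lemma summable_cat a b : summable a -> summable b -> summable (fun j => a j ++ b j).
Proof.
by move=> [S hS] [T hT]; exists (S + T) => K; rewrite mass_cat; exact: lerD.
Qed.

Lemma linf_cat a b x : summable a -> summable b ->
  linf (fun j => a j ++ b j) x = linf a x * linf b x.
Proof.
move=> sa sb; apply: ccvg_clim.
under eq_fun do rewrite lprod_cat.
by apply: ccvgM; exact: lprod_ccvg.
Qed.


Definition psum a (m K : nat) : C := \sum_(j < K) \sum_(c <- a j) c ^+ m.

Lemma sum_pow8_le n : \sum_(1 <= m < n) (8^-1 : R) ^+ m.-1 <= 2.
Proof.
case: n => [|n]; first by rewrite big_geq.
have e m : \sum_(1 <= i < m.+1) (8^-1 : R) ^+ i.-1 = (1 - 8^-1 ^+ m) * (8 / 7).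
  elim: m => [|m IH]; first by rewrite big_geq // expr0 subrr mul0r.
  by rewrite big_nat_recr //= IH exprS; field.
rewrite e; have : 0 <= (8^-1 : R) ^+ n by rewrite exprn_ge0 ?invr_ge0.
lra.
Qed.

Lemma psum_diff_le a (m K J : nat) x : (0 < m)%N ->
  (forall j c, c \in a j -> cabs (c * x) <= 8^-1) ->
  cabs (psum a m (J + K) * x ^+ m - psum a m K * x ^+ m)
    <= (mass a (J + K) - mass a K) * cabs x * 8^-1 ^+ m.-1.
Proof.
move=> m0 h; elim: J => [|J IH]; first by rewrite !subrr cabs0 !mul0r.
have e : psum a m (J + K).+1 = psum a m (J + K) + \sum_(c <- a (J + K)%N) c ^+ m.
  by rewrite /psum big_ord_recr.
rewrite addSn e massS.
rewrite (_ : _ * _ - _ = (psum a m (J + K) * x ^+ m - psum a m K * x ^+ m)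
  + (\sum_(c <- a (J + K)%N) c ^+ m) * x ^+ m); last by ring.
apply: le_trans (cabs_triangle _ _) _.
rewrite (_ : (_ + _ - _) * _ * _ = (mass a (J + K) - mass a K) * cabs x * 8^-1 ^+ m.-1
  + (\sum_(c <- a (J + K)%N) cabs c) * cabs x * 8^-1 ^+ m.-1); last by ring.
apply: lerD => //; rewrite !mulr_suml; apply: le_trans (cabs_sum _ _ _) _.
rewrite big_seq [X in _ <= X]big_seq; apply: ler_sum => c ca.
rewrite -exprMn cabsX -cabsM -{1}(prednK m0) exprS ler_wpM2l ?cabs_ge0 //.
by rewrite lerXn2r ?nnegrE ?cabs_ge0 ?invr_ge0 //; exact: h ca.
Qed.

(** In the disc where every factor is the exponential of its logarithmic series, the sums
   over the factors and over the powers are exchanged by means of a geometric bound that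
   is uniform in the number of factors. *)
Lemma linf_exp a (pw : nat -> C) S x :
  (forall K, mass a K <= S) -> S * cabs x <= 8^-1 ->
  (forall m, (0 < m)%N -> ccvg (psum a m) (pw m)) ->
  exists2 s, ccvg (fun n => \sum_(1 <= m < n) pw m / m%:R * x ^+ m) s
    & linf a x = cexp (- s).
Proof.
move=> hS hx hpw; have sa : summable a by exists S.
have h8 j c : c \in a j -> cabs (c * x) <= 8^-1.
  move=> ca; rewrite cabsM; apply: le_trans hx; rewrite ler_wpM2r ?cabs_ge0 //.
  by apply: le_trans (mem_le_mass ca) _.
pose L c : C := clim (fun n => \sum_(1 <= m < n) (c * x) ^+ m / m%:R).
have hL j c : c \in a j -> ccvg (fun n => \sum_(1 <= m < n) (c * x) ^+ m / m%:R) (L c)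
    /\ 1 - c * x = cexp (- L c).
  by move=> /h8 /complex_log [l h1 h2]; rewrite /L (ccvg_clim h1).
pose LK K := \sum_(j < K) \sum_(c <- a j) L c.
have hprod K : lprod a K x = cexp (- LK K).
  rewrite /LK -sumrN cexp_sum; apply: eq_bigr => j _; rewrite -sumrN cexp_sum big_seq [RHS]big_seq.
  by apply: eq_bigr => c ca; case: (hL _ _ ca).
pose LKn K n := \sum_(1 <= m < n) psum a m K / m%:R * x ^+ m.
have LKnE K n : LKn K n = \sum_(j < K) \sum_(c <- a j) \sum_(1 <= m < n) (c * x) ^+ m / m%:R.
  rewrite /LKn /psum; under eq_bigr do rewrite -mulrA mulr_suml.
  rewrite exchange_big; apply: eq_bigr => j _ /=; under eq_bigr do rewrite mulr_suml.
  rewrite exchange_big; apply: eq_bigr => c _ /=; apply: eq_bigr => m _.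
  by rewrite exprMn mulrCA mulrC.
have cLK K : ccvg (LKn K) (LK K).
  rewrite (_ : LKn K = fun n => \sum_(j < K) \sum_(c <- a j) \sum_(1 <= m < n) (c * x) ^+ m / m%:R);
    last exact/funext.
  apply: ccvg_sum => j.
  have aux (s : seq C) : {subset s <= a j} ->
     ccvg (fun n => \sum_(c <- s) \sum_(1 <= m < n) (c * x) ^+ m / m%:R) (\sum_(c <- s) L c).
    elim: s => [|c s IH] hs.
      by rewrite big_nil; under eq_fun do rewrite big_nil; exact: ccvg_cst.
    rewrite big_cons; under eq_fun do rewrite big_cons.
    apply: ccvgD; last by apply: IH => d ds; apply: hs; rewrite inE ds orbT.
    by have [] := hL j c (hs _ (mem_head _ _)).
  by apply: aux.
pose Ln n := \sum_(1 <= m < n) pw m / m%:R * x ^+ m.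
have diff K J n : cabs (LKn (J + K)%N n - LKn K n) <= (mass a (J + K) - mass a K) * cabs x * 2.
  rewrite /LKn -sumrB; apply: le_trans (cabs_sum _ _ _) _.
  have d0 : 0 <= (mass a (J + K) - mass a K) * cabs x.
    by rewrite mulr_ge0 ?cabs_ge0 // subr_ge0 mass_nd // leq_addl.
  apply: le_trans (ler_wpM2l d0 (sum_pow8_le n)); rewrite mulr_sumr.
  rewrite big_nat [X in _ <= X]big_nat; apply: ler_sum => m /andP[m0 _].
  apply: le_trans (psum_diff_le K J m0 h8).
  rewrite (_ : _ - _ = (psum a m (J + K) * x ^+ m - psum a m K * x ^+ m) / m%:R); last by ring.
  by rewrite cabsM cabsV cabs_nat ler_piMr ?cabs_ge0 // invf_le1 ?ltr0n // ler1n.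
have cLn n : ccvg (fun J => LKn J n) (Ln n).
  rewrite /LKn /Ln big_nat; under eq_fun do rewrite big_nat.
  rewrite -big_filter; under eq_fun do rewrite -big_filter.
  have : all (fun m => 0 < m)%N [seq i <- index_iota 1 n | (0 < i < n)%N].
    by apply/allP => m; rewrite mem_filter => /andP[/andP[]].
  elim: [seq _ <- _ | _] => [_|m s IH /= /andP[m0 hs]].
    by rewrite big_nil; under eq_fun do rewrite big_nil; exact: ccvg_cst.
  rewrite big_cons; under eq_fun do rewrite big_cons.
  apply: ccvgD; last exact: IH.
  by apply: ccvgM; [apply: ccvgM; [exact: hpw|]|]; exact: ccvg_cst.
have cm : mass a @ \oo --> limn (mass a).
  by apply: nondecreasing_is_cvgn; [exact: mass_nd|exists S => _ [k _ <-]].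
have diffL K n : cabs (Ln n - LKn K n) <= (limn (mass a) - mass a K) * cabs x * 2.
  have c1 : ccvg (fun J => LKn (J + K)%N n - LKn K n) (Ln n - LKn K n).
    by apply: ccvgD; [exact: (ccvg_shift K (cLn n))|exact: ccvg_cst].
  apply: (ler_of_ccvg c1 _ (fun J => diff K J n)).
  apply: cvgM; last exact: cvg_cst.
  apply: cvgM; last exact: cvg_cst.
  apply: cvgB; last exact: cvg_cst.
  by rewrite (cvg_shiftn K (mass a)).
have [k|n|s [_ [cs _ _]]] := @dominated_ccvg R Ln
    (fun n => \sum_(1 <= m < n) (S * cabs x * 8^-1 ^+ m.-1)) (S * cabs x * 2).
- case: k => [|k]; first by rewrite /Ln !big_geq // !subrr cabs0.
  rewrite /Ln big_nat_recr //= [X in _ <= X - _]big_nat_recr //= addrC addrK addrC addrK.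
  rewrite mulrAC cabsM cabsV cabs_nat.
  apply: (@le_trans _ _ (cabs (pw k.+1 * x ^+ k.+1))).
    by rewrite ler_piMr ?cabs_ge0 // invf_le1 ?ltr0n // ler1n.
  apply: (@ccvg_cabs_le _ (fun K => psum a k.+1 K * x ^+ k.+1)).
    by apply: ccvgM; [exact: hpw|exact: ccvg_cst].
  move=> K; have := psum_diff_le 0 K (ltn0Sn k) h8.
  rewrite addn0 {2}/psum {2}/mass !big_ord0 mul0r !subr0 => h; apply: le_trans h _.
  by rewrite ler_wpM2r ?exprn_ge0 ?invr_ge0 // ler_wpM2r ?cabs_ge0.
- rewrite -mulr_sumr ler_wpM2l ?sum_pow8_le // mulr_ge0 ?cabs_ge0 //.
  exact: le_trans (mass_ge0 a 0) (hS 0%N).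
exists s => //.
apply: ccvg_clim; under eq_fun do rewrite hprod.
apply: ccvg_cexp; apply: ccvgN.
apply: (@ccvg_le _ _ _ (fun K => (limn (mass a) - mass a K) * cabs x * 2)) => [K|].
  rewrite cabsBC; apply: (@ccvg_cabs_le _ (fun n => Ln n - LKn K n)); last exact: diffL.
  by apply: ccvgD => //; exact: ccvgN.
rewrite -(mul0r 2) -(mul0r (cabs x)); apply: cvgM; last exact: cvg_cst.
apply: cvgM; last exact: cvg_cst.
by rewrite -(subrr (limn (mass a))); apply: cvgB => //; exact: cvg_cst.
Qed.

End InfiniteProducts.

(** * Uniqueness of the meromorphic continuation *)

Section IdentityTheorem.
Variable R : realType.
Local Notation C := R[i].
Implicit Types (f g : C -> C) (a : nat -> C).

Definition series_for a f := forall w, ccvg (fun K => \sum_(k < K) a k * w ^+ k) (f w).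

Lemma series_coef_bound a f (rho : R) : series_for a f -> 0 <= rho ->
  exists2 M, 0 < M & forall n, cabs (a n) * rho ^+ n <= M.
Proof.
move=> ha r0; have /ccvg_cabs h := ha rho%:C.
have /cvg_seq_bounded [M [_ hM]] : cvgn (fun K => cabs (\sum_(k < K) a k * rho%:C ^+ k)).
  by apply/cvg_ex; eexists; exact: h.
have {}hM n : cabs (\sum_(k < n) a k * rho%:C ^+ k) <= `|M| + 1.
  have := hM (`|M| + 1); rewrite (le_lt_trans (ler_norm M)) ?ltrDl // => /(_ isT n Logic.I).
  by rewrite /= ger0_norm ?cabs_ge0.
exists (2 * (`|M| + 1)) => [|n]; first by rewrite mulr_gt0 // ltr_wpDl.
rewrite (_ : _ * _ = cabs (a n * rho%:C ^+ n)); last first.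
  by rewrite cabsM cabsX cabs_real ger0_norm.
rewrite (_ : a n * _ = \sum_(k < n.+1) a k * rho%:C ^+ k - \sum_(k < n) a k * rho%:C ^+ k).
  apply: le_trans (cabs_triangle _ _) _; rewrite cabsN mulr_natl mulr2n.
  by apply: lerD.
by rewrite big_ord_recr /= addrAC subrr add0r.
Qed.

Lemma ccvg_geom0 (z : R) (M : R) : 0 <= z -> z < 1 -> (fun n => M * z ^+ n) @ \oo --> (0 : R).
Proof.
by move=> z0 z1; have := @cvg_geometric R M z; rewrite /geometric /=; apply; rewrite ger0_norm.
Qed.

(** The Cauchy product converges because the coefficients of an entire function decrease
   faster than any geometric sequence. *)
Lemma entireM f g : entire f -> entire g -> entire (fun w => f w * g w).
Proof.
move=> [a ha] [b hb].
exists (fun k => \sum_(j < k.+1) a j * b (k - j)%N) => w.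
have r0 : 0 <= 8 * cabs w by rewrite mulr_ge0 ?cabs_ge0.
have [M M0 hM] := series_coef_bound ha r0; have [M' M'0 hM'] := series_coef_bound hb r0.
have e8 (x : R) n : x * (8 * cabs w) ^+ n = x * cabs w ^+ n * 8 ^+ n by rewrite exprMn; ring.
have ha8 n : cabs (a n) * cabs w ^+ n <= M * 8^-1 ^+ n.
  by rewrite exprVn ler_pdivlMr ?exprn_gt0 // -e8.
have hb8 n : cabs (b n) * cabs w ^+ n <= M' * 8^-1 ^+ n.
  by rewrite exprVn ler_pdivlMr ?exprn_gt0 // -e8.
pose c k := \sum_(j < k.+1) a j * b (k - j)%N.
rewrite -/c.
(* the product of the truncations agrees with the truncated product up to degree n *)
have key n : cabs (\sum_(k < n) c k * w ^+ k
    - (\sum_(k < n) a k * w ^+ k) * (\sum_(k < n) b k * w ^+ k)) <= 2 * M * M' * 2^-1 ^+ n.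
  pose P := \poly_(k < n) a k; pose Q := \poly_(k < n) b k.
  have eP : \sum_(k < n) a k * w ^+ k = P.[w] by rewrite horner_poly.
  have eQ : \sum_(k < n) b k * w ^+ k = Q.[w] by rewrite horner_poly.
  have ec k : (k < n)%N -> c k = (P * Q)`_k.
    move=> kn; rewrite coefM; apply: eq_bigr => j _; rewrite !coef_poly.
    by rewrite (leq_ltn_trans _ kn) ?(leq_ltn_trans _ kn) ?leq_subr // -ltnS.
  have szPQ : (size (P * Q)%R <= n + n)%N.
    apply: leq_trans (size_polyMleq _ _) _; apply: leq_trans (leq_pred _) _.
    by apply: leq_add; exact: size_poly.
  rewrite eP eQ -hornerM (horner_coef_wide _ szPQ).
  rewrite -(big_mkord xpredT (fun k => (P * Q)`_k * w ^+ k)).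
  rewrite (big_cat_nat (leq0n n) (leq_addr n n)) /= big_mkord.
  rewrite (eq_bigr (fun k : 'I_n => (P * Q)`_k * w ^+ k)); last by move=> k _; rewrite ec.
  rewrite opprD addrA subrr add0r cabsN.
  have tk k : (n <= k)%N -> cabs ((P * Q)`_k * w ^+ k) <= k.+1%:R * (M * M' * 8^-1 ^+ k).
    move=> nk; rewrite coefM mulr_suml; apply: le_trans (cabs_sum _ _ _) _.
    have -> : k.+1%:R * (M * M' * 8^-1 ^+ k) = \sum_(j < k.+1) M * M' * 8^-1 ^+ k.
      by rewrite sumr_const card_ord mulr_natl.
    apply: ler_sum => j _; have jk : (j <= k)%N by rewrite -ltnS.
    have -> : w ^+ k = w ^+ j * w ^+ (k - j) by rewrite -exprD subnKC.
    have -> : 8^-1 ^+ k = 8^-1 ^+ j * 8^-1 ^+ (k - j) :> R by rewrite -exprD subnKC.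
    rewrite [X in cabs X]mulrACA [X in _ <= X]mulrACA cabsM; apply: ler_pM; rewrite ?cabs_ge0 // cabsM cabsX coef_poly.
    - case: ifP => _; first exact: ha8.
      by rewrite cabs0 mul0r mulr_ge0 ?exprn_ge0 ?invr_ge0 // ltW.
    - case: ifP => _; first exact: hb8.
      by rewrite cabs0 mul0r mulr_ge0 ?exprn_ge0 ?invr_ge0 // ltW.
  have tk2 k : (n <= k < n + n)%N -> cabs ((P * Q)`_k * w ^+ k) <= 2 * n%:R * (M * M' * 8^-1 ^+ n).
    move=> /andP[nk kn]; apply: le_trans (tk k nk) _; apply: ler_pM.
    - exact: ler0n.
    - by rewrite !mulr_ge0 ?exprn_ge0 ?invr_ge0 // ltW.
    - by rewrite -natrM ler_nat mul2n -addnn.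
    - rewrite ler_wpM2l ?mulr_ge0 ?(ltW M0) ?(ltW M'0) // ler_wiXn2l ?invr_ge0 //.
      by rewrite invf_le1 // ler1n.
  apply: le_trans (cabs_sum _ _ _) _; rewrite big_nat.
  apply: (@le_trans _ _ (\sum_(n <= k < n + n | (n <= k < n + n)%N) 2 * n%:R * (M * M' * 8^-1 ^+ n))).
    by apply: ler_sum => k; exact: tk2.
  rewrite -big_nat sumr_const_nat addKn.
  rewrite [X in X <= _](_ : _ = 2 * M * M' * (n%:R ^+ 2 * 8^-1 ^+ n)); last first.
    by rewrite -[LHS]mulr_natr; ring.
  rewrite ler_wpM2l ?mulr_ge0 ?(ltW M0) ?(ltW M'0) //.
  have -> : 8^-1 ^+ n = (2^-1 ^+ n) ^+ 2 * 2^-1 ^+ n :> R.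
    by rewrite -exprSr -exprM mulnC exprM; congr (_ ^+ n); rewrite exprVn -natrX.
  rewrite mulrA -exprMn ler_piMl ?exprn_ge0 ?invr_ge0 //.
  rewrite exprn_ile1 ?mulr_ge0 ?exprn_ge0 ?invr_ge0 //.
  by rewrite exprVn ler_pdivrMr ?exprn_gt0 // mul1r -natrX ler_nat ltnW // ltn_expl.
have cPQ := ccvgM (ha w) (hb w).
have := ccvgD cPQ (@ccvg_le R _ 0 _ (fun n => _) (ccvg_geom0 (2 * M * M') _ _)).
move=> /(_ (fun n => \sum_(k < n) c k * w ^+ k
    - (\sum_(k < n) a k * w ^+ k) * (\sum_(k < n) b k * w ^+ k)) 2^-1).
rewrite addr0 => h; have {h} := h _ _ _.
under eq_fun do rewrite addrC subrK.
apply => //; last by rewrite invf_lt1 // ltr1n.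
by move=> n; rewrite subr0; exact: key.
Qed.

Lemma entireB f g : entire f -> entire g -> entire (fun w => f w - g w).
Proof.
move=> [a ha] [b hb]; exists (fun k => a k - b k) => w.
have := ccvgD (ha w) (ccvgN (hb w)).
by under eq_fun do rewrite -sumrB; under eq_fun do (under eq_bigr do rewrite -mulrBl).
Qed.

(** The first nonzero coefficient would dominate the rest of the series near 0. *)
Lemma entire_eq0 f (e : R) : entire f -> 0 < e -> (forall w, cabs w < e -> f w = 0) ->
  forall w, f w = 0.
Proof.
move=> [a ha] e0 f0.
suff a0 k : a k = 0.
  move=> w; apply: ccvg_unique (ha w) _.
  have -> : (fun K => \sum_(k < K) a k * w ^+ k) = fun=> 0; last exact: ccvg_cst.
  by apply/funext => K; rewrite big1 // => i _; rewrite a0 mul0r.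
apply/eqP/negPn/negP => ak; have ex : exists k, a k != 0 by exists k.
have [n an nmin] := ex_minnP ex; have {nmin} nz m : (m < n)%N -> a m = 0.
  by move=> mn; apply/eqP/negPn/negP => /nmin; rewrite leqNgt mn.
have [M M0] := series_coef_bound ha ler01.
move=> hM; have {}hM m : cabs (a m) <= M by have := hM m; rewrite expr1n mulr1.
have an0 : 0 < cabs (a n) by rewrite cabs_gt0.
have key (t : R) : 0 < t -> t <= 2^-1 -> t < e -> cabs (a n) <= 2 * M * t.
  move=> t0 t2 te; have tC : cabs t%:C = t by rewrite cabs_real gtr0_norm.
  have := ha t%:C; rewrite f0 ?tC // => h0.
  have := ccvg_shift n.+1 h0 => {}h0.
  have := ccvgD h0 (ccvg_cst (- (a n * t%:C ^+ n))); rewrite add0r => h1.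
  have : cabs (- (a n * t%:C ^+ n)) <= M * (2 * t ^+ n.+1).
    apply: (ccvg_cabs_le h1) => K.
    rewrite -(big_mkord xpredT (fun k => a k * t%:C ^+ k)).
    rewrite (big_cat_nat (leq0n n) (leq_trans (leqnSn n) (leq_addl K n.+1))) /=.
    rewrite big_nat big1 ?add0r; last by move=> i /andP[_ /nz ->]; rewrite mul0r.
    rewrite big_ltn ?leq_addl //.
    rewrite addrAC subrr add0r; apply: le_trans (cabs_sum _ _ _) _.
    apply: (@le_trans _ _ (\sum_(n.+1 <= i < K + n.+1) M * t ^+ i)).
      by apply: ler_sum => i _; rewrite cabsM cabsX tC ler_wpM2r // exprn_ge0 // ltW.
    rewrite -mulr_sumr ler_wpM2l ?(ltW M0) //.
    elim: K {h1} => [|K IH]; first by rewrite add0n big_geq // mulr_ge0 // exprn_ge0 // ltW.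
    have -> : \sum_(n.+1 <= i < K.+1 + n.+1) t ^+ i = t ^+ n.+1 * \sum_(0 <= i < K.+1) t ^+ i.
      rewrite mulr_sumr addnC -{1}(add0n n.+1) big_addn addnC addnK.
      by apply: eq_bigr => i _; rewrite -exprD addnC.
    rewrite [2 * _]mulrC ler_wpM2l ?exprn_ge0 ?(ltW t0) //.
    have : (1 - t) * \sum_(0 <= i < K.+1) t ^+ i <= 1.
      by rewrite big_mkord -opprB mulNr -subrX1 opprB lerBlDr lerDl exprn_ge0 // ltW.
    have : 0 <= \sum_(0 <= i < K.+1) t ^+ i by apply: sumr_ge0 => i _; rewrite exprn_ge0 // ltW.
    move: (\sum_(_ <= _ < _) _) => s; nra.
  rewrite cabsN cabsM cabsX tC exprS => h.
  have tn : 0 < t ^+ n by rewrite exprn_gt0.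
  rewrite -(ler_pM2r tn); apply: le_trans h _; rewrite le_eqVlt; apply/orP; left; apply/eqP; ring.
pose t := Num.min (Num.min 2^-1 (e / 2)) (cabs (a n) / (4 * M)).
have t0 : 0 < t.
  have h4 : 0 < 4 * M by rewrite mulr_gt0.
  by rewrite !lt_min (divr_gt0 an0 h4) (divr_gt0 e0 (ltr0n _ 2)) invr_gt0 ltr0n.
have := key t t0; rewrite !ge_min lexx /= => /(_ isT).
have -> : t < e.
  apply: (@le_lt_trans _ _ (e / 2)); first by rewrite !ge_min lexx orbT.
  by rewrite ltr_pdivrMr // ltr_pMr // ltr1n.
move=> /(_ isT); apply/negP; rewrite -ltNge.
have : t <= cabs (a n) / (4 * M) by rewrite ge_min lexx orbT.
rewrite ler_pdivlMr ?mulr_gt0 // => h; move: t0 M0 an0 h; nra.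
Qed.

(** Two continuations A / B and A' / B' agree near 0, hence A B' = A' B everywhere. As numerators
   and denominators have no common zero, the quotients have the same poles, where both are 0. *)
Lemma mero_exp_unique (c : nat -> C) g : meromorphic_continuation c g -> mero_exp c = g.
Proof.
move=> hg; have : meromorphic_continuation c (mero_exp c).
  rewrite /mero_exp; apply: (@xgetPex _ (fun=> 0) [set g | meromorphic_continuation c g]).
  by exists g.
move: (mero_exp c) hg => g' [A [B [eA eB nz gE [e e0 he]]]].
move=> [A' [B' [eA' eB' nz' gE' [e' e'0 he']]]].
have cross w : A w * B' w - A' w * B w = 0.
  apply: (@entire_eq0 (fun w => A w * B' w - A' w * B w) (Num.min e e')).
  - by apply: entireB; exact: entireM.
  - by rewrite lt_min e0.
  move=> {}w; rewrite lt_min => /andP[we we'].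
  have [|b0 [s hs ge]] := he w; first by rewrite cabsE ltcR.
  have [|b0' [s' hs' ge']] := he' w; first by rewrite cabsE ltcR.
  have es := ccvg_unique hs hs'; move: ge ge'; rewrite -es gE gE' => <- /eqP.
  by rewrite eqr_div // => /eqP ->; rewrite subrr.
apply/funext => w; rewrite gE gE'; have /eqP := cross w; rewrite subr_eq0 => /eqP ab.
have [b0|b0] := eqVneq (B w) 0; have [b0'|b0'] := eqVneq (B' w) 0.
- by rewrite b0 b0' !invr0 !mulr0.
- have /eqP : A w * B' w = 0 by rewrite ab b0 mulr0.
  by rewrite mulf_eq0 (negbTE b0') orbF => /eqP a0; case: (nz w).
- have /esym/eqP : 0 = A' w * B w by rewrite -ab b0' mulr0.
  by rewrite mulf_eq0 (negbTE b0) orbF => /eqP a0; case: (nz' w).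
- by apply/eqP; rewrite eqr_div //; apply/eqP; rewrite -ab.
Qed.

(** The continuation of exp (sum_m (pw_b(m) - pw_a(m)) w^m / m) is the quotient of the
   products over the a and the b, of which pw_a and pw_b are the power sums; that it is in
   lowest terms is what the disjointness of a and b gives. *)
Lemma mero_exp_linf (a b : nat -> seq C) (pa pb c : nat -> C) :
  summable a -> summable b ->
  (forall m, (0 < m)%N -> ccvg (psum a m) (pa m)) ->
  (forall m, (0 < m)%N -> ccvg (psum b m) (pb m)) ->
  (forall m, (0 < m)%N -> c m = (pb m - pa m) / m%:R) ->
  (forall j k x y, x \in a j -> y \in b k -> x != y) ->
  mero_exp c = fun w => linf a w / linf b w.
Proof.
move=> sa sb ha hb hc hab; apply: mero_exp_unique.
exists (linf a), (linf b); split => //; try exact: entire_linf.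
- move=> w [/eqP a0 /eqP b0].
  have [hx|nx] := pselect (exists j c, c \in a j /\ c * w = 1); last first.
    exfalso; move: a0; apply/negP; apply: linf_neq0 => // j x xa; apply/eqP => e.
    by apply: nx; exists j, x.
  have [hy|ny] := pselect (exists j c, c \in b j /\ c * w = 1); last first.
    exfalso; move: b0; apply/negP; apply: linf_neq0 => // j x xa; apply/eqP => e.
    by apply: ny; exists j, x.
  have [j [x [xa xw]]] := hx; have [k [y [yb yw]]] := hy.
  have w0 : w != 0.
    by apply: contra_eq_neq xw => ->; rewrite mulr0 eq_sym oner_neq0.
  have := hab _ _ _ _ xa yb; rewrite -(inj_eq (mulIf w0)) xw yw eqxx.
  by [].
have [S hS] := sa; have [T hT] := sb.
have S0 := le_trans (mass_ge0 a 0) (hS 0%N); have T0 := le_trans (mass_ge0 b 0) (hT 0%N).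
exists (8 * (S + T + 1))^-1; first by rewrite invr_gt0 mulr_gt0 // ltr_wpDl // addr_ge0.
move=> w; rewrite cabsE ltcR => hw'.
have p0 : 0 < 8 * (S + T + 1) by rewrite mulr_gt0 // ltr_wpDl // addr_ge0.
have hw : 8 * (S + T + 1) * cabs w < 1 by rewrite -ltr_pdivlMl // mulr1.
have w0 := cabs_ge0 w.
have hSw : S * cabs w <= 8^-1 by nra.
have hTw : T * cabs w <= 8^-1 by nra.
have [s1 c1 e1] := linf_exp hS hSw ha; have [s2 c2 e2] := linf_exp hT hTw hb.
split; first by rewrite e2 cexp_neq0.
exists (s2 - s1); last by rewrite e1 e2 -cexpN opprK -cexpD addrC.
have := ccvgD c2 (ccvgN c1); under eq_fun do rewrite -sumrB.
rewrite (_ : (fun k => _) = (fun K => \sum_(1 <= m < K) c m * w ^+ m)) //.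
apply/funext => K; rewrite big_nat [RHS]big_nat; apply: eq_bigr => m /andP[m0 _].
by rewrite hc //; ring.
Qed.

End IdentityTheorem.

(** * Powers of q and q-products *)

Section QFunctionLemmas.
Variable R : realType.
Local Notation C := R[i].

Lemma poch1E (c s w : C) : poch1 (c * w) s = linf (fun j => [:: c * s ^+ j]) w.
Proof.
rewrite /poch1 /linf; congr clim; apply/funext => K; apply: eq_bigr => j _.
by rewrite big_seq1; congr (1 - _); ring.
Qed.

Lemma sum_pow_le (z : R) K : 0 <= z -> z < 1 -> \sum_(k < K) z ^+ k <= (1 - z)^-1.
Proof.
move=> z0 z1; rewrite -[_^-1]mul1r ler_pdivlMr ?subr_gt0 // mulrC -opprB mulNr -subrX1 opprB.
by rewrite lerBlDr lerDl exprn_ge0.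
Qed.

Lemma summable_layers1 (c s : C) : cabs s < 1 -> summable (fun j => [:: c * s ^+ j]).
Proof.
move=> s1; exists (cabs c * (1 - cabs s)^-1) => K; rewrite /mass.
under eq_bigr do rewrite big_seq1 cabsM cabsX.
by rewrite -mulr_sumr ler_wpM2l ?cabs_ge0 // sum_pow_le ?cabs_ge0.
Qed.

Lemma ccvg_pow0 (z : C) : cabs z < 1 -> ccvg (fun n => z ^+ n) 0.
Proof.
move=> z1; apply: (@ccvg_le _ _ _ (fun n => 1 * cabs z ^+ n)) => [n|].
  by rewrite subr0 cabsX mul1r.
by apply: ccvg_geom0 => //; exact: cabs_ge0.
Qed.

Lemma ccvg_geom_sum (z : C) : cabs z < 1 -> ccvg (fun K => \sum_(k < K) z ^+ k) (1 - z)^-1.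
Proof.
move=> z1; have nz : 1 - z != 0.
  by rewrite subr_eq0; apply: contraTneq z1 => <-; rewrite cabs1 ltxx.
have -> : (fun K => \sum_(k < K) z ^+ k) = fun K => (1 + - z ^+ K) * (1 - z)^-1.
  apply/funext => K; apply: (mulIf nz); rewrite mulfVK // mulrC -opprB mulNr -subrX1; ring.
rewrite -[X in ccvg _ X]mul1r; apply: ccvgM; last exact: ccvg_cst.
rewrite -[X in ccvg _ X]addr0 -oppr0; apply: ccvgD; first exact: ccvg_cst.
by apply: ccvgN; exact: ccvg_pow0.
Qed.

Lemma cabs_pow_lt1 (z : C) m : (0 < m)%N -> cabs z < 1 -> cabs (z ^+ m) < 1.
Proof. by move=> m0 z1; rewrite cabsX exprn_ilt1 ?cabs_ge0 // -lt0n. Qed.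

Lemma psum_layers1 (c s : C) m : (0 < m)%N -> cabs s < 1 ->
  ccvg (psum (fun j => [:: c * s ^+ j]) m) (c ^+ m / (1 - s ^+ m)).
Proof.
move=> m0 s1; rewrite (_ : psum _ m = fun K => c ^+ m * \sum_(k < K) (s ^+ m) ^+ k); last first.
  apply/funext => K; rewrite /psum mulr_sumr; apply: eq_bigr => j _.
  by rewrite big_seq1 exprMn -!exprM mulnC.
by apply: ccvgM; [exact: ccvg_cst|exact: ccvg_geom_sum (cabs_pow_lt1 m0 s1)].
Qed.

(** The factors of a double product over the square k, l < K, listed by the value of
   max k l. *)
Definition layers2 (c s t : C) (j : nat) : seq C :=
  [seq c * s ^+ j * t ^+ l | l <- iota 0 j.+1] ++ [seq c * s ^+ k * t ^+ j | k <- iota 0 j].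

Lemma big_layers2 (T : Type) (idx : T) (op : Monoid.com_law idx) (F : C -> T) (c s t : C) K :
  \big[op/idx]_(j < K) \big[op/idx]_(x <- layers2 c s t j) F x =
  \big[op/idx]_(k < K) \big[op/idx]_(l < K) F (c * s ^+ k * t ^+ l).
Proof.
elim: K => [|K IH]; first by rewrite !big_ord0.
rewrite big_ord_recr IH [RHS]big_ord_recr /=.
under [X in _ = op X _]eq_bigr do rewrite big_ord_recr /=.
rewrite big_split /= -Monoid.mulmA; congr (op _ _).
have iotaE n : iota 0 n = index_iota 0 n by rewrite /index_iota subn0.
by rewrite /layers2 big_cat !big_map !iotaE !big_mkord /= Monoid.mulmC.
Qed.

Lemma poch2E (c s t w : C) : poch2 (c * w) s t = linf (layers2 c s t) w.
Proof.
rewrite /poch2 /linf; congr clim; apply/funext => K; rewrite /lprod.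
rewrite (big_layers2 _ (fun x => 1 - x * w)).
by apply: eq_bigr => k _; apply: eq_bigr => l _; congr (1 - _); ring.
Qed.

Lemma summable_layers2 (c s t : C) : cabs s < 1 -> cabs t < 1 -> summable (layers2 c s t).
Proof.
move=> s1 t1; exists (cabs c * (1 - cabs s)^-1 * (1 - cabs t)^-1) => K; rewrite /mass.
rewrite (big_layers2 _ (@cabs R)).
under eq_bigr do (under eq_bigr do rewrite !cabsM !cabsX; rewrite -mulr_sumr).
rewrite -mulr_suml -mulr_sumr.
apply: ler_pM; rewrite ?sum_pow_le ?cabs_ge0 //.
- by rewrite mulr_ge0 ?cabs_ge0 // sumr_ge0 // => i _; rewrite exprn_ge0 ?cabs_ge0.
- by rewrite sumr_ge0 // => i _; rewrite exprn_ge0 ?cabs_ge0.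
- by rewrite ler_wpM2l ?cabs_ge0 // sum_pow_le ?cabs_ge0.
Qed.

Lemma psum_layers2 (c s t : C) m : (0 < m)%N -> cabs s < 1 -> cabs t < 1 ->
  ccvg (psum (layers2 c s t) m) (c ^+ m / ((1 - s ^+ m) * (1 - t ^+ m))).
Proof.
move=> m0 s1 t1.
have -> : psum (layers2 c s t) m = fun K => c ^+ m *
    ((\sum_(k < K) (s ^+ m) ^+ k) * (\sum_(k < K) (t ^+ m) ^+ k)).
  apply/funext => K; rewrite /psum (big_layers2 _ (fun x => x ^+ m)) mulr_suml mulr_sumr.
  apply: eq_bigr => k _; rewrite mulr_sumr mulr_sumr; apply: eq_bigr => l _.
  by rewrite !exprMn -!exprM ![(m * _)%N]mulnC mulrA.
rewrite invfM; apply: ccvgM; first exact: ccvg_cst.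
by apply: ccvgM; exact: ccvg_geom_sum (cabs_pow_lt1 _ _).
Qed.

Lemma mem_layers2 (c s t x : C) j : x \in layers2 c s t j -> exists k l, x = c * s ^+ k * t ^+ l.
Proof.
by rewrite mem_cat => /orP[] /mapP[l _ ->]; [exists j, l|exists l, j].
Qed.

Lemma poch1_shift (x s : C) : cabs s < 1 -> poch1 x s = (1 - x) * poch1 (x * s) s.
Proof.
move=> s1.
have h := lprod_ccvg 1 (summable_layers1 x s1).
have h' := lprod_ccvg 1 (summable_layers1 (x * s) s1).
rewrite -[x in LHS]mulr1 -[(x * s)%R]mulr1 !poch1E.
apply: (ccvg_unique (ccvg_shift 1 h)).
rewrite (_ : (fun k => _) = fun K => (1 - x) * lprod (fun j => [:: x * s * s ^+ j]) K 1).
  by apply: ccvgM => //; exact: ccvg_cst.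
apply/funext => K; rewrite addn1 /lprod big_ord_recl big_seq1 expr0 !mulr1; congr (_ * _).
by apply: eq_bigr => j _; rewrite !big_seq1 /bump /= exprS !mulr1 mulrA.
Qed.

Lemma poch1_neq0 (x s : C) : cabs s < 1 -> (forall k, x * s ^+ k != 1) -> poch1 x s != 0.
Proof.
move=> s1 h; rewrite -[x]mulr1 poch1E; apply: linf_neq0; first exact: summable_layers1.
by move=> j c; rewrite inE => /eqP ->; rewrite mulr1.
Qed.

End QFunctionLemmas.

Section Contractions.
Variable R : realType.
Local Notation C := R[i].
Variables (N : nat) (logq : C) (r : R).
Local Notation qpow := (qpow logq).
Local Notation q := (qq logq).
Local Notation p := (pp logq r).
Local Notation pst := (pstar logq r).
Local Notation qint := (qint logq).

Lemma qpowD x y : qpow (x + y) = qpow x * qpow y.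
Proof. by rewrite /Defs.qpow mulrDl cexpD. Qed.

Lemma qpow0 : qpow 0 = 1.
Proof. by rewrite /Defs.qpow mul0r cexp0. Qed.

Lemma qpow_neq0 x : qpow x != 0.
Proof. exact: cexp_neq0. Qed.

Lemma qpowN x : qpow (- x) = (qpow x)^-1.
Proof. by rewrite /Defs.qpow mulNr cexpN. Qed.

Lemma qpowB x y : qpow (x - y) = qpow x / qpow y.
Proof. by rewrite qpowD qpowN. Qed.

Lemma qpowMn n x : qpow (n%:R * x) = qpow x ^+ n.
Proof. by rewrite /Defs.qpow -mulrA cexpMn. Qed.

Lemma qpow_nat n : qpow n%:R = q ^+ n.
Proof. by rewrite -[n%:R]mulr1 qpowMn. Qed.

Lemma cabs_qpow_real (t : R) : cabs (qpow t%:C) = expR (t * complex.Re logq).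
Proof. by rewrite /Defs.qpow cabs_cexp ReM /= mul0r subr0. Qed.

Lemma q_neq0 : q != 0. Proof. exact: qpow_neq0. Qed.
Lemma p_neq0 : p != 0. Proof. exact: qpow_neq0. Qed.

Lemma pstE : pst = p / q ^+ 2.
Proof. by rewrite -qpow_nat -qpowB /pstar rmorphB /= rmorph1 mulrBr mulr1. Qed.

Hypothesis hq : complex.Re logq < 0.
Hypothesis hr : 1 < r.

Lemma cabs_q : cabs q = expR (complex.Re logq).
Proof. by rewrite /qq -(rmorph1 (real_complex R)) cabs_qpow_real mul1r. Qed.

Lemma cabs_p : cabs p = expR (2 * r * complex.Re logq).
Proof. by rewrite -cabs_qpow_real rmorphM rmorph_nat. Qed.

Lemma cabs_q_gt0 : 0 < cabs q. Proof. by rewrite cabs_gt0 q_neq0. Qed.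
Lemma cabs_q_lt1 : cabs q < 1.
Proof. by rewrite cabs_q expR_lt1. Qed.

Lemma cabs_p_lt1 : cabs p < 1.
Proof. by rewrite cabs_p expR_lt1; move: hq hr; nra. Qed.

Lemma cabs_p_lt_q2 : cabs p < cabs q ^+ 2.
Proof. by rewrite cabs_p cabs_q -expRM_natl ltr_expR; move: hq hr; nra. Qed.

Lemma cabs_qN_lt1 n : (0 < n)%N -> cabs (q ^+ n) < 1.
Proof. by move=> n0; apply: cabs_pow_lt1 => //; exact: cabs_q_lt1. Qed.

Hypothesis hgen : forall s : rat, r != ratr s.

(** Comparison of the moduli shows i + 2 r j = i' + 2 r j', and r is irrational. *)
Lemma qp_indep (i j i' j' : nat) : q ^+ i * p ^+ j = q ^+ i' * p ^+ j' -> i = i' /\ j = j'.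
Proof.
move=> /(congr1 (@cabs R)); rewrite !cabsM !cabsX cabs_q cabs_p -!expRM_natl -!expRD.
move/expR_inj; rewrite !(mulrA _ (2 * r)) -!mulrDl => /(mulIf (ltr0_neq0 hq)) e.
have ejj : j = j'.
  apply/eqP/negPn/negP => jj; have := hgen (((i'%:Z - i%:Z)%:~R / (2 * (j%:Z - j'%:Z))%:~R)).
  rewrite fmorph_div /= !ratr_int; apply/negP; rewrite negbK.
  have nz : ((2 * (j%:Z - j'%:Z))%:~R : R) != 0.
    by rewrite intr_eq0 mulf_neq0 // subr_eq0 eqz_nat.
  apply/eqP; apply: (mulIf nz); rewrite divfK // rmorphM !rmorphB /=; move: e.
  rewrite -!pmulrn; lra.
by split=> //; move: e; rewrite ejj => /addIr /eqP; rewrite eqr_nat => /eqP.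
Qed.

Section Mode.
Variable m : nat.
Hypothesis m0 : (0 < m)%N.

Definition qnum (k : nat) : C := ((q ^+ m) ^+ k - ((q ^+ m) ^+ k)^-1) / (q - q^-1).

Let Q := q ^+ m.
Let P := p ^+ m.

Lemma Q_neq0 : Q != 0. Proof. by rewrite expf_neq0 // q_neq0. Qed.
Lemma P_neq0 : P != 0. Proof. by rewrite expf_neq0 // p_neq0. Qed.

Lemma pow_neq1 (z : C) : cabs z < 1 -> 1 - z != 0.
Proof. by move=> z1; rewrite subr_eq0; apply: contraTneq z1 => <-; rewrite cabs1 ltxx. Qed.

Lemma P_neq1 : 1 - P != 0.
Proof. by apply/pow_neq1/cabs_pow_lt1/cabs_p_lt1. Qed.

Lemma QQ_neq_P : Q ^+ 2 - P != 0.
Proof.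
rewrite subr_eq0 /Q /P -exprM; apply/eqP => e.
have [|_ m00] := @qp_indep (m * 2) 0 0 m; first by rewrite mulr1 mul1r.
by have := m0; rewrite -m00.
Qed.

Lemma sub_inv_neq0 (z : C) : z != 0 -> cabs z < 1 -> z - z^-1 != 0.
Proof.
move=> z0 z1; rewrite subr_eq0; apply/eqP => /(congr1 (fun x => z * x)).
rewrite mulfV // -expr2 => e; have := @cabs_pow_lt1 _ z 2 isT z1.
by rewrite e cabs1 ltxx.
Qed.

Lemma qnum_neq0 k : (0 < k)%N -> qnum k != 0.
Proof.
move=> k0; rewrite mulf_neq0 // ?invr_eq0.
- apply: sub_inv_neq0; first by rewrite expf_neq0 // Q_neq0.
  by apply: cabs_pow_lt1 => //; exact: cabs_qN_lt1.
- by apply: sub_inv_neq0; [exact: q_neq0|exact: cabs_q_lt1].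
Qed.

Lemma qintM (k : nat) : qint (k%:Z * m%:Z) = qnum k.
Proof. by rewrite /Defs.qint -PoszM -exprnN -exprnP mulnC exprM. Qed.

Lemma qint_oppr (x : int) : qint (- x) = - qint x.
Proof. by rewrite /Defs.qint opprK -mulNr opprB. Qed.

Lemma qint1 : qint m%:Z = qnum 1.
Proof. by rewrite -qintM mul1r. Qed.

Lemma qintMN (k : nat) : qint (k%:Z * - m%:Z) = - qnum k.
Proof. by rewrite mulrN qint_oppr qintM. Qed.

Definition cur_qnum (i j : nat) : C :=
  (if i == j then qnum 2 else 0) - (if i == j.+1 then qnum 1 else 0)
  - (if i.+1 == j then qnum 1 else 0).

Lemma qint_cartan i j : qint (cartan i j * m%:Z) = cur_qnum i j.
Proof.
rewrite /cartan /cur_qnum; have [->|ij] := eqVneq i j.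
  by rewrite (qintM 2) ltn_eqF // gtn_eqF // !subr0.
rewrite [j == i.+1]eq_sym; have [->|ij1] := eqVneq i j.+1.
  by rewrite mulN1r qint_oppr qint1 gtn_eqF // sub0r subr0.
have [_|ij2] := eqVneq i.+1 j; first by rewrite mulN1r qint_oppr qint1 subr0 sub0r.
by rewrite mul0r /Defs.qint oppr0 expr0z subrr mul0r !subr0.
Qed.

Lemma qnum0 : qnum 0 = 0.
Proof. by rewrite /qnum expr0 invr1 subrr mul0r. Qed.

Lemma qnum_rec k : qnum k.+1 * qnum 2 = qnum 1 * (qnum k.+2 + qnum k).
Proof.
have q0 : q - q^-1 != 0 by apply: sub_inv_neq0; [exact: q_neq0|exact: cabs_q_lt1].
have Q0 := Q_neq0; have Qk0 : Q ^+ k != 0 by rewrite expf_neq0.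
rewrite /qnum -/Q !exprS expr0; move: (q - q^-1) q0 (Q ^+ k) Qk0 => d d0 Qk Qk0.
by field; rewrite Q0 Qk0 d0.
Qed.

(** The vector of the q-numbers is annihilated by the q-Cartan matrix except at its last
   place. This is why Phi_N interacts with the current F_(N-1) alone. *)
Lemma qnum_cartan_sum j : (1 <= j < N)%N ->
  \sum_(1 <= i < N) qnum i * cur_qnum i j = if j == N.-1 then qnum N * qnum 1 else 0.
Proof.
move=> /andP[j1 jN].
under eq_bigr => i _ do rewrite /cur_qnum !mulrBr 3!(fun_if (fun x => qnum i * x)) !mulr0.
rewrite !sumrB -!big_mkcond /= [X in _ - _ - X = _](eq_bigl (fun i => i == j.-1)); last first.
  by move=> i; rewrite -{1}(prednK j1) eqSS.
rewrite !big_nat1_eq j1 jN /=.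
have -> : (if (0 < j.-1)%N && (j.-1 < N)%N then qnum j.-1 * qnum 1 else 0) = qnum j.-1 * qnum 1.
  rewrite (leq_ltn_trans (leq_pred _) jN) andbT; case: (j.-1) => [|k] //.
  by rewrite qnum0 mul0r.
have -> : qnum j * qnum 2 = qnum 1 * (qnum j.+1 + qnum j.-1).
  by rewrite -{1}(prednK j1) qnum_rec prednK.
have [jN'|jN'] := eqVneq j N.-1.
  have eN : j.+1 = N by rewrite jN' prednK // (leq_trans _ jN).
  by rewrite eN ltnn; ring.
have -> : (j.+1 < N)%N by move: jN jN'; lia.
ring.
Qed.

(** The m-th coefficient of a contraction between adjacent levels, multiplied by m. *)
Definition contr_fac : C := (Q ^+ 2 - P) / ((1 - P) * Q).

Lemma prime_bcomm i j : prime_coef logq r m%:Z * prime_coef logq r (- m%:Z)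
  * bcomm logq r i j m%:Z = cur_qnum i j * qnum 1 / m%:R * contr_fac.
Proof.
rewrite /prime_coef /bcomm qint_cartan qint1 -!exprnN -!exprnP.
have -> : pst ^+ m = P / Q ^+ 2.
  by rewrite pstE exprMn exprVn -!exprM mulnC.
rewrite -/P -/Q /contr_fac.
have P0 := P_neq0; have Q0 := Q_neq0; have P1 := P_neq1; have QP := QQ_neq_P.
have P1' : P - 1 != 0 by rewrite -opprB oppr_eq0.
have mn0 : (m%:R : C) != 0 by rewrite pnatr_eq0 -lt0n.
have -> : (m%:Z%:~R : C) = m%:R by [].
by field; rewrite ?P0 ?Q0 ?P1 ?QP ?P1' ?mn0.
Qed.

Lemma cur_coefN (j : nat) : (1 < N)%N -> cur_coef N logq N j m%:Z = - (qnum j / (qnum 1 * qnum N)).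
Proof.
move=> hN; rewrite /cur_coef eqxx qint1 !qintM -exprnN -exprnP.
have n1 := @qnum_neq0 1 isT; have nN := @qnum_neq0 N (ltnW hN).
have q0 : q - q^-1 != 0 by apply: sub_inv_neq0; [exact: q_neq0|exact: cabs_q_lt1].
have -> : q ^+ m - (q ^+ m)^-1 = qnum 1 * (q - q^-1) by rewrite /qnum expr1 divfK.
move: (qnum 1) (qnum N) (qnum j) (q - q^-1) n1 nN q0 => a b c d n1 nN q0.
by field; rewrite n1 nN q0.
Qed.

Lemma cur_coefNV (j : nat) : (1 < N)%N -> cur_coef N logq N j (- m%:Z) = qnum j / (qnum 1 * qnum N).
Proof.
move=> hN; rewrite /cur_coef eqxx !qintMN opprK qint_oppr qint1 -exprnN -exprnP.
have n1 := @qnum_neq0 1 isT; have nN := @qnum_neq0 N (ltnW hN).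
have q0 : q - q^-1 != 0 by apply: sub_inv_neq0; [exact: q_neq0|exact: cabs_q_lt1].
have -> : (q ^+ m)^-1 - q ^+ m = - (qnum 1 * (q - q^-1)) by rewrite /qnum expr1 divfK // opprB.
move: (qnum 1) (qnum N) (qnum j) (q - q^-1) n1 nN q0 => a b c d n1 nN q0.
by field; rewrite n1 nN q0.
Qed.

Lemma cur_coefF l (j : nat) : (l < N)%N -> cur_coef N logq l j m%:Z = if j == l then (qnum 1)^-1 else 0.
Proof. by move=> lN; rewrite /cur_coef ltn_eqF // qint1. Qed.

Lemma cur_coefFV l (j : nat) : (l < N)%N ->
  cur_coef N logq l j (- m%:Z) = if j == l then - (qnum 1)^-1 else 0.
Proof. by move=> lN; rewrite /cur_coef ltn_eqF // qint_oppr qint1 invrN. Qed.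

Lemma contr_coefE l l' : contr_coef N logq r l l' m =
  (\sum_(1 <= i < N) \sum_(1 <= j < N)
     cur_coef N logq l i m%:Z * cur_coef N logq l' j (- m%:Z) * cur_qnum i j)
  * (qnum 1 / m%:R * contr_fac).
Proof.
rewrite /contr_coef mulr_suml; apply: eq_bigr => i _; rewrite mulr_suml; apply: eq_bigr => j _.
by rewrite -mulrA prime_bcomm; ring.
Qed.

Lemma sum_pick l (F : nat -> C) (c : C) : (1 <= l < N)%N ->
  \sum_(1 <= i < N) (if i == l then c else 0) * F i = c * F l.
Proof.
move=> hl; under eq_bigr => i _ do rewrite (fun_if (fun x => x * F i)) mul0r.
by rewrite -big_mkcond /= big_nat1_eq hl.
Qed.

Lemma contr_coef_FF l l' : (1 <= l < N)%N -> (1 <= l' < N)%N ->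
  contr_coef N logq r l l' m = - cur_qnum l l' / qnum 1 / m%:R * contr_fac.
Proof.
move=> hl hl'; rewrite contr_coefE.
have [lN l'N] : (l < N)%N /\ (l' < N)%N by case/andP: hl => _ ->; case/andP: hl' => _ ->.
rewrite (eq_bigr (fun i => (if i == l then (qnum 1)^-1 else 0) *
   (\sum_(1 <= j < N) (if j == l' then - (qnum 1)^-1 else 0) * cur_qnum i j))); last first.
  move=> i _; rewrite mulr_sumr; apply: eq_bigr => j _.
  by rewrite cur_coefF // cur_coefFV // mulrA.
rewrite sum_pick // sum_pick //.
have n1 := @qnum_neq0 1 isT; move: (qnum 1) n1 => a n1.
have mn0 : (m%:R : C) != 0 by rewrite pnatr_eq0 -lt0n.
by field; rewrite n1 mn0.
Qed.

Lemma cur_qnumC i j : cur_qnum i j = cur_qnum j i.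
Proof.
rewrite /cur_qnum [j == i]eq_sym [j.+1 == i]eq_sym [j == i.+1]eq_sym.
by rewrite addrAC; case: eqVneq => [->|].
Qed.

Lemma contr_coef_NF l' : (1 < N)%N -> (1 <= l' < N)%N ->
  contr_coef N logq r N l' m = if l' == N.-1 then contr_fac / m%:R else 0.
Proof.
move=> hN hl'; rewrite contr_coefE.
have l'N : (l' < N)%N by case/andP: hl' => _ ->.
rewrite (eq_bigr (fun i => (qnum i * cur_qnum i l') * ((qnum 1)^-1 / (qnum 1 * qnum N)))); last first.
  move=> i _; rewrite (eq_bigr (fun j => (if j == l' then - (qnum 1)^-1 else 0)
     * (cur_coef N logq N i m%:Z * cur_qnum i j))); last first.
    by move=> j _; rewrite cur_coefFV //; ring.
  by rewrite sum_pick // cur_coefN //; ring.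
rewrite -mulr_suml qnum_cartan_sum //; case: ifP => _; last by rewrite !mul0r.
have n1 := @qnum_neq0 1 isT; have nN := @qnum_neq0 N (ltnW hN).
have mn0 : (m%:R : C) != 0 by rewrite pnatr_eq0 -lt0n.
move: (qnum 1) (qnum N) n1 nN => a b n1 nN; by field; rewrite n1 nN mn0.
Qed.

Lemma contr_coef_FN l : (1 < N)%N -> (1 <= l < N)%N ->
  contr_coef N logq r l N m = if l == N.-1 then contr_fac / m%:R else 0.
Proof.
move=> hN hl; rewrite contr_coefE.
have lN : (l < N)%N by case/andP: hl => _ ->.
rewrite (eq_bigr (fun i => (if i == l then (qnum 1)^-1 else 0) * \sum_(1 <= j < N)
    cur_coef N logq N j (- m%:Z) * cur_qnum i j)); last first.
  by move=> i _; rewrite mulr_sumr; apply: eq_bigr => j _; rewrite cur_coefF // mulrA.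
rewrite sum_pick // (eq_bigr (fun j => (qnum j * cur_qnum j l) * (qnum 1 * qnum N)^-1)); last first.
  by move=> j _; rewrite cur_coefNV // [cur_qnum l j]cur_qnumC; ring.
rewrite -mulr_suml qnum_cartan_sum //; case: ifP => _; last by rewrite !mul0r mulr0 mul0r.
have n1 := @qnum_neq0 1 isT; have nN := @qnum_neq0 N (ltnW hN).
have mn0 : (m%:R : C) != 0 by rewrite pnatr_eq0 -lt0n.
move: (qnum 1) (qnum N) n1 nN => a b n1 nN; by field; rewrite n1 nN mn0.
Qed.

Lemma contr_coef_NN : (1 < N)%N ->
  contr_coef N logq r N N m = - (qnum N.-1 / qnum N) * contr_fac / m%:R.
Proof.
move=> hN; rewrite contr_coefE exchange_big /=.
have n1 := @qnum_neq0 1 isT; have nN := @qnum_neq0 N (ltnW hN).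
rewrite big_nat (eq_bigr (fun j => if j == N.-1 then
    - (qnum j / (qnum 1 * qnum N)) else 0)); last first.
  move=> j hj; rewrite (eq_bigr (fun i => (qnum i * cur_qnum i j)
    * (- (qnum j / (qnum 1 * qnum N)) / (qnum 1 * qnum N)))); last first.
    by move=> i _; rewrite cur_coefN // cur_coefNV //; ring.
  rewrite -mulr_suml qnum_cartan_sum //; case: ifP => _; last by rewrite mul0r.
  by move: (qnum 1) (qnum N) n1 nN => a b n1 nN; field; rewrite n1 nN.
rewrite -big_nat -big_mkcond /= big_nat1_eq.
have -> : (0 < N.-1)%N && (N.-1 < N)%N by move: hN; lia.
have mn0 : (m%:R : C) != 0 by rewrite pnatr_eq0 -lt0n.
move: (qnum 1) (qnum N) n1 nN => a b n1 nN; by field; rewrite n1 nN mn0.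
Qed.

End Mode.
End Contractions.

(** * The contractions in closed form *)

Lemma same_aux (F : fieldType) (Q P : F) : Q != 0 -> 1 - P != 0 ->
  - (Q + Q^-1) * ((Q ^+ 2 - P) / ((1 - P) * Q)) =
  P / Q ^+ 2 / (1 - P) - (1 + Q ^+ 2 / (1 - P)).
Proof. by move=> Q0 P1; field; rewrite Q0 P1. Qed.

Lemma NN_aux (F : fieldType) (d Q P T : F) : Q != 0 -> 1 - P != 0 -> d != 0 -> T != 0 ->
  1 - Q ^+ 2 * T ^+ 2 != 0 ->
  - ((T - T^-1) / d / ((Q * T - (Q * T)^-1) / d)) * ((Q ^+ 2 - P) / ((1 - P) * Q)) =
  P / ((1 - P) * (1 - Q ^+ 2 * T ^+ 2)) + Q ^+ 2 * T ^+ 2 / ((1 - P) * (1 - Q ^+ 2 * T ^+ 2))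
   - (Q ^+ 2 / ((1 - P) * (1 - Q ^+ 2 * T ^+ 2)) + P * T ^+ 2 / ((1 - P) * (1 - Q ^+ 2 * T ^+ 2))).
Proof.
move=> Q0 P1 d0 T0 h.
have h' : Q ^+ 2 * T ^+ 2 - 1 != 0 by rewrite -opprB oppr_eq0.
have -> : (Q * T - (Q * T)^-1) = (Q ^+ 2 * T ^+ 2 - 1) / (Q * T) by field; rewrite Q0 T0.
have -> : T - T^-1 = (T ^+ 2 - 1) / T by field.
by field; rewrite !exprMn h h' P1 Q0 d0 T0.
Qed.

Section ContractionFormulas.
Variable R : realType.
Local Notation C := R[i].
Variables (N : nat) (logq : C) (r : R).
Local Notation q := (qq logq).
Local Notation p := (pp logq r).
Hypothesis hN : (1 < N)%N.
Hypothesis hq : complex.Re logq < 0.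
Hypothesis hr : 1 < r.
Hypothesis hgen : forall s : rat, r != ratr s.

Let p1 := cabs_p_lt1 hq hr.

Lemma contr_coef_adj l l' m : (0 < m)%N -> (1 <= l <= N)%N -> (1 <= l' <= N)%N ->
  (l' == l.+1) || (l == l'.+1) ->
  contr_coef N logq r l l' m = contr_fac logq r m / m%:R.
Proof.
move=> m0 /andP[l1 lN] /andP[l'1 l'N] ll'.
have n1 := @qnum_neq0 _ logq hq m m0 1 isT.
have [eN|lN'] := eqVneq l N; last have [eN|l'N'] := eqVneq l' N.
- rewrite eN (contr_coef_NF hq hr hgen) //; last by move: ll' lN l'N l'1; rewrite eN; lia.
  by rewrite ifT //; move: ll' l'N; rewrite eN; lia.
- rewrite eN (contr_coef_FN hq hr hgen) //; last by move: lN lN' l1; lia.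
  by rewrite ifT //; move: ll' lN lN' l'N; rewrite eN; lia.
- rewrite (contr_coef_FF hq hr hgen) //; try by move: lN lN' l1 l'N l'N' l'1; lia.
  rewrite /cur_qnum; have -> : (l == l') = false by move: ll'; lia.
  have [e|ne] := eqVneq l l'.+1.
    have -> : (l.+1 == l') = false by rewrite e; lia.
    by rewrite sub0r subr0 opprK divff // mul1r mulrC.
  have -> : (l.+1 == l') = true by move: ll' ne; lia.
  by rewrite subr0 sub0r opprK divff // mul1r mulrC.
Qed.

Lemma contr_coef_far l l' m : (0 < m)%N -> (1 <= l <= N)%N -> (1 <= l' <= N)%N ->
  (l.+1 < l')%N || (l'.+1 < l)%N -> contr_coef N logq r l l' m = 0.
Proof.
move=> m0 /andP[l1 lN] /andP[l'1 l'N] ll'.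
have [eN|lN'] := eqVneq l N; last have [eN|l'N'] := eqVneq l' N.
- rewrite eN (contr_coef_NF hq hr hgen) //; last by move: ll' lN l'N l'1; rewrite eN; lia.
  by rewrite ifF //; move: ll' l'N; rewrite eN; lia.
- rewrite eN (contr_coef_FN hq hr hgen) //; last by move: lN lN' l1; lia.
  by rewrite ifF //; move: ll' lN lN' l'N; rewrite eN; lia.
- rewrite (contr_coef_FF hq hr hgen) //; try by move: lN lN' l1 l'N l'N' l'1; lia.
  rewrite /cur_qnum.
  have -> : (l == l') = false by move: ll'; lia.
  have -> : (l == l'.+1) = false by move: ll'; lia.
  have -> : (l.+1 == l') = false by move: ll'; lia.
  by rewrite !subr0 oppr0 !mul0r.
Qed.

Lemma summable0 : summable (fun=> [::] : seq C).
Proof. by exists 0 => K; rewrite /mass big1 // => j _; rewrite big_nil. Qed.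

Lemma linf_nil w : linf (fun=> [::] : seq C) w = 1.
Proof.
apply: ccvg_clim; have -> : (fun K => lprod (fun=> [::]) K w) = fun=> 1; last exact: ccvg_cst.
by apply/funext => K; rewrite /lprod big1 // => j _; rewrite big_nil.
Qed.

Lemma contr_far l l' : (1 <= l <= N)%N -> (1 <= l' <= N)%N ->
  (l.+1 < l')%N || (l'.+1 < l)%N -> contr N logq r l l' = fun=> 1.
Proof.
move=> hl hl' ll'; rewrite /contr.
have pz m : (0 < m)%N -> ccvg (psum (fun=> [::] : seq C) m) 0.
  move=> _; have -> : psum (fun=> [::] : seq C) m = fun=> 0; last exact: ccvg_cst.
  by apply/funext => K; rewrite /psum big1 // => j _; rewrite big_nil.
rewrite (mero_exp_linf summable0 summable0 pz pz) //; last first.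
  by move=> m m0; rewrite contr_coef_far // subrr mul0r.
by apply/funext => w; rewrite linf_nil divr1.
Qed.

(** The coefficients are power sums of the factors of two q-products with base p, which
   have no common factor because q and p are multiplicatively independent. *)
Lemma contr_adj l l' : (1 <= l <= N)%N -> (1 <= l' <= N)%N ->
  (l' == l.+1) || (l == l'.+1) ->
  contr N logq r l l' = fun w => poch1 (p / q * w) p / poch1 (q * w) p.
Proof.
move=> hl hl' ll'; rewrite /contr.
have q0 := q_neq0 logq.
rewrite (mero_exp_linf (summable_layers1 (p / q) p1) (summable_layers1 q p1)
  (fun m m0 => psum_layers1 (p / q) m0 p1) (fun m m0 => psum_layers1 q m0 p1)).
- by apply/funext => w; rewrite !poch1E.
- move=> m m0; rewrite contr_coef_adj // /contr_fac; congr (_ / _).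
  have P1 := P_neq1 hq hr m0; have Q0 := Q_neq0 logq m; rewrite exprMn exprVn.
  by move: (q ^+ m) (p ^+ m) P1 Q0 => Q P P1 Q0; field; rewrite P1 Q0.
- move=> j k x y; rewrite !inE => /eqP -> /eqP ->; apply/eqP => /(congr1 ( *%R q)).
  have -> : q * (p / q * p ^+ j) = q ^+ 0 * p ^+ j.+1 by rewrite exprS; field.
  by rewrite mulrA -expr2 => /(qp_indep hq hgen) [].
Qed.

Lemma contr_same l : (1 <= l < N)%N ->
  contr N logq r l l = fun w => (1 - w) * poch1 (q ^+ 2 * w) p / poch1 (p / q ^+ 2 * w) p.
Proof.
move=> hl; rewrite /contr.
have q0 := q_neq0 logq; have p0 := p_neq0 logq r.
pose one j : seq C := if j is 0 then [:: 1] else [::].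
have s1 : summable one.
  exists 1 => K; rewrite /mass; case: K => [|K]; first by rewrite big_ord0.
  by rewrite big_ord_recl big_seq1 cabs1 big1 ?addr0 // => j _; rewrite big_nil.
have lone w : linf one w = 1 - w.
  apply: ccvg_clim; apply: (@ccvg_unshift _ _ _ 1).
  have -> : (fun k => lprod one (k + 1) w) = fun=> 1 - w; last exact: ccvg_cst.
  apply/funext => K; rewrite addn1 /lprod big_ord_recl big_seq1 mul1r big1 ?mulr1 // => j _.
  by rewrite big_nil.
have pone m : ccvg (psum one m) 1.
  apply: (@ccvg_unshift _ _ _ 1).
  have -> : (fun k => psum one m (k + 1)) = fun=> 1; last exact: ccvg_cst.
  apply/funext => K; rewrite addn1 /psum big_ord_recl big_seq1 expr1n big1 ?addr0 // => j _.
  by rewrite big_nil.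
have sl := summable_layers1 (q ^+ 2) p1.
rewrite (mero_exp_linf (summable_cat s1 sl) (summable_layers1 (p / q ^+ 2) p1)
  (pa := fun m => 1 + (q ^+ 2) ^+ m / (1 - p ^+ m))
  (pb := fun m => (p / q ^+ 2) ^+ m / (1 - p ^+ m))).
- by apply/funext => w; rewrite linf_cat // lone !poch1E.
- move=> m m0.
  have -> : psum (fun j => one j ++ [:: q ^+ 2 * p ^+ j]) m =
      fun K => psum one m K + psum (fun j => [:: q ^+ 2 * p ^+ j]) m K.
    by apply/funext => K; rewrite /psum -big_split; apply: eq_bigr => j _; rewrite big_cat.
  by apply: ccvgD => //; exact: psum_layers1.
- by move=> m m0; exact: psum_layers1.
- move=> m m0; rewrite (contr_coef_FF hq hr hgen) // /contr_fac /cur_qnum eqxx.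
  rewrite ltn_eqF // gtn_eqF // !subr0 mulrAC; congr (_ / _).
  have P1 := P_neq1 hq hr m0; have Q0 := Q_neq0 logq m.
  have qq0 := sub_inv_neq0 q0 (cabs_q_lt1 hq).
  have QQ0 := sub_inv_neq0 Q0 (cabs_qN_lt1 hq m0).
  have -> : qnum logq m 2 = qnum logq m 1 * (q ^+ m + (q ^+ m)^-1).
    rewrite /qnum expr1; move: (q - q^-1) qq0 (q ^+ m) Q0 => d d0 Q Q0.
    by field; rewrite d0 Q0.
  have n1 := @qnum_neq0 _ logq hq m m0 1 isT.
  rewrite [- _ / _](_ : _ = - (q ^+ m + (q ^+ m)^-1)); last by rewrite -mulrN mulrAC divff ?mul1r.
  have e1 : (q ^+ 2) ^+ m = (q ^+ m) ^+ 2 by rewrite -!exprM mulnC.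
  rewrite exprMn exprVn e1.
  exact: same_aux.
- move=> j k x y; rewrite mem_cat !inE => hx /eqP ->; apply/eqP => /(congr1 ( *%R (q ^+ 2))).
  have -> : q ^+ 2 * (p / q ^+ 2 * p ^+ k) = q ^+ 0 * p ^+ k.+1.
    by rewrite mulrA [q ^+ 2 * _]mulrC divfK ?expf_neq0 // mul1r -exprS.
  case/orP: hx => [|/eqP ->].
    by case: j => [|j] //; rewrite inE => /eqP ->; move=> /(qp_indep hq hgen (j := 0)) [].
  by rewrite mulrA -exprD => /(qp_indep hq hgen) [].
Qed.

(** [(N-1) m] / [N m] expands in powers of q^(2 N m), so that the power sums are those of
   double products with bases p and q^(2 N). *)
Lemma contr_NN : contr N logq r N N = fun w =>
  dpoch N logq r (q ^+ 2 * w) * dpoch N logq r (p * q ^+ (2 * N - 2) * w)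
  / (dpoch N logq r (p * w) * dpoch N logq r (q ^+ (2 * N) * w)).
Proof.
rewrite /contr /dpoch.
have q0 := q_neq0 logq; have p0 := p_neq0 logq r.
have t1 : cabs (q ^+ (2 * N)) < 1 by apply: cabs_qN_lt1 => //; move: hN; lia.
have sl c := @summable_layers2 _ c _ _ p1 t1.
have pl c m m0 := @psum_layers2 _ c _ _ m m0 p1 t1.
set den := fun m => (1 - p ^+ m) * (1 - (q ^+ (2 * N)) ^+ m).
have pc c d m : (0 < m)%N -> ccvg (psum (fun j => layers2 c p (q ^+ (2 * N)) j ++
    layers2 d p (q ^+ (2 * N)) j) m) (c ^+ m / den m + d ^+ m / den m).
  move=> m0; rewrite (_ : psum _ m = fun K => psum (layers2 c p (q ^+ (2 * N))) m K +
      psum (layers2 d p (q ^+ (2 * N))) m K).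
    by apply: ccvgD; exact: pl.
  by apply/funext => K; rewrite /psum -big_split; apply: eq_bigr => j _; rewrite big_cat.
rewrite (mero_exp_linf (summable_cat (sl (q ^+ 2)) (sl (p * q ^+ (2 * N - 2))))
  (summable_cat (sl p) (sl (q ^+ (2 * N)))) (pc _ _) (pc _ _)).
- by apply/funext => w; rewrite !poch2E (linf_cat w (sl _) (sl _)) (linf_cat w (sl p) (sl _)).
- move=> m m0; rewrite (contr_coef_NN hq hr hgen) //; congr (_ / _).
  have P1 := P_neq1 hq hr m0; have Q0 := Q_neq0 logq m.
  have qq0 := sub_inv_neq0 q0 (cabs_q_lt1 hq).
  have eN : N = (N.-1).+1 by rewrite prednK // ltnW.
  have e1 : (q ^+ 2) ^+ m = (q ^+ m) ^+ 2 by rewrite -!exprM mulnC.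
  have e3 : (q ^+ (2 * N)) ^+ m = (q ^+ m) ^+ 2 * ((q ^+ m) ^+ N.-1) ^+ 2.
    by rewrite -!exprM -exprD; congr (_ ^+ _); rewrite {1}eN; lia.
  have e2 : (p * q ^+ (2 * N - 2)) ^+ m = p ^+ m * ((q ^+ m) ^+ N.-1) ^+ 2.
    by rewrite exprMn -!exprM; congr (_ * _ ^+ _); lia.
  have e4 : (q ^+ m) ^+ N = q ^+ m * (q ^+ m) ^+ N.-1 by rewrite {1}eN exprS.
  have QN1 : 1 - (q ^+ m) ^+ 2 * ((q ^+ m) ^+ N.-1) ^+ 2 != 0.
    by rewrite -e3; apply/pow_neq1/cabs_pow_lt1.
  rewrite /den /contr_fac /qnum e1 e2 e3 e4; apply: NN_aux => //.
  by rewrite expf_neq0.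
- move=> j k x y; rewrite mem_cat => hx; rewrite mem_cat => hy; apply/eqP => exy; subst y.
  have {}hx : exists a b, x = q ^+ (2 + 2 * N * b) * p ^+ a \/ x = q ^+ (2 * N - 2 + 2 * N * b) * p ^+ a.
    case/orP: hx => /mem_layers2 [a [b ->]].
      by exists a, b; left; rewrite exprD (exprM q (2 * N)); ring.
    by exists a.+1, b; right; rewrite exprD exprS (exprM q (2 * N) b); ring.
  have {}hy : exists a b, x = q ^+ (2 * N * b) * p ^+ a.
    case/orP: hy => /mem_layers2 [a [b ->]].
      by exists a.+1, b; rewrite exprS (exprM q (2 * N) b); ring.
    by exists a, b.+1; rewrite mulnS exprD (exprM q (2 * N) b); ring.
  have [a' [b' ex]] := hy.
  have [a [b [e|e]]] := hx; move: e; rewrite ex => /(qp_indep hq hgen) [e _].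
  - have : (N %| 1 + N * b)%N.
      have -> : (1 + N * b = N * b')%N  by move: e; rewrite -!mulnA; lia.
      exact: dvdn_mulr.
    by rewrite dvdn_addl ?dvdn_mulr // dvdn1 => /eqP; move: hN; lia.
  - have : (N %| 1 + N * b')%N.
      have -> : (1 + N * b' = N * b.+1)%N by move: e; rewrite mulnS -!mulnA; move: hN; lia.
      exact: dvdn_mulr.
    by rewrite dvdn_addl ?dvdn_mulr // dvdn1 => /eqP; move: hN; lia.
Qed.

End ContractionFormulas.

(** * Integration over an interval *)

Section UnitIntervalIntegral.
Variable R : realType.
Local Notation RR := (measurableTypeR R).
Local Notation D := (`[0%R, 1%R]%classic : set R).
Local Notation mu := (@lebesgue_measure R).

Definition I01 (g : R -> R) : R := Rintegral mu D g.

Let mD : @measurable _ RR D. Proof. exact: measurable_itv. Qed.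

Lemma muD : mu D = 1%E.
Proof. by rewrite lebesgue_measure_itv /= lte_fin ltr01 oppr0 adde0. Qed.

Lemma bounded_integrable (g : R -> R) (B : R) : measurable_fun setT g ->
  (forall x, 0 <= x <= 1 -> `|g x| <= B) -> mu.-integrable D (EFin \o g).
Proof.
move=> mg hB; apply: measurable_bounded_integrable => //.
- by have := ltry (1 : R); rewrite -muD.
- exact: measurable_funTS.
- exists B; split; first exact: num_real.
  by move=> M BM x /=; rewrite in_itv /= => /hB h; apply: le_trans h _; exact: ltW.
Qed.

Lemma I01_bound (g : R -> R) (B : R) : measurable_fun setT g ->
  (forall x, 0 <= x <= 1 -> `|g x| <= B) -> `|I01 g| <= B.
Proof.
move=> mg hB; have ig := bounded_integrable mg hB.
apply: le_trans (@le_normr_Rintegral _ _ R mu D g mD ig) _.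
have -> : B = Rintegral mu D (fun=> B).
  apply/esym; rewrite Rintegral_cst //.
  exact: etrans (congr1 (fun z => B * fine z) muD) (mulr1 B).
apply: le_Rintegral => //.
- by apply: (@bounded_integrable _ B) => [|x /hB]; [exact: measurableT_comp|rewrite normr_id].
- apply: (@bounded_integrable _ `|B|) => [|x _]; [exact: measurable_cst|exact: lexx].
Qed.

Lemma I01D (f g : R -> R) (B B' : R) : measurable_fun setT f -> measurable_fun setT g ->
  (forall x, 0 <= x <= 1 -> `|f x| <= B) -> (forall x, 0 <= x <= 1 -> `|g x| <= B') ->
  I01 (fun x => f x + g x) = I01 f + I01 g.
Proof.
move=> mf mg hf hg; apply: RintegralD => //.
- exact: bounded_integrable mf hf.
- exact: bounded_integrable mg hg.
Qed.

Lemma I01Z (c : R) (f : R -> R) (B : R) : measurable_fun setT f ->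
  (forall x, 0 <= x <= 1 -> `|f x| <= B) ->
  I01 (fun x => c * f x) = c * I01 f.
Proof. by move=> mf hf; apply: RintegralZl => //; exact: bounded_integrable mf hf. Qed.

Lemma eq_I01 (f g : R -> R) : (forall x, 0 <= x <= 1 -> f x = g x) -> I01 f = I01 g.
Proof.
by move=> h; apply: eq_Rintegral => x; rewrite inE /= in_itv /= => /h.
Qed.

Lemma I01E (g : R -> R) : I01 g = fine (\int[mu]_x (g x * \1_D x)%:E)%E.
Proof.
rewrite /I01 /Rintegral integral_mkcond; congr fine; apply: eq_integral => x _.
by rewrite patchE indicE; case: ifP; rewrite ?mulr1 ?mulr0.
Qed.

Lemma measurable_I01 d (S : measurableType d) (G : S * RR -> R) :
  measurable_fun setT G -> measurable_fun setT (fun w => I01 (fun x => G (w, x))).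
Proof.
move=> mG.
pose f (z : S * RR) : \bar R := (G z * \1_D z.2)%:E.
have mf : measurable_fun setT f.
  apply/measurable_EFinP; apply: measurable_funM => //.
  by apply: measurableT_comp; [exact: measurable_indic|exact: measurable_snd].
rewrite (_ : (fun w => _) = fun w => fine (\int[mu]_x (f^\+ (w, x)) - \int[mu]_x (f^\- (w, x)))%E).
  apply: measurableT_comp; first exact: fine_measurable.
  apply: emeasurable_funB.
  - exact: (@measurable_fun_fubini_tonelli_F _ _ S RR R mu (funepos f) (measurable_funepos mf)
      (funepos_ge0 f)).
  - exact: (@measurable_fun_fubini_tonelli_F _ _ S RR R mu (funeneg f) (measurable_funeneg mf)
      (funeneg_ge0 f)).
apply/funext => w; rewrite I01E integralE; congr (fine (_ - _)%E).
- by apply: eq_integral => x _; rewrite !funeposE.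
- by apply: eq_integral => x _; rewrite !funenegE.
Qed.

Lemma I01_swap (G : RR * RR -> R) (B : R) : measurable_fun setT G ->
  (forall x y, 0 <= x <= 1 -> 0 <= y <= 1 -> `|G (x, y)| <= B) ->
  I01 (fun x => I01 (fun y => G (x, y))) = I01 (fun y => I01 (fun x => G (x, y))).
Proof.
move=> mG hB.
pose F (z : RR * RR) : \bar R := (G z * \1_D z.1 * \1_D z.2)%:E.
have iF : (mu \x mu)%E.-integrable setT F.
  have mDD : @measurable _ (RR * RR)%type (D `*` D) by exact: (@measurableX _ _ RR RR).
  have h : (mu \x mu)%E.-integrable (D `*` D) (EFin \o G).
    apply: measurable_bounded_integrable => //.
    - have e := @product_measure1E _ _ RR RR R mu mu D D mD mD.
      have := ltry (1 : R); rewrite -[1%E]mule1 -{1 2}muD; by rewrite -e.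
    - exact: measurable_funTS.
    - exists B; split; first exact: num_real.
      move=> M BM [x y] /= []; rewrite !in_itv /= => hx hy.
      by apply: le_trans (hB x y hx hy) _; exact: ltW.
  have := (integrable_mkcond _ mDD).1 h; apply: eq_integrable => // -[x y] _.
  rewrite patchE /F /= !indicE; have [xy|xy] := boolP ((x, y) \in D `*` D).
    by move: xy; rewrite in_setX => /andP[-> ->]; rewrite !mulr1.
  move: xy; rewrite in_setX negb_and => /orP[] /negbTE ->; by rewrite ?mulr0 ?mul0r.
have := Fubini iF.
have e1 x : (\int[mu]_y F (x, y) = (I01 (fun y => G (x, y)) * \1_D x)%:E)%E.
  rewrite indicE; case: (boolP (x \in D)) => hx; last first.
    rewrite mulr0 integral0_eq // => y _.
    by rewrite /F /= indicE (negbTE hx) mulr0 mul0r.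
  rewrite mulr1 I01E fineK.
    by apply: eq_integral => y _; rewrite /F /= [\1_D x]indicE hx mulr1.
  have hx' : 0 <= x <= 1 by move: hx; rewrite inE /= in_itv.
  have := @bounded_integrable (fun y => G (x, y)) B _ (fun y => hB x y hx').
  move=> /(_ (measurableT_comp mG (measurable_pair1 _))) /integrable_fin_num.
  rewrite integral_mkcond (eq_integral (fun y => (G (x, y) * \1_D y)%:E)); first by move=> h; exact: h.
  move=> y _.
  by rewrite patchE indicE; case: ifP; rewrite ?mulr1 ?mulr0.
have e2 y : (\int[mu]_x F (x, y) = (I01 (fun x => G (x, y)) * \1_D y)%:E)%E.
  rewrite indicE; case: (boolP (y \in D)) => hy; last first.
    rewrite mulr0 integral0_eq // => x _.
    by rewrite /F /= [\1_D y]indicE (negbTE hy) mulr0.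
  rewrite mulr1 I01E fineK.
    by apply: eq_integral => x _; rewrite /F /= [\1_D y]indicE hy mulr1.
  have hy' : 0 <= y <= 1 by move: hy; rewrite inE /= in_itv.
  have := @bounded_integrable (fun x => G (x, y)) B _ (fun x hx => hB x y hx hy').
  move=> /(_ (measurableT_comp mG (measurable_pair2 _))) /integrable_fin_num.
  rewrite integral_mkcond (eq_integral (fun x => (G (x, y) * \1_D x)%:E)); first by move=> h; exact: h.
  move=> x _.
  by rewrite patchE indicE; case: ifP; rewrite ?mulr1 ?mulr0.
under eq_integral do rewrite e1.
under [X in _ = X -> _]eq_integral do rewrite e2.
by move=> /(congr1 fine); rewrite -!I01E.
Qed.

(** A finite set is negligible for the Lebesgue measure. *)
Lemma I01_finite_diff (f g : R -> R) (B : set R) : finite_set B -> measurable_fun setT g ->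
  (forall x, 0 <= x <= 1 -> ~ B x -> f x = g x) -> I01 f = I01 g.
Proof.
move=> fB mg h.
have mfin (A : set RR) : finite_set A -> measurable A.
  move=> fA; apply: countable_measurable; last exact: finite_set_countable.
  by move=> x; exact: (@lebesgue_stieltjes_measure.measurable_set1 R x).
pose k (x : RR) : R := if x \in B then f x else g x.
have mk : measurable_fun (setT : set RR) k.
  move=> _ Y mY; rewrite setTI.
  have -> : k @^-1` Y = (B `&` (f @^-1` Y)) `|` (~` B `&` (g @^-1` Y)).
    apply/seteqP; split => x; rewrite /k /=.
    - by case: (boolP (x \in B)) => [|]; rewrite ?inE ?notin_setE => hx hY; [left|right].
    - by move=> [[hx hY]|[hx hY]]; [rewrite mem_set|rewrite memNset].
  apply: measurableU; first by apply: mfin; apply: sub_finite_set fB; exact: subIsetl.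
  apply: measurableI; first by apply: measurableC; exact: mfin.
  by rewrite -[_ @^-1` _]setTI; exact: mg.
have eqf : I01 f = I01 k.
  by apply: eq_I01 => x hx; rewrite /k; case: ifP => // /negbT; rewrite notin_setE => /(h x hx).
rewrite eqf /I01 /Rintegral; congr fine; apply: (@ae_eq_integral _ RR R mu) => //.
- exact/measurable_EFinP/measurable_funTS.
- exact/measurable_EFinP/measurable_funTS.
exists B; split; first exact: mfin.
- exact: countable_lebesgue_measure0 (finite_set_countable fB).
- move=> x /= hx; apply: contrapT => nB; apply: hx => _; rewrite /k memNset //.
Qed.

End UnitIntervalIntegral.

(** * Integrals over the torus *)

(** Adjacent swaps bring any entry to the front, and one concludes by induction. *)
Lemma perm_adjacent (T : eqType) (A : Type) (Q : seq T -> A) :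
  (forall s1 c d s2, Q (s1 ++ c :: d :: s2) = Q (s1 ++ d :: c :: s2)) ->
  forall s t, perm_eq s t -> Q s = Q t.
Proof.
move=> hQ.
have move_front c s1 s2 : forall s0, Q (s0 ++ s1 ++ c :: s2) = Q (s0 ++ c :: s1 ++ s2).
  elim: s1 => [|d s1 IH] s0 //=.
  by rewrite -cat_rcons IH cat_rcons hQ.
move=> s t; suff aux : forall s0, perm_eq s t -> Q (s0 ++ s) = Q (s0 ++ t) by exact: (aux [::]).
elim: s t => [|c s IH] t s0 st; first by move: st; rewrite perm_sym => /perm_nilP ->.
have ct : c \in t by rewrite -(perm_mem st) mem_head.
case/splitPr: ct st => t1 t2 st.
rewrite move_front -!cat_rcons; apply: IH.
by rewrite -(perm_cons c) (perm_trans st) // perm_sym -cat1s perm_catCA.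
Qed.

Section TorusIntegrals.
Variable R : realType.
Local Notation C := R[i].
Implicit Types (F G : (nat -> R) -> C) (tau : nat -> R).

Definition mfun F : Prop :=
  forall d (S : measurableType d) (X : nat -> S -> R),
    (forall c, measurable_fun setT (X c)) ->
    measurable_fun setT (fun w => complex.Re (F (fun c => X c w))) /\
    measurable_fun setT (fun w => complex.Im (F (fun c => X c w))).

Definition cube tau : Prop := forall c, 0 <= tau c <= 1.

(** Measurability is stated for all measurable families of coordinates, so that it
   passes through the iterated integrals without a sigma-algebra on nat -> R. *)
Definition nice F : Prop := mfun F /\ exists B, forall tau, cube tau -> cabs (F tau) <= B.

Definition upd tau (c : nat) (x : R) : nat -> R := fun d => if d == c then x else tau d.

Lemma cube_upd tau c x : cube tau -> 0 <= x <= 1 -> cube (upd tau c x).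
Proof. by move=> ht hx d; rewrite /upd; case: ifP. Qed.

Lemma updC tau c d x y : c != d -> upd (upd tau c x) d y = upd (upd tau d y) c x.
Proof.
move=> cd; apply/funext => e; rewrite /upd; case: (eqVneq e d) => [->|//].
by rewrite eq_sym (negbTE cd).
Qed.

Lemma mfun_cst (z : C) : mfun (fun=> z).
Proof. by move=> d S X mX; split; exact: measurable_cst. Qed.

Lemma mfunD F G : mfun F -> mfun G -> mfun (fun tau => F tau + G tau).
Proof.
move=> mF mG d S X mX; have [f1 f2] := mF d S X mX; have [g1 g2] := mG d S X mX; split.
- by under eq_fun do rewrite ReD; exact: measurable_funD.
- by under eq_fun do rewrite ImD; exact: measurable_funD.
Qed.

Lemma mfunM F G : mfun F -> mfun G -> mfun (fun tau => F tau * G tau).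
Proof.
move=> mF mG d S X mX; have [f1 f2] := mF d S X mX; have [g1 g2] := mG d S X mX; split.
- by under eq_fun do rewrite ReM; apply: measurable_funB; apply: measurable_funM.
- by under eq_fun do rewrite ImM; apply: measurable_funD; apply: measurable_funM.
Qed.

Lemma nice_cst (z : C) : nice (fun=> z).
Proof. by split; [exact: mfun_cst|exists (cabs z)]. Qed.

Lemma niceD F G : nice F -> nice G -> nice (fun tau => F tau + G tau).
Proof.
move=> [mF [B hB]] [mG [B' hB']]; split; first exact: mfunD.
exists (B + B') => tau ht; apply: le_trans (cabs_triangle _ _) _.
by apply: lerD; [exact: hB|exact: hB'].
Qed.

Lemma niceM F G : nice F -> nice G -> nice (fun tau => F tau * G tau).
Proof.
move=> [mF [B hB]] [mG [B' hB']]; split; first exact: mfunM.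
exists (B * B') => tau ht; rewrite cabsM.
by apply: ler_pM; rewrite ?cabs_ge0 //; [exact: hB|exact: hB'].
Qed.

Lemma nice_sum (I : Type) (s : seq I) (P : pred I) (F : I -> (nat -> R) -> C) :
  (forall i, P i -> nice (F i)) -> nice (fun tau => \sum_(i <- s | P i) F i tau).
Proof.
move=> h; elim: s => [|i s IH].
  rewrite (_ : (fun _ => _) = fun=> 0); first exact: nice_cst.
  by apply/funext => tau; rewrite big_nil.
case Pi : (P i); last first.
  rewrite (_ : (fun _ => _) = fun tau => \sum_(i <- s | P i) F i tau) //.
  by apply/funext => tau; rewrite big_cons Pi.
rewrite (_ : (fun _ => _) = fun tau => F i tau + \sum_(i <- s | P i) F i tau).
  by apply: niceD => //; exact: h.
by apply/funext => tau; rewrite big_cons Pi.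
Qed.

Lemma nice_prod (I : eqType) (s : seq I) (P : pred I) (F : I -> (nat -> R) -> C) :
  (forall i, i \in s -> P i -> nice (F i)) -> nice (fun tau => \prod_(i <- s | P i) F i tau).
Proof.
elim: s => [|i s IH] h.
  rewrite (_ : (fun _ => _) = fun=> 1); first exact: nice_cst.
  by apply/funext => tau; rewrite big_nil.
have {}IH : nice (fun tau => \prod_(i <- s | P i) F i tau).
  by apply: IH => j js; apply: h; rewrite inE js orbT.
case Pi : (P i); last first.
  rewrite (_ : (fun _ => _) = fun tau => \prod_(i <- s | P i) F i tau) //.
  by apply/funext => tau; rewrite big_cons Pi.
rewrite (_ : (fun _ => _) = fun tau => F i tau * \prod_(i <- s | P i) F i tau).
  by apply: niceM => //; apply: h => //; exact: mem_head.
by apply/funext => tau; rewrite big_cons Pi.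
Qed.

Lemma nice_relabel F (rho : nat -> nat) : nice F -> nice (fun tau => F (fun c => tau (rho c))).
Proof.
move=> [mF [B hB]]; split.
- by move=> d S X mX; exact: (mF d S (fun c => X (rho c))).
- by exists B => tau ht; apply: hB => c; exact: ht.
Qed.

Lemma mfun_section F tau c : mfun F ->
  measurable_fun setT (fun x => complex.Re (F (upd tau c x))) /\
  measurable_fun setT (fun x => complex.Im (F (upd tau c x))).
Proof.
move=> mF; apply: (mF _ R (fun e x => upd tau c x e)) => e.
by rewrite /upd; case: (e == c); [exact: measurable_id|exact: measurable_cst].
Qed.

Lemma circle_intE (f : R -> C) : circle_int f =
  I01 (fun x => complex.Re (f x)) +i* I01 (fun x => complex.Im (f x)).
Proof. by []. Qed.

Lemma eq_circle_int (f g : R -> C) : (forall x, 0 <= x <= 1 -> f x = g x) ->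
  circle_int f = circle_int g.
Proof. by move=> h; rewrite !circle_intE; congr (_ +i* _); apply: eq_I01 => x /h ->. Qed.

Lemma nice_circle F c : nice F -> nice (fun tau => circle_int (fun x => F (upd tau c x))).
Proof.
move=> [mF [B hB]]; split.
- move=> d S X mX.
  pose Y (e : nat) (z : S * measurableTypeR R) : R := if e == c then z.2 else X e z.1.
  have mY e : measurable_fun setT (Y e).
    rewrite /Y; case: (e == c); first exact: measurable_snd.
    exact: (measurableT_comp (mX e) measurable_fst).
  have [m1 m2] := mF _ _ Y mY.
  by split; [exact: (measurable_I01 m1)|exact: (measurable_I01 m2)].
- exists (B + B) => tau ht; have [m1 m2] := mfun_section tau c mF.
  apply: le_trans (cabs_le _) _; apply: lerD; apply: I01_bound => // x hx.
  + by apply: le_trans (Re_le_cabs _) _; apply: hB; exact: cube_upd.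
  + by apply: le_trans (Im_le_cabs _) _; apply: hB; exact: cube_upd.
Qed.

Lemma circle_int_swap F c d tau : nice F -> cube tau -> c != d ->
  circle_int (fun x => circle_int (fun y => F (upd (upd tau c x) d y))) =
  circle_int (fun y => circle_int (fun x => F (upd (upd tau d y) c x))).
Proof.
move=> [mF [B hB]] ht cd; rewrite !circle_intE.
pose Y (e : nat) (z : measurableTypeR R * measurableTypeR R) : R :=
  if e == d then z.2 else if e == c then z.1 else tau e.
have mY e : measurable_fun setT (Y e).
  rewrite /Y; case: (e == d); first exact: measurable_snd.
  by case: (e == c); [exact: measurable_fst|exact: measurable_cst].
have [m1 m2] := mF _ _ Y mY.
have eY x y : (fun e => Y e (x, y)) = upd (upd tau c x) d y by [].
apply: (f_equal2 (@Complex R)) => /=.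
- rewrite (I01_swap (B := B) m1) => [|x y hx hy]; last first.
    by apply: le_trans (Re_le_cabs _) _; apply: hB; rewrite eY; do 2![apply: cube_upd => //].
  by apply: eq_I01 => y _; apply: eq_I01 => x _; rewrite eY updC.
- rewrite (I01_swap (B := B) m2) => [|x y hx hy]; last first.
    by apply: le_trans (Im_le_cabs _) _; apply: hB; rewrite eY; do 2![apply: cube_upd => //].
  by apply: eq_I01 => y _; apply: eq_I01 => x _; rewrite eY updC.
Qed.

Lemma circle_intD F G c tau : nice F -> nice G -> cube tau ->
  circle_int (fun x => F (upd tau c x) + G (upd tau c x)) =
  circle_int (fun x => F (upd tau c x)) + circle_int (fun x => G (upd tau c x)).
Proof.
move=> [mF [B hB]] [mG [B' hB']] ht.
have [f1 f2] := mfun_section tau c mF; have [g1 g2] := mfun_section tau c mG.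
rewrite !circle_intE; apply: eq_ReIm => /=.
- under eq_I01 do [].
  rewrite -(I01D (B := B) (B' := B')) //.
  + by apply: eq_I01 => x _; rewrite ReD.
  + by move=> x hx; apply: le_trans (Re_le_cabs _) _; apply: hB; exact: cube_upd.
  + by move=> x hx; apply: le_trans (Re_le_cabs _) _; apply: hB'; exact: cube_upd.
- rewrite -(I01D (B := B) (B' := B')) //.
  + by apply: eq_I01 => x _; rewrite ImD.
  + by move=> x hx; apply: le_trans (Im_le_cabs _) _; apply: hB; exact: cube_upd.
  + by move=> x hx; apply: le_trans (Im_le_cabs _) _; apply: hB'; exact: cube_upd.
Qed.

Lemma circle_intZ F c tau (z : C) : nice F -> cube tau ->
  circle_int (fun x => z * F (upd tau c x)) = z * circle_int (fun x => F (upd tau c x)).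
Proof.
move=> [mF [B hB]] ht; have [f1 f2] := mfun_section tau c mF.
have bR x : 0 <= x <= 1 -> `|complex.Re (F (upd tau c x))| <= B.
  by move=> hx; apply: le_trans (Re_le_cabs _) _; apply: hB; exact: cube_upd.
have bI x : 0 <= x <= 1 -> `|complex.Im (F (upd tau c x))| <= B.
  by move=> hx; apply: le_trans (Im_le_cabs _) _; apply: hB; exact: cube_upd.
have mZ (a : R) (f : R -> R) : measurable_fun setT f -> measurable_fun setT (fun x => a * f x).
  by move=> mf; apply: measurable_funM => //; exact: measurable_cst.
have bZ (a : R) (f : R -> R) : (forall x, 0 <= x <= 1 -> `|f x| <= B) ->
    forall x, 0 <= x <= 1 -> `|a * f x| <= `|a| * B.
  by move=> hf x hx; rewrite normrM ler_wpM2l // hf.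
case: z => a b; rewrite !circle_intE; apply: eq_ReIm; rewrite ?ReM ?ImM /=.
- rewrite -(I01Z a f1 bR) -mulNr -(I01Z (- b) f2 bI) -(I01D (mZ _ _ f1) (mZ _ _ f2) (bZ a _ bR) (bZ (- b) _ bI)).
  by apply: eq_I01 => x _; rewrite ReM /= mulNr.
- rewrite -(I01Z a f2 bI) -(I01Z b f1 bR) -(I01D (mZ _ _ f2) (mZ _ _ f1) (bZ a _ bI) (bZ b _ bR)).
  by apply: eq_I01 => x _; rewrite ImM /=.
Qed.

(** The variables of integration are named by labels instead of positions in the iterated
   integral, so that reordering and renaming them are operations on s and on tau. *)
Fixpoint tint (s : seq nat) F tau : C :=
  if s is c :: s' then circle_int (fun x => tint s' F (upd tau c x)) else F tau.

Lemma nice_tint s F : nice F -> nice (tint s F).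
Proof. by move=> nF; elim: s => [|c s IH] //=; exact: nice_circle. Qed.

Lemma tint_swap s1 c d s2 F tau : nice F -> cube tau ->
  tint (s1 ++ c :: d :: s2) F tau = tint (s1 ++ d :: c :: s2) F tau.
Proof.
move=> nF; elim: s1 tau => [|e s1 IH] tau ht /=; last first.
  by apply: eq_circle_int => x hx; apply: IH; exact: cube_upd.
have [-> //|cd] := eqVneq c d.
by apply: (circle_int_swap (nice_tint s2 nF)).
Qed.

Lemma tint_perm s t F tau : nice F -> cube tau -> perm_eq s t -> tint s F tau = tint t F tau.
Proof.
move=> nF ht; apply: (perm_adjacent (Q := fun s => tint s F tau)) => s1 c d s2.
exact: tint_swap.
Qed.

Lemma eq_tint s F G tau : cube tau -> (forall tau, cube tau -> F tau = G tau) ->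
  tint s F tau = tint s G tau.
Proof.
move=> ht h; elim: s tau ht => [|c s IH] tau ht /=; first exact: h.
by apply: eq_circle_int => x hx; apply: IH; exact: cube_upd.
Qed.

Lemma tintD s F G tau : nice F -> nice G -> cube tau ->
  tint s (fun tau => F tau + G tau) tau = tint s F tau + tint s G tau.
Proof.
move=> nF nG; elim: s tau => [|c s IH] tau ht //=.
rewrite -(circle_intD c (nice_tint s nF) (nice_tint s nG) ht).
by apply: eq_circle_int => x hx; apply: IH; exact: cube_upd.
Qed.

Lemma tintZ s F tau z : nice F -> cube tau ->
  tint s (fun tau => z * F tau) tau = z * tint s F tau.
Proof.
move=> nF; elim: s tau => [|c s IH] tau ht //=.
rewrite -(circle_intZ c z (nice_tint s nF) ht).
by apply: eq_circle_int => x hx; apply: IH; exact: cube_upd.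
Qed.

Lemma tint0 s tau : cube tau -> tint s (fun=> 0) tau = 0.
Proof.
move=> ht; rewrite -[RHS](mul0r (tint s (fun=> 0) tau)) -tintZ //; last exact: nice_cst.
by apply: eq_tint => // t _; rewrite mul0r.
Qed.

Lemma tint_sum (I : Type) (r : seq I) s (F : I -> (nat -> R) -> C) tau :
  (forall i, nice (F i)) -> cube tau ->
  tint s (fun tau => \sum_(i <- r) F i tau) tau = \sum_(i <- r) tint s (F i) tau.
Proof.
move=> nF ht; elim: r => [|i r IH].
  by rewrite big_nil -[RHS](tint0 s ht); apply: eq_tint => // t _; rewrite big_nil.
rewrite big_cons -IH -tintD //; last exact: nice_sum.
by apply: eq_tint => // t _; rewrite big_cons.
Qed.

Lemma tint_relabel s F (rho : nat -> nat) tau : injective rho ->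
  tint (map rho s) (fun tau => F (fun c => tau (rho c))) tau
  = tint s F (fun c => tau (rho c)).
Proof.
move=> inj; elim: s tau => [|c s IH] tau //=.
apply: eq_circle_int => x hx; rewrite IH; congr (tint s F).
by apply/funext => e; rewrite /upd (inj_eq inj).
Qed.

(** Renaming the variables permutes the integrals, which Fubini puts back in order. *)
Lemma tint_permute s F (rho : nat -> nat) tau : injective rho -> nice F -> cube tau ->
  perm_eq (map rho s) s -> (forall c, tau (rho c) = tau c) ->
  tint s (fun tau => F (fun c => tau (rho c))) tau = tint s F tau.
Proof.
move=> inj nF ht hs hc.
rewrite -(tint_perm (nice_relabel rho nF) ht hs) tint_relabel //.
by congr (tint s F); apply/funext.
Qed.

(** Each of the iterated integrals ignores finitely many values of its variable. Only G has
   to be measurable, since F agrees with it almost everywhere. *)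
Lemma tint_finite_diff s F G (B : set R) tau : finite_set B -> nice G -> cube tau ->
  (forall tau', cube tau' -> (forall c, c \in s -> ~ B (tau' c)) -> F tau' = G tau') ->
  tint s F tau = tint s G tau.
Proof.
move=> fB nG ht h.
have {h} : forall tau', cube tau' -> (forall c, c \notin s -> tau' c = tau c) ->
    (forall c, c \in s -> ~ B (tau' c)) -> F tau' = G tau'.
  by move=> tau' ht' _; exact: h.
elim: s tau ht => [|c s IH] tau ht h /=; first by apply: h.
have [m1 m2] := mfun_section tau c (proj1 (nice_tint s nG)).
have e x : 0 <= x <= 1 -> ~ B x -> tint s F (upd tau c x) = tint s G (upd tau c x).
  move=> hx nB; apply: IH; first exact: cube_upd.
  move=> tau' ht' eo nb; have [cs|cs] := boolP (c \in s).
    apply: h => // d; rewrite inE.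
    - rewrite negb_or => /andP[dc ds]; by rewrite eo // /upd (negbTE dc).
    - by case/orP => [/eqP ->|]; exact: nb.
  apply: h => // d; rewrite inE.
  - rewrite negb_or => /andP[dc ds]; by rewrite eo // /upd (negbTE dc).
  - by case/orP => [/eqP ->|]; [rewrite eo // /upd eqxx|exact: nb].
by rewrite !circle_intE; congr (_ +i* _); apply: (I01_finite_diff fB) => // x hx nB; rewrite e.
Qed.

Lemma cube0 : cube (fun=> 0).
Proof. by move=> c; rewrite lexx ler01. Qed.

Lemma torus_int_tail M (f : (nat -> R) -> C) :
  torus_int M f = torus_int M (fun th => f (fun i => if (i < M)%N then th i else 0)).
Proof.
elim: M f => [|M IH] f /=; first by [].
congr circle_int; apply/funext => x; rewrite IH; congr torus_int; apply/funext => th.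
by congr f; apply/funext => -[|i].
Qed.

Lemma torus_int_tint s F : uniq s ->
  torus_int (size s) (fun th => F (fun c => th (index c s))) = tint s F (fun=> 0).
Proof.
move=> us; have aux : forall tau, torus_int (size s)
    (fun th => F (fun c => if c \in s then th (index c s) else tau c)) = tint s F tau.
  elim: s us => [|c s IH] /= us tau; first by [].
  case/andP: us => cs us; congr circle_int; apply/funext => x; rewrite -IH //.
  congr torus_int; apply/funext => th; congr F; apply/funext => d; rewrite inE /upd.
  rewrite [c == d]eq_sym; have [->|dc] //= := eqVneq d c.
  by rewrite (negbTE cs).
rewrite -aux torus_int_tail; congr torus_int; apply/funext => th; congr F; apply/funext => c.
by rewrite index_mem.
Qed.

Lemma torus_int_iota M F : torus_int M F = tint (iota 0 M) F (fun=> 0).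
Proof.
rewrite -torus_int_tint ?iota_uniq // size_iota torus_int_tail [RHS]torus_int_tail.
congr torus_int; apply/funext => th; congr F; apply/funext => c; case: ifP => cM.
  have e : nth 0%N (iota 0 M) c = c by rewrite nth_iota.
  have e' : index c (iota 0 M) = c by rewrite -{1}e index_uniq ?size_iota ?iota_uniq.
  by rewrite e' cM.
by rewrite memNindex ?size_iota ?ltnn // mem_iota add0n cM.
Qed.

End TorusIntegrals.

(** * Words in the currents *)

Section PairProducts.
Variables (T : eqType) (K : comNzRingType).
Implicit Types (g : T -> T -> K) (s : seq T).

(** The scalar left by normal ordering is of this form, g being the factor of two letters,
   and the comparison of two orders of the letters is one of such products. *)
Fixpoint pairprod g s : K :=
  if s is c :: s' then (\prod_(d <- s') g c d) * pairprod g s' else 1.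

Lemma pairprod_cat g s t :
  pairprod g (s ++ t) = pairprod g s * pairprod g t * \prod_(c <- s) \prod_(d <- t) g c d.
Proof.
elim: s => [|c s IH] /=; first by rewrite big_nil mul1r mulr1.
by rewrite IH big_cat big_cons /=; ring.
Qed.

Lemma pairprodM g g' s :
  pairprod (fun c d => g c d * g' c d) s = pairprod g s * pairprod g' s.
Proof. by elim: s => [|c s IH] /=; rewrite ?mulr1 // IH big_split /=; ring. Qed.

Lemma pairprod_const (z : K) s : pairprod (fun _ _ => z) s = z ^+ 'C(size s, 2).
Proof.
elim: s => [|c s IH] /=; first by rewrite expr0.
by rewrite IH big_const_seq count_predT iter_mulr_1 binS bin1 addnC exprD.
Qed.

Lemma eq_pairprod (lt : rel T) g g' s : pairwise lt s ->
  {in s &, forall c d, lt c d -> g c d = g' c d} -> pairprod g s = pairprod g' s.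
Proof.
elim: s => [|c s IH] //= /andP[/allP hc hs] h; congr (_ * _).
  rewrite big_seq [RHS]big_seq; apply: eq_bigr => d ds.
  by apply: h; rewrite ?inE ?eqxx ?ds ?orbT //; exact: hc.
by apply: IH => // d e ds es; apply: h; rewrite inE ?ds ?es orbT.
Qed.

Lemma pairprod_perm g s t : (forall c d, g c d = g d c) -> perm_eq s t ->
  pairprod g s = pairprod g t.
Proof.
move=> gC; apply: perm_adjacent => s1 c d s2; rewrite !pairprod_cat /= !big_cons.
rewrite (gC d c); congr (_ * _); first by ring.
by apply: eq_bigr => e _; rewrite !big_cons mulrCA.
Qed.

End PairProducts.

Lemma pairprod_map (T T' : eqType) (K : comNzRingType) (g : T -> T -> K) (f : T' -> T) s :
  pairprod g (map f s) = pairprod (fun c d => g (f c) (f d)) s.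
Proof. by elim: s => [|c s IH] //=; rewrite big_map IH. Qed.

Section OperatorWords.
Variable R : realType.
Local Notation C := R[i].
Variables (N : nat) (logq : C) (r : R).
Local Notation W := 'rV[C]_N.
Variable kap : W -> W -> C.
Local Notation qpow := (qpow logq).
Local Notation contr := (contr N logq r).
Local Notation fmul := (@fmul R N logq r).
Local Notation fop_prod := (@fop_prod R N logq r).

Lemma fop_eq (A B : fop R N) : letters A = letters B -> wshift A = wshift B ->
  (forall x y, zcoef A x y = zcoef B x y) -> A = B.
Proof.
case: A => la wa za; case: B => lb wb zb /= -> -> h; congr Fop.
by apply/funext => x; apply/funext => y.
Qed.

Lemma fmul1f A : fmul (fone R N) A = A.
Proof.
by apply: fop_eq => //= [|x y]; rewrite ?add0r // big_nil !mul1r.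
Qed.

Lemma fmulf1 A : fmul A (fone R N) = A.
Proof.
apply: fop_eq => /= [||x y]; rewrite ?cats0 ?addr0 // big1 ?mul1r ?mulr1 // => c _.
by rewrite big_nil.
Qed.

Lemma fmulA A B D : fmul A (fmul B D) = fmul (fmul A B) D.
Proof.
apply: fop_eq => /= [||x y]; rewrite ?catA ?addrA //.
rewrite big_cat /=; under eq_bigr do rewrite big_cat /=; rewrite big_split /=.
rewrite (addrAC x (wshift B)); ring.
Qed.

Lemma fop_prod_cat s t : fop_prod (s ++ t) = fmul (fop_prod s) (fop_prod t).
Proof. by elim: s => [|A s IH] /=; rewrite ?fmul1f // IH fmulA. Qed.

Definition zright (A : fop R N) (g : W -> W -> C) : fop R N :=
  Fop (letters A) (wshift A) (fun x y => zcoef A x y * g x y).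

Lemma fmul_fzero A g : fmul A (fzero g) = zright A g.
Proof.
apply: fop_eq => /= [||x y]; rewrite ?cats0 ?addr0 // big1 ?mul1r // => c _.
by rewrite big_nil.
Qed.

Lemma fmul_zright_r A g B : fmul A (zright B g) = zright (fmul A B) g.
Proof. by apply: fop_eq => //= x y; ring. Qed.

(** Current l shifts the weight by - wt l. *)
Definition wt (l : nat) : W := if l == N then epsbar R N N else alpha R N l.

Lemma wtN : wt N = epsbar R N N.
Proof. by rewrite /wt eqxx. Qed.

Lemma wtF l : (l < N)%N -> wt l = alpha R N l.
Proof. by move=> lN; rewrite /wt ltn_eqF. Qed.

Lemma dotDr (w x y : W) : dot w (x + y) = dot w x + dot w y.
Proof. by rewrite /dot -big_split; apply: eq_bigr => i _; rewrite mxE mulrDr. Qed.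

Lemma dotNr (w x : W) : dot w (- x) = - dot w x.
Proof. by rewrite /dot -sumrN; apply: eq_bigr => i _; rewrite mxE mulrN. Qed.

Lemma dotZr (w x : W) (a : C) : dot w (a *: x) = a * dot w x.
Proof. by rewrite /dot mulr_sumr; apply: eq_bigr => i _; rewrite mxE mulrCA. Qed.

Lemma dotC (w x : W) : dot w x = dot x w.
Proof. by apply: eq_bigr => i _; rewrite mulrC. Qed.

Lemma dot0r (w : W) : dot w 0 = 0.
Proof. by rewrite /dot big1 // => i _; rewrite mxE mulr0. Qed.

Lemma sgnpowD (a b : C) : sgnpow (a + b) = sgnpow a * sgnpow b.
Proof. by rewrite /sgnpow mulrDr cexpD. Qed.

Definition zm (l : nat) (v : C) (x y : W) : C :=
  if l == N
  then sgnpow (- dot (epsbar R N N) x) * qpow (2 * v * - dot (epsbar R N N) x)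
       * qpow (2 * v * (dot (epsbar R N N) (x + y) / r%:C))
  else qpow (2 * v * (- dot (alpha R N l) x + 1))
       * qpow (((N - l)%:R + 2 * v) * ((dot (alpha R N l) (x + y) - 1) / r%:C)).

(** The factor that [zm l v] acquires when x is replaced by x + d. *)
Definition zsh (l : nat) (v : C) (d : W) : C :=
  if l == N
  then sgnpow (- dot (epsbar R N N) d) * qpow (2 * v * - dot (epsbar R N N) d)
       * qpow (2 * v * (dot (epsbar R N N) d / r%:C))
  else qpow (2 * v * - dot (alpha R N l) d)
       * qpow (((N - l)%:R + 2 * v) * (dot (alpha R N l) d / r%:C)).

Lemma zm_shift l v x d y : zm l v (x + d) y = zm l v x y * zsh l v d.
Proof.
rewrite /zm /zsh; case: ifP => _.
- rewrite !dotDr opprD sgnpowD.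
  rewrite (_ : 2 * v * (- dot _ x - _) = 2 * v * - dot (epsbar R N N) x
    + 2 * v * - dot (epsbar R N N) d); last by ring.
  rewrite (_ : 2 * v * ((_ + _ + _) / _) = 2 * v * ((dot (epsbar R N N) x + dot (epsbar R N N) y) / r%:C)
    + 2 * v * (dot (epsbar R N N) d / r%:C)); last by ring.
  by rewrite !qpowD; ring.
- rewrite !dotDr.
  rewrite (_ : 2 * v * (- (_ + _) + 1) = 2 * v * (- dot (alpha R N l) x + 1)
    + 2 * v * - dot (alpha R N l) d); last by ring.
  rewrite (_ : (_ + 2 * v) * _ = ((N - l)%:R + 2 * v) * ((dot (alpha R N l) x + dot (alpha R N l) y - 1) / r%:C)
    + ((N - l)%:R + 2 * v) * (dot (alpha R N l) d / r%:C)); last by ring.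
  by rewrite !qpowD; ring.
Qed.

Lemma zshD l v d d' : zsh l v (d + d') = zsh l v d * zsh l v d'.
Proof.
have h : zm l v 0 0 != 0.
  rewrite /zm; case: ifP => _; rewrite !mulf_neq0 ?qpow_neq0 //; exact: cexp_neq0.
apply: (mulfI h); rewrite -zm_shift addrA zm_shift add0r -{1}(add0r d) zm_shift; ring.
Qed.

Lemma zsh0 l v : zsh l v 0 = 1.
Proof.
by rewrite /zsh; case: ifP => _; rewrite !dot0r !oppr0 !mul0r !mulr0 qpow0 ?mulr1 //;
  rewrite /sgnpow mulr0 cexp0.
Qed.

Lemma zsh_sum l v (I : Type) (s : seq I) (F : I -> W) :
  zsh l v (\sum_(i <- s) F i) = \prod_(i <- s) zsh l v (F i).
Proof. by apply: (big_morph _ (zshD l v) (zsh0 l v)). Qed.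

(** The factor q^(N-l) in front of the variable of F_l is part of zm; Phi_N and the F_l are
   then instances of one operator. *)
Definition cur (c : nat * C) : fop R N :=
  Fop [:: c] (- wt c.1) (fun x y => kap (- wt c.1) x * zm c.1 c.2 x y).

Lemma PhiN_cur u : PhiN logq r kap u = cur (N, u).
Proof.
by apply: fop_eq => //= [|x y]; rewrite /wt /zm eqxx //; ring.
Qed.

Lemma Fcur_cur l v : (l < N)%N -> Fcur logq r kap l v = cur (l, v).
Proof.
by move=> lN; apply: fop_eq => //= [|x y]; rewrite /wt /zm ltn_eqF //; ring.
Qed.

Fixpoint kapw (ls : seq nat) (x : W) : C :=
  if ls is l :: ls' then kap (- wt l) (x - \sum_(l' <- ls') wt l') * kapw ls' x else 1.

(** The contraction of c with d times the factor that the zero modes of c acquire from the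
   weight shift of d. *)
Definition pair_coef (c d : nat * C) : C :=
  contr c.1 d.1 (qpow (2 * d.2) / qpow (2 * c.2)) * zsh c.1 c.2 (- wt d.1).

Definition word (s : seq (nat * C)) : fop R N := fop_prod [seq cur c | c <- s].

Lemma letters_word s : letters (word s) = s.
Proof. by elim: s => [|c s IH] //=; rewrite -/(word s) IH. Qed.

Lemma wshift_word s : wshift (word s) = - \sum_(c <- s) wt c.1.
Proof.
elim: s => [|c s IH] /=; first by rewrite big_nil oppr0.
by rewrite -/(word s) IH big_cons opprD.
Qed.

Lemma word_cat s t : word (s ++ t) = fmul (word s) (word t).
Proof. by rewrite /word map_cat fop_prod_cat. Qed.

(** Besides the lattice cocycle kapw and the zero modes at the initial weight, the coefficient
   is a product over pairs, because zero modes are exponential in the weight. *)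
Lemma zcoef_word s x y : zcoef (word s) x y =
  kapw [seq c.1 | c <- s] x * pairprod pair_coef s * \prod_(c <- s) zm c.1 c.2 x y.
Proof.
elim: s => [|c s IH]; first by rewrite /= big_nil !mulr1.
rewrite /word /= -/(word s) IH letters_word big_seq1 !big_cons wshift_word big_map.
rewrite zm_shift -sumrN zsh_sum /pair_coef big_split /=; ring.
Qed.

Definition nX (l : nat) (vs : seq C) : fop R N :=
  if l == N then nPhi logq r kap vs else nF logq r kap l vs.

Definition nord_const (l : nat) : C := if l == N then 1 else qpow (- (2 * (N - l)%:R / r%:C)).

Lemma letters_nX l vs : letters (nX l vs) = [seq (l, v) | v <- vs].
Proof. by rewrite /nX; case: eqP => [->|]. Qed.

Lemma wshift_nX l vs : wshift (nX l vs) = - \sum_(v <- vs) wt l.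
Proof.
by rewrite big_const_seq count_predT iter_addr_0 /nX /wt; case: eqP => _ /=; rewrite mulNrn.
Qed.

Lemma kapw_nseq m l x : kap_iter kap m (- wt l) x = kapw (nseq m l) x.
Proof.
elim: m => [|m IH]; first by rewrite /kap_iter big_ord0.
rewrite /kap_iter big_ord_recr -/(kap_iter kap m (- wt l) x) IH /= mulrC; congr (kap _ _ * _).
by rewrite big_nseq iter_addr_0 mulNrn.
Qed.

Lemma zcoef_nX l vs x y : (r != 0) -> zcoef (nX l vs) x y =
  kapw (nseq (size vs) l) x * nord_const l ^+ 'C(size vs, 2) * \prod_(v <- vs) zm l v x y.
Proof.
move=> r0; have rC : r%:C != 0 :> C by rewrite (inj_eq (@complexI R) r 0).
rewrite /nX /nord_const; case: eqP => [->|/eqP lN] /=.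
  rewrite -kapw_nseq /wt eqxx expr1n mulr1; congr (_ * _); apply: eq_bigr => v _.
  by rewrite /zm eqxx.
rewrite -kapw_nseq /wt (negbTE lN) -!mulrA; congr (_ * _).
set a := dot _ (x + y).
set P := \prod_(v <- vs) _; set h := qpow (- _).
rewrite [X in _ = _ * X](eq_bigr (fun v => (qpow (2 * v * (- dot (alpha R N l) x + 1))
     * qpow (2 * v * ((a - 1) / r%:C))) * qpow ((N - l)%:R * ((a - 1) / r%:C)))); last first.
  by move=> v _; rewrite /zm (negbTE lN) -/a (mulrDl (N - l)%:R (2 * v)) qpowD; ring.
rewrite big_split /= -/P [RHS]mulrCA; congr (_ * _).
rewrite /h big_const_seq count_predT iter_mulr_1 -!qpowMn -qpowD; congr qpow.
have -> : ((size vs)%:R ^+ 2 : C) = 2 * 'C(size vs, 2)%:R + (size vs)%:R.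
  rewrite -natrX -natrM -natrD; congr (_%:R); elim: (size vs) => [|m IH] //.
  by rewrite binS bin1; lia.
by field.
Qed.

Definition nord_coef (c d : nat * C) : C := if c.1 == d.1 then nord_const c.1 else pair_coef c d.

(** Within a level the contractions are absent, and only the constants that the zero modes
   leave behind, which do not depend on the variables, remain. *)
Lemma nX_prod (ls : seq nat) (vs : nat -> seq C) : r != 0 -> uniq ls ->
  let A := fop_prod [seq nX l (vs l) | l <- ls] in
  let s := flatten [seq [seq (l, v) | v <- vs l] | l <- ls] in
  [/\ letters A = s, wshift A = - \sum_(c <- s) wt c.1 &
    forall x y, zcoef A x y =
      kapw [seq c.1 | c <- s] x * pairprod nord_coef s * \prod_(c <- s) zm c.1 c.2 x y].
Proof.
move=> r0; elim: ls => [|l ls IH] /=.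
  by move=> _; split=> // [|x y]; rewrite big_nil ?oppr0 ?mulr1.
case/andP => lls /IH [h1 h2 h3]; set s := flatten _ in h1 h2 h3 *.
split=> [||x y].
- by rewrite h1 letters_nX.
- by rewrite h2 wshift_nX big_cat big_map opprD.
rewrite h1 h2 h3 letters_nX zcoef_nX // pairprod_cat big_cat map_cat /= !big_map.
have e1 : pairprod nord_coef [seq (l, v) | v <- vs l] = nord_const l ^+ 'C(size (vs l), 2).
  rewrite pairprod_map -pairprod_const; congr (pairprod _ _).
  by apply/funext => c; apply/funext => d; rewrite /nord_coef eqxx.
have e2 x' : \prod_(v <- vs l) zm l v (x' - \sum_(c <- s) wt c.1) y
    = \prod_(v <- vs l) (zm l v x' y * \prod_(c <- s) zsh l v (- wt c.1)).
  by apply: eq_bigr => v _; rewrite zm_shift -sumrN zsh_sum.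
have e3 : \prod_(v <- vs l) \prod_(d <- s) nord_coef (l, v) d
   = \prod_(v <- vs l) \prod_(d <- s) (contr l d.1 (qpow (2 * d.2) / qpow (2 * v)) * zsh l v (- wt d.1)).
  apply: eq_bigr => v _; rewrite big_seq [RHS]big_seq; apply: eq_bigr => d ds.
  rewrite /nord_coef /pair_coef /= ifF //; apply: contraNF lls => /eqP ->.
  by case/flattenP: ds => _ /mapP[l' l'ls ->] /mapP[v' _ ->].
have e4 (t : seq nat) m : kapw (nseq m l ++ t) x
    = kapw (nseq m l) (x - \sum_(l' <- t) wt l') * kapw t x.
  elim: m => [|m IHm] /=; first by rewrite mul1r.
  by rewrite IHm big_cat opprD /= addrAC mulrA addrA.
have e0 : [seq c.1 | c <- [seq (l, v) | v <- vs l]] = nseq (size (vs l)) l.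
  by elim: (vs l) => //= ? ? ->.
rewrite e0 e1 e2 e3 e4 big_split /=.
under [X in _ = _ * (_ * _ * X) * _]eq_bigr do rewrite big_split /=.
rewrite big_split /= big_map; ring.
Qed.

End OperatorWords.

(** * Exchange of the zero modes *)

Section ZeroModeExchange.
Variable R : realType.
Local Notation C := R[i].
Variables (N : nat) (logq : C) (r : R).
Local Notation W := 'rV[C]_N.
Variable kap : W -> W -> C.
Local Notation qpow := (qpow logq).
Local Notation eps := (eps R N).
Local Notation alpha := (alpha R N).
Local Notation epsbar := (epsbar R N).
Local Notation wt := (wt R N).

Lemma sum_delta k a b : \sum_(a <= i < b) ((i == k)%:R : C) = ((a <= k) && (k < b))%N%:R.
Proof.
under eq_bigr do rewrite mulrb.
by rewrite -big_mkcond /= big_nat1_eq; case: ifP.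
Qed.

Lemma dotBr (w x y : W) : dot w (x - y) = dot w x - dot w y.
Proof. by rewrite dotDr dotNr. Qed.

Lemma dotBl (w x y : W) : dot (x - y) w = dot x w - dot y w.
Proof. by rewrite !(dotC _ w) dotBr. Qed.

Lemma dot_sumr (I : Type) (s : seq I) (F : I -> W) w :
  dot w (\sum_(i <- s) F i) = \sum_(i <- s) dot w (F i).
Proof. by apply: (big_morph _ (dotDr w) (dot0r w)). Qed.

Lemma dot_eps_l j (x : W) (hj : (j.-1 < N)%N) : (0 < j)%N -> dot (eps j) x = x 0 (Ordinal hj).
Proof.
move=> j0; rewrite /dot (bigD1 (Ordinal hj)) //= mxE /= prednK // eqxx mul1r big1 ?addr0 // => i ij.
rewrite mxE (_ : _ == j = false) ?mul0r //; apply: contraNF ij => /eqP e.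
by apply/eqP/val_inj => /=; rewrite -e.
Qed.

Lemma dot_eps j k : (1 <= j <= N)%N -> dot (eps j) (eps k) = (j == k)%:R.
Proof.
case/andP=> j0 jN; have hj : (j.-1 < N)%N by rewrite prednK.
by rewrite (dot_eps_l _ hj) // mxE /= prednK.
Qed.

Lemma dot_eps_epsbar j k : (1 <= j <= N)%N -> dot (eps j) (epsbar k) = (j == k)%:R - (N%:R)^-1.
Proof.
move=> hj; rewrite dotBr dot_eps // dotZr dot_sumr.
under eq_bigr do rewrite dot_eps // eq_sym.
by rewrite sum_delta ltnS hj mulr1.
Qed.

Lemma dot_alpha_epsbar j k : (1 <= j < N)%N ->
  dot (alpha j) (epsbar k) = (j == k)%:R - (j.+1 == k)%:R.
Proof.
move=> /andP[j0 jN]; rewrite dotBl !dot_eps_epsbar; first by ring.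
all: by rewrite ?j0 ?jN ?(ltnW jN).
Qed.

Lemma dot_epsbar2 : (0 < N)%N -> dot (epsbar N) (epsbar N) = (N%:R - 1) / N%:R.
Proof.
move=> N0; have nN : (N%:R : C) != 0 by rewrite pnatr_eq0 -lt0n.
rewrite {1}/Defs.epsbar dotBl dot_eps_epsbar ?N0 ?leqnn // eqxx dotC dotZr dot_sumr.
rewrite big_nat (eq_bigr (fun k => (k == N)%:R - (N%:R)^-1)); last first.
  by move=> k hk; rewrite dotC dot_eps_epsbar // -ltnS.
rewrite -big_nat sumrB sum_delta ltnS N0 leqnn /=.
rewrite sumr_const_nat subn1 /=. rewrite -[X in _ - _ * (_ - X)]mulr_natl mulfV // subrr mulr0 subr0.
by rewrite mulrBl mulfV // mul1r.
Qed.

Lemma dot_alpha j k : (1 <= j < N)%N ->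
  dot (alpha j) (alpha k) = (j == k)%:R *+ 2 - (j == k.+1)%:R - (j.+1 == k)%:R.
Proof.
move=> /andP[j0 jN]; rewrite dotBl !dotBr !dot_eps ?eqSS; first by ring.
all: by rewrite ?j0 ?jN ?(ltnW jN).
Qed.

Lemma dot_wt_adj l l' : (1 <= l <= N)%N -> (1 <= l' <= N)%N ->
  (l' == l.+1) || (l == l'.+1) -> dot (wt l) (wt l') = -1.
Proof.
wlog ll' : l l' / (l' == l.+1).
  move=> h hl hl' /orP[e|e]; first by apply: h; rewrite ?e.
  by rewrite dotC; apply: h; rewrite ?e.
rewrite (eqP ll') => /andP[l0 lN] /andP[_ l'N] _; have lN' := l'N.
rewrite (wtF _ lN'); move: l'N; rewrite leq_eqVlt => /orP[/eqP e|l'N].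
  by rewrite e wtN dot_alpha_epsbar ?l0 // e eqxx ltn_eqF // sub0r.
by rewrite wtF // dot_alpha ?l0 // eqxx !ltn_eqF ?mul0rn ?subr0 ?sub0r //; lia.
Qed.

Lemma dot_wt_far l l' : (1 <= l <= N)%N -> (1 <= l' <= N)%N -> (l.+1 < l')%N || (l'.+1 < l)%N ->
  dot (wt l) (wt l') = 0.
Proof.
wlog ll' : l l' / (l.+1 < l')%N.
  move=> h hl hl' /orP[e|e]; first by apply: h; rewrite ?e.
  by rewrite dotC; apply: h; rewrite ?e.
move=> /andP[l0 lN] /andP[_ l'N] _.
have lN' : (l < N)%N by lia.
rewrite wtF //; move: l'N; rewrite leq_eqVlt => /orP[/eqP e|l'N].
  by rewrite e wtN dot_alpha_epsbar ?l0 // !ltn_eqF ?subr0 //; lia.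
by rewrite wtF // dot_alpha ?l0 // !ltn_eqF ?mul0rn ?subr0 //; lia.
Qed.

Lemma dot_alpha2 l : (1 <= l < N)%N -> dot (alpha l) (alpha l) = 2.
Proof. by move=> hl; rewrite dot_alpha // eqxx ltn_eqF // gtn_eqF // !subr0. Qed.


Lemma zformBl (x y z : W) : zform (x - y) z = zform x z - zform y z.
Proof.
rewrite /zform -sumrB; apply: eq_bigr => i _; rewrite -sumrB; apply: eq_bigr => j _.
by rewrite !mxE; ring.
Qed.

Lemma zformBr (x y z : W) : zform z (x - y) = zform z x - zform z y.
Proof.
rewrite /zform -sumrB; apply: eq_bigr => i _; rewrite -sumrB; apply: eq_bigr => j _.
by rewrite !mxE; ring.
Qed.

Lemma zform_eps j k : (1 <= j <= N)%N -> (1 <= k <= N)%N ->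
  zform (eps j) (eps k) = (Num.sg (j%:Z - k%:Z))%:~R.
Proof.
move=> /andP[j0 jN] /andP[k0 kN].
have hj : (j.-1 < N)%N by rewrite prednK.
have hk : (k.-1 < N)%N by rewrite prednK.
have neq (m : nat) (m0 : (0 < m)%N) (hm : (m.-1 < N)%N) (i : 'I_N) :
    i != Ordinal hm -> eps m 0 i = 0.
  move=> im; rewrite mxE (_ : _ == m = false) //; apply: contraNF im => /eqP e.
  by apply/eqP/val_inj => /=; rewrite -e.
rewrite /zform (bigD1 (Ordinal hj)) //= (bigD1 (Ordinal hk)) //= !mxE /= !prednK // !eqxx !mul1r.
rewrite !big1 ?addr0.
- congr (_%:~R); congr (Num.sg _); lia.
- by move=> i ij; rewrite big1 // => i' _; rewrite (neq j j0 hj) // !mul0r.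
- by move=> i ij; rewrite (neq k k0 hk) // mulr0 mul0r.
Qed.

Lemma sgB_lt (a b : nat) : (a < b)%N -> ((Num.sg (a%:Z - b%:Z))%:~R : C) = -1.
Proof. by move=> ab; rewrite ltr0_sg // subr_lt0 ltz_nat. Qed.

Lemma sgB_eq (a : nat) : ((Num.sg (a%:Z - a%:Z))%:~R : C) = 0.
Proof. by rewrite subrr sgr0. Qed.

Lemma zform_alpha_epsN l : (1 <= l < N)%N ->
  zform (alpha l) (eps N) = if N == l.+1 then -1 else 0.
Proof.
move=> /andP[l0 lN]; rewrite zformBl !zform_eps ?l0 ?leqnn ?(ltnW lN) //; try lia.
rewrite (sgB_lt lN); case: eqP => [<-|h]; first by rewrite sgB_eq subr0.
by rewrite sgB_lt ?subrr //; lia.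
Qed.

Lemma zform_alpha l' l : (1 <= l' < l)%N -> (l < N)%N ->
  zform (alpha l') (alpha l) = if l == l'.+1 then -1 else 0.
Proof.
move=> /andP[l0 ll] lN; rewrite zformBl !zformBr !zform_eps; try lia.
rewrite (@sgB_lt l' l) // (@sgB_lt l' l.+1) ?ltnS ?(ltnW ll) // (@sgB_lt l'.+1 l.+1) //.
by case: eqP => [->|h]; rewrite ?sgB_eq ?(@sgB_lt l'.+1 l); try lia; ring.
Qed.

(** The factor by which the lattice parts of the currents l' and l fail to commute. *)
Definition kapex (l' l : nat) : C :=
  if l == l'.+1 then (if l == N then qpow (- (r%:C)^-1) else - qpow (- (r%:C)^-1)) else 1.

Hypothesis hkap : lattice_rep logq r kap.

Lemma kap_exchange l' l x : (1 <= l' < l)%N -> (l <= N)%N -> wlat x ->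
  kap (- wt l') (x - wt l) * kap (- wt l) x =
  kapex l' l * (kap (- wt l) (x - wt l') * kap (- wt l') x).
Proof.
case: hkap => _ hF hN' /andP[l'0 l'l] lN hx.
have l'N : (l' < N)%N by apply: leq_trans lN.
rewrite (wtF _ l'N) /kapex; move: (lN); rewrite leq_eqVlt => /orP[/eqP e|lN'].
  rewrite e wtN eqxx hN' ?l'0 //; congr (_ * _).
  rewrite zform_alpha_epsN ?l'0 //; case: eqP => _; last by rewrite mul0r qpow0.
  by rewrite mulN1r.
rewrite (wtF _ lN') hF ?l'0 ?lN' ?(ltn_trans _ l'l) //; congr (_ * _).
rewrite zform_alpha ?l'0 // /cartan [l' == l]ltn_eqF // (ltn_eqF lN').
rewrite (_ : l' == l.+1 = false) /=; last by lia.
by case: eqP => _; [rewrite exprN1 invrN1 !mulN1r|rewrite mul0r qpow0 expr0z mulr1].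
Qed.

Lemma kapex_neq0 l' l : kapex l' l != 0.
Proof.
by rewrite /kapex; case: ifP => _; [case: ifP => _|]; rewrite ?oppr_eq0 ?qpow_neq0 ?oner_neq0.
Qed.


Lemma rootlatD (x y : W) : rootlat x -> rootlat y -> rootlat (x + y).
Proof.
move=> [c ->] [d ->]; exists (fun j => c j + d j); rewrite -big_split /=.
by apply: eq_bigr => j _; rewrite rmorphD scalerDl.
Qed.

Lemma rootlat_sum (a b : nat) (s : int) : (1 <= a)%N -> (b <= N)%N ->
  rootlat (\sum_(a <= j < b) s%:~R *: alpha j).
Proof.
move=> a1 bN; exists (fun j => if (a <= j < b)%N then s else 0).
have [ab|ba] := leqP a b; last first.
  rewrite big_geq ?(ltnW ba) // big1 // => j _; rewrite ifF ?scale0r //.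
  by apply/negbTE; move: ba; lia.
have aN : (a <= N)%N by apply: leq_trans bN.
rewrite (big_cat_nat a1 aN) /= (big_cat_nat ab bN) /= !big_nat.
rewrite [X in _ = X + _]big1 ?add0r; last first.
  by move=> j hj; rewrite ifF ?scale0r //; apply/negbTE; move: hj; lia.
rewrite [X in _ = _ + X]big1 ?addr0; last first.
  by move=> j hj; rewrite ifF ?scale0r //; apply/negbTE; move: hj; lia.
by apply: eq_bigr => j hj; rewrite hj.
Qed.

Lemma sum_alpha a b : (a <= b)%N -> \sum_(a <= j < b) alpha j = eps a - eps b.
Proof.
move=> ab; rewrite -(subnKC ab); elim: (b - a)%N => [|m IH].
  by rewrite addn0 big_geq // subrr.
by rewrite addnS big_nat_recr ?leq_addr //= IH /Defs.alpha addrA subrK.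
Qed.

Lemma sum_epsbar : (0 < N)%N -> \sum_(1 <= j < N.+1) epsbar j = 0.
Proof.
move=> N0; rewrite /Defs.epsbar sumrB sumr_const_nat subn1 /= -scaler_nat scalerA mulfV.
  by rewrite scale1r subrr.
by rewrite pnatr_eq0 -lt0n.
Qed.

Lemma wlat_sub_wt l x : (1 <= l <= N)%N -> wlat x -> wlat (x - wt l).
Proof.
move=> /andP[l0 lN] [a aN hx]; move: (lN); rewrite leq_eqVlt => /orP[/eqP e|lN'].
- rewrite e wtN; have N0 : (0 < N)%N by lia.
  case: a aN hx => [|a] aN hx.
    exists N.-1; first by rewrite prednK.
    have -> : x - epsbar N - Lambdabar R N N.-1 = x - Lambdabar R N 0; last by [].
    have := sum_epsbar N0; rewrite big_nat_recr //= => /eqP.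
    rewrite addrC addr_eq0 => /eqP ->; rewrite /Lambdabar [X in _ = _ - X]big_geq // prednK //.
    by rewrite opprK addrK subr0.
  exists a; first exact: ltnW.
  have -> : x - epsbar N - Lambdabar R N a = (x - Lambdabar R N a.+1) + \sum_(a.+1 <= j < N) 1%:~R *: alpha j.
    under eq_bigr do rewrite scale1r.
    have -> : Lambdabar R N a.+1 = Lambdabar R N a + epsbar a.+1 by rewrite /Lambdabar big_nat_recr.
    rewrite sum_alpha 1?ltnW // /Defs.epsbar.
    apply/rowP => i; rewrite !mxE; ring.
  by apply: rootlatD => //; exact: rootlat_sum.
- rewrite wtF //; exists a => //.
  have -> : x - alpha l - Lambdabar R N a = (x - Lambdabar R N a) + \sum_(l <= j < l.+1) (-1)%:~R *: alpha j.
    by rewrite big_nat1 scaleN1r addrAC.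
  by apply: rootlatD => //; exact: rootlat_sum.
Qed.

Lemma wlat_sub_sum s x : all (fun l => 1 <= l <= N)%N s -> wlat x ->
  wlat (x - \sum_(l <- s) wt l).
Proof.
elim: s x => [|l s IH] x /=; first by rewrite big_nil subr0.
by move=> /andP[hl hs] hx; rewrite big_cons opprD addrA; apply: IH => //; exact: wlat_sub_wt.
Qed.

Definition lat_coef (l' l : nat) : C := if (l' < l)%N then kapex l' l else 1.

Lemma lat_coef_neq0 l' l : lat_coef l' l != 0.
Proof. by rewrite /lat_coef; case: ifP; rewrite ?kapex_neq0 ?oner_neq0. Qed.

Lemma pairprod_lat_coef_neq0 s : pairprod lat_coef s != 0.
Proof.
elim: s => [|l s IH] /=; first exact: oner_neq0.
by rewrite mulf_neq0 // prodf_seq_neq0; apply/allP => d _; rewrite /= lat_coef_neq0.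
Qed.

Lemma kapw_cat s t x :
  kapw kap (s ++ t) x = kapw kap s (x - \sum_(l <- t) wt l) * kapw kap t x.
Proof.
elim: s => [|l s IH] /=; first by rewrite mul1r.
by rewrite IH big_cat opprD /= addrAC mulrA addrA.
Qed.

(** Adjacent transpositions generate all permutations; each multiplies the cocycle by the
   commutation factor of two lattice operators. Writing the total factor as a quotient of
   pair products avoids any choice of a sequence of transpositions. *)
Lemma kapw_perm s t x : all (fun l => 1 <= l <= N)%N s -> wlat x -> perm_eq s t ->
  kapw kap s x = kapw kap t x * pairprod lat_coef s / pairprod lat_coef t.
Proof.
move=> hs hx st.
have ht : all (fun l => 1 <= l <= N)%N t by rewrite -(perm_all _ st).
pose Q s := if all (fun l => 1 <= l <= N)%N s then kapw kap s x / pairprod lat_coef s else 0.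
suff : Q s = Q t.
  rewrite /Q hs ht => e; rewrite mulrAC -e divfK //; exact: pairprod_lat_coef_neq0.
apply: perm_adjacent st => s1 c d s2; rewrite /Q !all_cat /=.
case: (boolP (all _ s1)) => //= h1; case: (boolP (1 <= c <= N)%N) => /= hc; last by rewrite andbF.
case: (boolP (1 <= d <= N)%N) => //= hd; case: (boolP (all _ s2)) => //= h2.
have sw : kapw kap [:: c; d] (x - \sum_(l <- s2) wt l) * lat_coef d c
    = kapw kap [:: d; c] (x - \sum_(l <- s2) wt l) * lat_coef c d.
  have hw : wlat (x - \sum_(l <- s2) wt l) by exact: wlat_sub_sum.
  move: (x - _) hw => x' hw.
  rewrite /= !big_seq1 !big_nil !subr0 !mulr1 /lat_coef; case: (ltngtP c d) => cd.
  - by rewrite kap_exchange //; [ring|lia|lia].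
  - by rewrite [X in _ = X * _]kap_exchange //; [ring|lia|lia].
  - by rewrite cd.
have e0 a b : s1 ++ [:: a, b & s2] = s1 ++ ([:: a; b] ++ s2) by [].
rewrite !e0 !kapw_cat !pairprod_cat.
have es : \sum_(l <- [:: c; d] ++ s2) wt l = \sum_(l <- [:: d; c] ++ s2) wt l.
  by rewrite !big_cat /= !big_cons !big_nil !addr0 [wt c + wt d]addrC.
have ec i : \prod_(k <- [:: c; d] ++ s2) lat_coef i k = \prod_(k <- [:: d; c] ++ s2) lat_coef i k.
  by rewrite !big_cat /= !big_cons !big_nil !mulr1 [lat_coef i c * _]mulrC.
have ed : \prod_(i <- [:: c; d]) \prod_(k <- s2) lat_coef i k
    = \prod_(i <- [:: d; c]) \prod_(k <- s2) lat_coef i k.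
  by rewrite !big_cons !big_nil !mulr1 mulrC.
rewrite es (eq_bigr _ (fun i _ => ec i)) ed.
have -> : kapw kap [:: c; d] (x - \sum_(l <- s2) wt l) =
    kapw kap [:: d; c] (x - \sum_(l <- s2) wt l) * lat_coef c d / lat_coef d c.
  by rewrite -sw mulfK // lat_coef_neq0.
rewrite /= !big_seq1 !big_nil !mulr1.
set P := \prod_(_ <- s1) _; have P0 : P != 0.
  rewrite prodf_seq_neq0; apply/allP => i _; rewrite /= prodf_seq_neq0; apply/allP => k _.
  by rewrite /= lat_coef_neq0.
set Q0 := \prod_(_ <- [:: d; c]) _; have Q00 : Q0 != 0.
  rewrite prodf_seq_neq0; apply/allP => i _; rewrite /= prodf_seq_neq0; apply/allP => k _.
  by rewrite /= lat_coef_neq0.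
have p1 := pairprod_lat_coef_neq0 s1; have p2 := pairprod_lat_coef_neq0 s2.
have p3 := lat_coef_neq0 c d; have p4 := lat_coef_neq0 d c.
by field; rewrite P0 Q00 p1 p2 p3 p4.
Qed.
End ZeroModeExchange.

(** * Exchange of two currents *)

Section PairIdentities.
Variable R : realType.
Local Notation C := R[i].
Variables (N : nat) (logq : C) (r : R).
Local Notation qpow := (qpow logq).
Local Notation q := (qq logq).
Local Notation p := (pp logq r).
Local Notation "[[ x ]]" := (br logq r x).
Local Notation gL := (pair_coef N logq r).
Local Notation psi := (lat_coef N logq r).
Hypothesis N1 : (1 < N)%N.
Hypothesis hq : complex.Re logq < 0.
Hypothesis hr : 1 < r.
Hypothesis hgen : forall s : rat, r != ratr s.

Let p1 := cabs_p_lt1 hq hr.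

Lemma rC_neq0 : r%:C != 0 :> C.
Proof. by rewrite (inj_eq (@complexI R) r 0); move: hr; lra. Qed.

Lemma poch1_neq0_lt1 (y : C) : cabs y < 1 -> poch1 y p != 0.
Proof.
move=> y1; apply: poch1_neq0 => // k; apply/eqP => e.
have := cabs1 R; rewrite -e cabsM cabsX; apply/eqP; rewrite lt_eqF //.
apply: le_lt_trans y1; rewrite ler_piMr ?cabs_ge0 // exprn_ile1 ?cabs_ge0 //.
exact: ltW.
Qed.

Lemma br_ratio (a b : C) : [[a]] / [[b]] = qpow ((a ^+ 2 - b ^+ 2) / r%:C - (a - b)) *
  (poch1 (qpow (2 * a)) p * poch1 (p / qpow (2 * a)) p
   / (poch1 (qpow (2 * b)) p * poch1 (p / qpow (2 * b)) p)).
Proof.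
have P0 : poch1 p p != 0 by apply: poch1_neq0_lt1.
have e : qpow ((a ^+ 2 - b ^+ 2) / r%:C - (a - b)) =
    qpow (a ^+ 2 / r%:C - a) / qpow (b ^+ 2 / r%:C - b).
  by rewrite -qpowB; congr (Defs.qpow _ _); ring.
rewrite e /br /theta !invfM.
rewrite -[RHS]mulr1 -(mulfV P0); ring.
Qed.

Lemma qpow_half_p (a : C) : qpow (2 * (a - 2^-1)) = qpow (2 * a) / q.
Proof. by rewrite -[q]/(qpow 1) -qpowB; congr (Defs.qpow _ _); field. Qed.

Lemma qpow_half_m (a : C) : qpow (2 * (a + 2^-1)) = qpow (2 * a) * q.
Proof. by rewrite -[q]/(qpow 1) -qpowD; congr (Defs.qpow _ _); field. Qed.

Lemma same_field (F : fieldType) (x Q2 A D X B E u1 u2 h : F) :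
  x != 0 -> Q2 != 0 -> A != 0 -> D != 0 -> X != 0 ->
  (1 - x^-1) * ((1 - Q2 / x) * B) / E * (u1 * u2 * (x / Q2) * h) =
  - u1 * (X * ((1 - x^-1) * D) / (A * E)) * (u2 * ((1 - x / Q2) * A * B / (X * D))) * h.
Proof.
move=> x0 Q0 A0 D0 X0.
have [->|E0] := eqVneq E 0; first by rewrite !(mulr0, invr0, mul0r).
by field; rewrite x0 Q0 A0 D0 X0 E0.
Qed.

(** The contraction is the symmetric one times a quotient of theta functions: shifting a
   q-product by one factor supplies the missing zeros and poles. *)
Lemma same_level l v w : (1 <= l < N)%N -> cabs (qpow (2 * v)) = cabs (qpow (2 * w)) ->
  gL (l, v) (l, w) = FSym logq r v w * ([[v - w - 1]] / [[v - w]]) * nord_const N logq r l.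
Proof.
move=> hl hvw; have lN : (l < N)%N by case/andP: hl.
have r0 := rC_neq0; have q0 := q_neq0 logq.
have tv0 := qpow_neq0 logq (2 * v); have tw0 := qpow_neq0 logq (2 * w).
pose x := qpow (2 * v) / qpow (2 * w).
have x0 : x != 0 by rewrite mulf_neq0 // invr_eq0.
have x1 : cabs x = 1 by rewrite cabsM cabsV hvw divff // cabs_eq0.
have exw : qpow (2 * w) / qpow (2 * v) = x^-1 by rewrite /x invfM invrK mulrC.
have e2 : qpow (2 * (v - w)) = x by rewrite mulrBr qpowB.
have e1 : qpow (2 * (v - w - 1)) = x / q ^+ 2.
  by rewrite mulrBr qpowB e2 mulr1 -qpow_nat.
rewrite /pair_coef /= exw.
rewrite (contr_same hq hr hgen hl).
rewrite br_ratio e1 e2.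
rewrite /FSym -/x; clearbody x.
have sx : poch1 x^-1 p = (1 - x^-1) * poch1 (p / x) p by rewrite (poch1_shift _ p1) [x^-1 * p]mulrC.
have sxq : poch1 (x / q ^+ 2) p = (1 - x / q ^+ 2) * poch1 (p / q ^+ 2 * x) p.
  have e : x / q ^+ 2 * p = p / q ^+ 2 * x by rewrite mulrAC [x * p]mulrC mulrAC.
  by rewrite (poch1_shift _ p1) e.
have sqx : poch1 (q ^+ 2 * x^-1) p = (1 - q ^+ 2 / x) * poch1 (p / (x / q ^+ 2)) p.
  have e : q ^+ 2 * x^-1 * p = p / (x / q ^+ 2) by rewrite invfM invrK [RHS]mulrC [x^-1 * _]mulrC.
  by rewrite (poch1_shift _ p1) e.
have A0 : poch1 (p / q ^+ 2 * x) p != 0.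
  apply: poch1_neq0_lt1; rewrite cabsM x1 mulr1 cabsM cabsV cabsX.
  by rewrite ltr_pdivrMr ?mul1r ?exprn_gt0 ?cabs_q_gt0 // cabs_p_lt_q2.
have D0 : poch1 (p / x) p != 0.
  by apply: poch1_neq0_lt1; rewrite cabsM cabsV x1 invr1 mulr1.
rewrite sx sxq sqx.
have [->|xn1] := eqVneq x 1; first by rewrite invr1 subrr !(mul0r, mulr0).
have X0 : poch1 x p != 0.
  rewrite (poch1_shift _ p1) mulf_neq0 //; first by rewrite subr_eq0 eq_sym.
  by apply: poch1_neq0_lt1; rewrite cabsM x1 mul1r.
have pre : zsh logq r l v (- wt R N l) =
  qpow ((1 + 2 * v + 2 * w) * (1 - (r%:C)^-1)) *
  qpow (((v - w - 1) ^+ 2 - (v - w) ^+ 2) / r%:C - (v - w - 1 - (v - w))) *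
  (x / q ^+ 2) * nord_const N logq r l.
  rewrite /zsh ltn_eqF // wtF // dotNr dot_alpha2 // /nord_const ltn_eqF // -e1 -!qpowD.
  by congr (Defs.qpow _ _); field.
by rewrite pre; apply: same_field; rewrite ?expf_neq0.
Qed.

Lemma adj_field (F : fieldType) (X Q A D B E u z : F) :
  X != 0 -> Q != 0 -> D != 0 -> B != 0 -> 1 - Q * X != 0 ->
  A / E * (z * - (X^-1 / Q * u)) =
  D / ((1 - Q * X) * B) * z * (u * ((1 - X^-1 / Q) * A * B / (E * D))).
Proof.
move=> X0 Q0 D0 B0 h.
have [->|E0] := eqVneq E 0; first by rewrite !(mulr0, invr0, mul0r).
by field; rewrite X0 Q0 D0 B0 h E0.
Qed.

Lemma sgnpow1 : sgnpow (1 : C) = -1.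
Proof.
have e : 'i%C * (pi : R)%:C = 0 +i* pi :> C.
  by apply: eq_ReIm; rewrite ?ReM ?ImM /=; ring.
rewrite /sgnpow mulr1 e /cexp /= expR0 cospi sinpi mulr0 mul1r.
by apply: eq_ReIm => //=; rewrite oppr0.
Qed.

Lemma sgnpowN1 : sgnpow (-1 : C) = -1.
Proof.
have h : sgnpow (-1 : C) * sgnpow 1 = 1.
  by rewrite -sgnpowD addNr /sgnpow mulr0 cexp0.
by move: h; rewrite sgnpow1 mulrN1 => /eqP; rewrite eqr_oppLR => /eqP.
Qed.

(** The contractions in the two orders differ by a quotient of theta functions of argument
   shifted by q. A pole has the value 0, so that the identity needs the two q-products that
   are cancelled to be nonzero. *)
Lemma adj_exchange l' l v' v : l = l'.+1 -> (1 <= l')%N -> (l <= N)%N ->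
  poch1 (q * (qpow (2 * v') / qpow (2 * v))) p != 0 ->
  poch1 (p / q * (qpow (2 * v') / qpow (2 * v))) p != 0 ->
  gL (l', v') (l, v) * psi l' l =
  gL (l, v) (l', v') * ([[v - v' - 2^-1]] / [[v - v' + 2^-1]]).
Proof.
move=> el l'0 lN; have r0 := rC_neq0; have q0 := q_neq0 logq.
have hl : (1 <= l <= N)%N by rewrite lN el.
have hl' : (1 <= l' <= N)%N by rewrite l'0 ltnW // -el.
have l'N : (l' < N)%N by rewrite -el.
have ll' : (l' == l.+1) || (l == l'.+1) by rewrite el eqxx orbT.
have l'l : (l == l'.+1) || (l' == l.+1) by rewrite el eqxx.
pose X := qpow (2 * v') / qpow (2 * v).
have X0 : X != 0 by rewrite mulf_neq0 ?invr_eq0 ?qpow_neq0.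
have eX : qpow (2 * v) / qpow (2 * v') = X^-1 by rewrite /X invfM invrK mulrC.
have e0 : qpow (2 * (v - v')) = X^-1 by rewrite mulrBr qpowB.
have e1 : qpow (2 * (v - v' - 2^-1)) = X^-1 / q by rewrite qpow_half_p e0.
have e2 : qpow (2 * (v - v' + 2^-1)) = X^-1 * q by rewrite qpow_half_m e0.
rewrite -/X /pair_coef /= eX.
rewrite (contr_adj N1 hq hr hgen hl' hl l'l) (contr_adj N1 hq hr hgen hl hl' ll').
rewrite br_ratio e1 e2 -/X.
clearbody X => qX pX.
have dw : dot (wt R N l') (wt R N l) = -1 by exact: dot_wt_adj.
have dw' : dot (wt R N l) (wt R N l') = -1 by exact: dot_wt_adj.
have z1 : zsh logq r l' v' (- wt R N l) * psi l' l =
   (if l == N then 1 else -1) * qpow (- (2 * v') + (N - l)%:R / r%:C + 2 * v' / r%:C).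
  have eNl : ((N - l')%:R : C) = (N - l)%:R + 1.
    by rewrite natr1 -subSn // el subSS.
  move: dw; rewrite /zsh ltn_eqF // (wtF _ l'N) dotNr => ->.
  rewrite /lat_coef {1}el leqnn /kapex el eqxx -el eNl opprK.
  by case: ifP => _; rewrite ?mul1r ?mulN1r ?mulrN -!qpowD; [|congr (- _)];
    congr (Defs.qpow _ _); field.
have z2 : zsh logq r l v (- wt R N l') =
   (if l == N then -1 else 1) * qpow (- (2 * v) + (N - l)%:R / r%:C + 2 * v / r%:C).
  move: dw'; rewrite /zsh; case: (eqVneq l N) => [eN|nN].
    rewrite eN wtN dotNr => ->; rewrite opprK subnn mul0r addr0.
    rewrite sgnpowN1.
    by rewrite -mulrA -qpowD; congr (_ * Defs.qpow _ _); field.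
  rewrite (wtF _ (_ : (l < N)%N)) ?ltn_neqAle ?nN // dotNr => ->; rewrite opprK mul1r -qpowD.
  by congr (Defs.qpow _ _); field.
have zz : zsh logq r l' v' (- wt R N l) * psi l' l =
   zsh logq r l v (- wt R N l') * - (X^-1 / q * qpow (((v - v' - 2^-1) ^+ 2 - (v - v' + 2^-1) ^+ 2) / r%:C
      - (v - v' - 2^-1 - (v - v' + 2^-1)))).
  rewrite z1 z2 -e1 -qpowD -!mulrA mulrN -qpowD mulrN.
  have -> : ((if l == N then 1 else -1) : C) = - (if l == N then -1 else 1).
    by case: ifP => _; rewrite ?opprK.
  by rewrite mulNr; congr (- (_ * Defs.qpow _ _)); field.
have D0 : poch1 (p / (X^-1 * q)) p != 0.
  by move: pX; congr (poch1 _ p != 0); rewrite invfM invrK; ring.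
have sA : poch1 (X^-1 / q) p = (1 - X^-1 / q) * poch1 (p / q * X^-1) p.
  have e : X^-1 / q * p = p / q * X^-1 by rewrite mulrC [X^-1 / q]mulrC mulrA.
  by rewrite (poch1_shift _ p1) e.
have sB : poch1 (q * X) p = (1 - q * X) * poch1 (p / (X^-1 / q)) p.
  have e : q * X * p = p / (X^-1 / q) by rewrite !invfM !invrK [RHS]mulrC [X * q]mulrC.
  by rewrite (poch1_shift _ p1) e.
have eD : p / q * X = p / (X^-1 * q) by rewrite invfM invrK mulrAC mulrA.
have eE : q * X^-1 = X^-1 * q by rewrite mulrC.
rewrite -mulrA zz sA eD eE sB.
move: qX; rewrite sB mulf_eq0 negb_or => /andP[h B0].
exact: adj_field.
Qed.

Lemma far_exchange l l' v v' : (1 <= l <= N)%N -> (1 <= l' <= N)%N ->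
  (l.+1 < l')%N || (l'.+1 < l)%N -> gL (l, v) (l', v') = 1.
Proof.
move=> hl hl' ll'; rewrite /pair_coef /= (contr_far N1 hq hr hgen hl hl' ll') mul1r.
have d0 := @dot_wt_far R N l l' hl hl' ll'.
move: d0; rewrite /zsh; case: (eqVneq l N) => [->|nN].
  by rewrite wtN dotNr => ->; rewrite !oppr0 mul0r !mulr0 qpow0 !mulr1 /sgnpow mulr0 cexp0.
have lN : (l < N)%N by rewrite ltn_neqAle nN; case/andP: hl.
by rewrite (wtF _ lN) dotNr => ->; rewrite !oppr0 mul0r !mulr0 qpow0 mulr1.
Qed.

(** The elliptic Gamma functions of mu^+ turn the symmetric contraction into the ordered one. *)
Lemma NN_pair v w : 
  let x := qpow (2 * v) / qpow (2 * w) in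
  dpoch N logq r (q ^+ 2 * x) != 0 ->
  dpoch N logq r (q ^+ (2 * N) * x) != 0 ->
  gL (N, v) (N, w) = PhiSym N logq r (qpow (2 * v)) (qpow (2 * w)) *
    (sgnpow ((N%:R - 1) / N%:R) * qpow (2 * v * ((r - 1)%:C * (N%:R - 1) / (r%:C * N%:R)))
     * (eGamma (q ^+ 2 * x) p (q ^+ (2 * N)) / eGamma (q ^+ (2 * N) * x) p (q ^+ (2 * N)))).
Proof.
move=> x; have r0 := rC_neq0; have q0 := q_neq0 logq.
have nN : (N%:R : C) != 0 by rewrite pnatr_eq0 -lt0n ltnW.
have ex : qpow (2 * w) / qpow (2 * v) = x^-1 by rewrite /x invfM invrK mulrC.
have x0 : x != 0 by rewrite mulf_neq0 ?invr_eq0 ?qpow_neq0.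
rewrite /pair_coef /= ex (contr_NN N1 hq hr hgen) /PhiSym ex -/x.
clearbody x.
have -> : zsh logq r N v (- wt R N N) = sgnpow ((N%:R - 1) / N%:R)
    * qpow (2 * v * ((r - 1)%:C * (N%:R - 1) / (r%:C * N%:R))).
  rewrite /zsh eqxx wtN dotNr dot_epsbar2 ?(ltnW N1) // opprK -mulrA -qpowD; congr (_ * Defs.qpow _ _).
  by rewrite rmorphB /= rmorph1; field; rewrite nN r0.
rewrite /eGamma -!/(dpoch _ _ _ _).
have e1 : p * q ^+ (2 * N) / (q ^+ 2 * x) = p * q ^+ (2 * N - 2) * x^-1.
  have -> : q ^+ (2 * N) = q ^+ (2 * N - 2) * q ^+ 2 by rewrite -exprD subnK // leq_pmulr // ltnW.
  by rewrite invfM mulrA mulrA mulfK // expf_neq0.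
have e2 : p * q ^+ (2 * N) / (q ^+ (2 * N) * x) = p * x^-1.
  by rewrite invfM mulrA mulfK // expf_neq0.
rewrite e1 e2.
move: (dpoch _ _ _ (q ^+ 2 * x)) (dpoch _ _ _ (q ^+ (2 * N) * x)) => A B A0 B0.
move: (dpoch _ _ _ (q ^+ 2 * x^-1)) (dpoch _ _ _ (p * q ^+ (2 * N - 2) * x^-1))
  (dpoch _ _ _ (p * x^-1)) (dpoch _ _ _ (q ^+ (2 * N) * x^-1)) (sgnpow _) (qpow _) => D E F G s u.
rewrite !invfM !invrK.
transitivity (D * E * (F^-1 * G^-1) * (s * u) * (A / A) * (B / B)); last by ring.
by rewrite !divff // !mulr1.
Qed.

End PairIdentities.

(** * The two orders of the currents *)

Section Labels.
Variables (N : nat) (mu : seq nat).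
Hypothesis N1 : (1 < N)%N.
Hypothesis hmu : all (fun m => 1 <= m <= N)%N mu.
Local Notation n := (size mu).

Lemma mu_range k : (k < n)%N -> (1 <= nth 0 mu k <= N)%N.
Proof. by move=> kn; move/allP: hmu; apply; exact: mem_nth. Qed.

(** A current is labelled by its level l and by the position k of the vertex operator
   that it comes from. *)
Definition block (k : nat) : seq (nat * nat) :=
  (N, k) :: [seq (m, k) | m <- rev (index_iota (nth 0 mu k) N)].
(** The currents in the order in which they occur in the product of the vertex operators, and
   below, in labelsR, by decreasing level. *)
Definition labelsL (ks : seq nat) := flatten [seq block k | k <- ks].
Definition levels : seq nat := N :: rev (index_iota 1 N).
Definition labelsR := flatten [seq [seq (l, k) | k <- Iset mu l] | l <- levels].

Definition ltL : rel (nat * nat) :=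
  fun c d => (c.2 < d.2)%N || ((c.2 == d.2) && (d.1 < c.1)%N).
Definition ltR : rel (nat * nat) :=
  fun c d => (d.1 < c.1)%N || ((c.1 == d.1) && (c.2 < d.2)%N).

Lemma mem_block k c : (k < n)%N -> (c \in block k) = (c.2 == k) && (nth 0 mu k <= c.1 <= N)%N.
Proof.
case: c => l k' kn; have /andP[m1 mN] := mu_range kn; rewrite inE xpair_eqE /=.
apply/orP/andP => [[/andP[/eqP -> /eqP ->]|/mapP[m]]|[/eqP -> /andP[h1 h2]]].
- by rewrite eqxx mN leqnn.
- rewrite mem_rev mem_index_iota => /andP[h1 h2] [-> ->].
  by rewrite eqxx h1 ltnW.
- move: h2; rewrite leq_eqVlt => /orP[/eqP ->|h2]; first by left; rewrite !eqxx.
  by right; apply/mapP; exists l => //; rewrite mem_rev mem_index_iota h1.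
Qed.

Lemma labelsL_cons k ks : labelsL (k :: ks) = block k ++ labelsL ks.
Proof. by []. Qed.

Lemma mem_labelsL ks c : all (fun k => k < n)%N ks ->
  (c \in labelsL ks) = (c.2 \in ks) && (nth 0 mu c.2 <= c.1 <= N)%N.
Proof.
elim: ks => [|k ks IH]; first by [].
rewrite [all _ _]/= => /andP[kn hks].
rewrite labelsL_cons mem_cat mem_block // IH // inE.
by case: eqP => [->|_] /=; [rewrite orb_idr // => /andP[]|].
Qed.

Lemma mem_Iset l k : (k \in Iset mu l) = (k < n)%N && (nth 0 mu k <= l)%N.
Proof. by rewrite mem_filter mem_iota add0n andbC. Qed.

Lemma mem_levels l : (l \in levels) = (1 <= l <= N)%N.
Proof.
rewrite inE mem_rev mem_index_iota; have N0 := ltnW N1.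
by apply/orP/idP => [[/eqP ->|]|]; lia.
Qed.

Lemma mem_labelsR c : (c \in labelsR) = [&& (c.2 < n)%N, (nth 0 mu c.2 <= c.1)%N & (c.1 <= N)%N].
Proof.
case: c => l k; rewrite [(l, k).2]/= [(l, k).1]/=.
apply/flattenP/idP => [[_ /mapP[l' l'l ->] /mapP[k' k'l [-> ->]]]|].
  by move: l'l k'l; rewrite mem_levels mem_Iset => /andP[_ ->] /andP[-> ->].
move=> /and3P[kn h1 h2]; have /andP[m1 mN] := mu_range kn.
exists [seq (l, k) | k <- Iset mu l]; last by apply/mapP; exists k => //; rewrite mem_Iset kn.
by apply/mapP; exists l => //; rewrite mem_levels h2 (leq_trans m1).
Qed.

Lemma pairwise_rev_iota a b : pairwise (fun m m' => m' < m)%N (rev (index_iota a b)).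
Proof.
rewrite -sorted_pairwise; last by move=> x y z /= xy /ltn_trans; exact.
rewrite rev_sorted; exact: iota_ltn_sorted.
Qed.

Lemma pairwise_block k : pairwise ltL (block k).
Proof.
rewrite /block /=; apply/andP; split.
  apply/allP => c /mapP[m]; rewrite mem_rev mem_index_iota => /andP[_ mN] ->.
  by rewrite /ltL /= ltnn eqxx.
rewrite pairwise_map -[X in pairwise X](_ : (fun m m' => (m' < m)%N) = _); last first.
  by apply/funext => m; apply/funext => m'; rewrite /= /ltL /= ltnn eqxx.
exact: pairwise_rev_iota.
Qed.

Lemma pairwise_labelsL ks : sorted ltn ks -> all (fun k => k < n)%N ks -> pairwise ltL (labelsL ks).
Proof.
rewrite sorted_pairwise; last exact: ltn_trans.
elim: ks => [|k ks IH]; first by [].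
rewrite labelsL_cons [all _ _]/= [pairwise _ (k :: ks)]/= => /andP[/allP hk hs] /andP[kn hks].
rewrite pairwise_cat pairwise_block IH //; apply/andP; split=> //.
apply/allrelP => c d; rewrite mem_block // mem_labelsL // => /andP[/eqP ck _] /andP[dks _].
by rewrite /ltL ck; apply/orP; left; exact: hk.
Qed.

Lemma levelsE : levels = rev (index_iota 1 N.+1).
Proof.
rewrite /levels; have -> : N.+1 = (1 + N)%N by [].
rewrite /index_iota addKn; have -> : iota 1 N = iota 1 (N - 1) ++ [:: N].
  have {1}-> : N = (N - 1 + 1)%N by rewrite subnK // ltnW.
  by rewrite iotaD /=; congr (_ ++ [:: _]); rewrite subnKC // ltnW.
by rewrite rev_cat.
Qed.

Lemma pairwise_labelsR : pairwise ltR labelsR.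
Proof.
have : pairwise (fun l l' => (l' < l)%N) levels.
  rewrite levelsE.
  exact: pairwise_rev_iota.
rewrite /labelsR; elim: levels => [|l ls IH] //= /andP[/allP hl hs].
rewrite pairwise_cat; apply/and3P; split; last exact: IH.
  apply/allrelP => _ _ /mapP[k _ ->] /flattenP[_ /mapP[l' l'ls ->] /mapP[k' _ ->]].
  by apply/orP; left; exact: hl.
rewrite pairwise_map; have : pairwise ltn (Iset mu l).
  by rewrite -sorted_pairwise; [apply: sorted_filter; [exact: ltn_trans|exact: iota_ltn_sorted]|exact: ltn_trans].
by apply: sub_pairwise => k k' /= kk; rewrite /ltR /= eqxx kk orbT.
Qed.

Lemma ltL_irr c : ltL c c = false. Proof. by rewrite /ltL !ltnn andbF. Qed.
Lemma ltR_irr c : ltR c c = false. Proof. by rewrite /ltR !ltnn andbF. Qed.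

Lemma pairwise_uniq_irr (T : eqType) (lt : rel T) s : (forall c, lt c c = false) ->
  pairwise lt s -> uniq s.
Proof.
move=> irr; elim: s => [|c s IH] //= /andP[/allP hc /IH ->]; rewrite andbT.
by apply/negP => /hc; rewrite irr.
Qed.

Lemma ltLN c d : c != d -> ltL d c = ~~ ltL c d.
Proof.
case: c d => [l k] [l' k']; rewrite xpair_eqE /ltL /=.
by case: (ltngtP k k') => //= _; case: (ltngtP l l').
Qed.

Lemma all_iota_lt : all (fun k => k < n)%N (iota 0 n).
Proof. by apply/allP => k; rewrite mem_iota. Qed.

Lemma perm_labels : perm_eq (labelsL (iota 0 n)) labelsR.
Proof.
apply: uniq_perm.
- apply: (pairwise_uniq_irr ltL_irr); apply: pairwise_labelsL; last exact: all_iota_lt.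
  exact: iota_ltn_sorted.
- exact: (pairwise_uniq_irr ltR_irr pairwise_labelsR).
- move=> c; rewrite mem_labelsL ?all_iota_lt // mem_labelsR mem_iota add0n.
  by case: (c.2 < n)%N => //=; rewrite andbC andbC.
Qed.

(** A product over ordered pairs is a product over unordered pairs, each evaluated in the
   order ltL. *)
Lemma pairprod_labels (K : comNzRingType) (g : nat * nat -> nat * nat -> K) :
  pairprod g (labelsL (iota 0 n)) =
  pairprod (fun c d => if ltL c d then g c d else g d c) labelsR.
Proof.
have pl : pairwise ltL (labelsL (iota 0 n)).
  by apply: pairwise_labelsL; [exact: iota_ltn_sorted|exact: all_iota_lt].
rewrite (@eq_pairprod _ _ _ g (fun c d => if c == d then 1 else if ltL c d then g c d else g d c) _ pl); last first.
  move=> c d _ _ cd; rewrite cd; case: eqP => // e.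
  by move: cd; rewrite e ltL_irr.
rewrite (pairprod_perm _ perm_labels); last first.
  move=> c d; rewrite [d == c]eq_sym; case: eqVneq => // cd.
  by rewrite (ltLN cd); case: (ltL c d).
apply: eq_pairprod pairwise_labelsR _ => c d _ _ cd; case: eqP => // e.
by move: cd; rewrite e ltR_irr.
Qed.

Lemma Iset_uniq l : uniq (Iset mu l).
Proof. by rewrite filter_uniq ?iota_uniq. Qed.

Lemma IsetN : Iset mu N = iota 0 n.
Proof.
rewrite /Iset; apply/all_filterP/allP => k; rewrite mem_iota add0n => /= kn.
by case/andP: (mu_range kn).
Qed.

Lemma lamN : lam mu N = n.
Proof. by rewrite /lam IsetN size_iota. Qed.

Lemma IsetE l : Iset mu l = [seq ipos mu l a | a <- iota 0 (lam mu l)].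
Proof. by rewrite -[LHS](mkseq_nth 0%N). Qed.

Lemma ipos_mem l a : (a < lam mu l)%N -> ipos mu l a \in Iset mu l.
Proof. by move=> al; exact: mem_nth. Qed.

Lemma index_ipos l a : (a < lam mu l)%N -> index (ipos mu l a) (Iset mu l) = a.
Proof. by move=> al; rewrite index_uniq // Iset_uniq. Qed.

Lemma big_Iset (T : Type) (idx : T) (op : Monoid.com_law idx) l (F : nat -> T) :
  \big[op/idx]_(k <- Iset mu l) F k = \big[op/idx]_(0 <= a < lam mu l) F (ipos mu l a).
Proof. by rewrite IsetE big_map /index_iota subn0. Qed.

End Labels.

Lemma index_iota_sub a j m : (a <= m < a + j)%N -> index m (iota a j) = (m - a)%N.
Proof.
move=> /andP[am mj]; have mj' : (m - a < j)%N by rewrite ltn_subLR.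
have em : m = nth 0%N (iota a j) (m - a)%N by rewrite nth_iota // subnKC.
by rewrite {1}em index_uniq ?iota_uniq // size_iota.
Qed.

Section PairprodSorted.
Variables (T : eqType) (K : comNzRingType).

Lemma pairprod_iota (g : nat -> nat -> K) m :
  pairprod g (iota 0 m) = \prod_(0 <= b < m) \prod_(0 <= a < b) g a b.
Proof.
elim: m => [|m IH]; first by rewrite big_geq.
rewrite -addn1 iotaD pairprod_cat IH /= big_nil !mulr1 addn1 big_nat_recr //= add0n.
congr (_ * _); rewrite /index_iota subn0; apply: eq_bigr => a _.
by rewrite big_seq1.
Qed.

Lemma pairprod_iota_l (g : nat -> nat -> K) m :
  pairprod g (iota 0 m) = \prod_(0 <= a < m) \prod_(a.+1 <= b < m) g a b.
Proof.
suff h j i : pairprod g (iota i j) = \prod_(i <= a < i + j) \prod_(a.+1 <= b < i + j) g a b.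
  by rewrite h add0n.
elim: j i => [|j IH] i; first by rewrite addn0 big_geq.
rewrite /= IH addnS [RHS]big_ltn ?ltnS ?leq_addr // addSn; congr (_ * _).
by rewrite /index_iota -addSn addKn.
Qed.

Lemma pairprod_flatten (I : eqType) (g : T -> T -> K) (S : I -> seq T) (ls : seq I) :
  pairprod g (flatten [seq S l | l <- ls]) =
  (\prod_(l <- ls) pairprod g (S l)) *
  pairprod (fun l l' => \prod_(c <- S l) \prod_(d <- S l') g c d) ls.
Proof.
elim: ls => [|l ls IH] /=; first by rewrite big_nil mulr1.
rewrite pairprod_cat IH big_cons /=.
have -> : \prod_(c <- S l) \prod_(d <- flatten [seq S l0 | l0 <- ls]) g c d
    = \prod_(l' <- ls) \prod_(c <- S l) \prod_(d <- S l') g c d.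
  rewrite [RHS]exchange_big; apply: eq_bigr => c _.
  by rewrite big_flatten big_map.
ring.
Qed.

(** In a decreasing list of levels, the only pairs that contribute are the consecutive ones. *)
Lemma pairprod_adjacent (h : nat -> nat -> K) M :
  (forall l l', l != l'.+1 -> h l l' = 1) ->
  pairprod h (rev (index_iota 1 M.+1)) = \prod_(1 <= l < M) h l.+1 l.
Proof.
move=> h1; elim: M => [|M IH]; first by rewrite !big_geq.
have -> : rev (index_iota 1 M.+2) = M.+1 :: rev (index_iota 1 M.+1).
  by rewrite /index_iota !subSS !subn0 -[X in iota 1 X]addn1 iotaD rev_cat.
rewrite /= IH; case: M {IH} => [|M].
  by rewrite !big_geq // big_nil mul1r.
rewrite [RHS]big_nat_recr //= mulrC; congr (_ * _).
rewrite (bigD1_seq M.+1) /=; first last.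
- by rewrite rev_uniq iota_uniq.
- by rewrite mem_rev mem_index_iota ltnSn.
rewrite big1 ?mulr1 // => l lM; apply: h1; rewrite eqSS eq_sym; exact: lM.
Qed.

End PairprodSorted.

(** * Products of vertex operators as words *)

Section VertexWords.
Variable R : realType.
Local Notation C := R[i].
Variables (N : nat) (logq : C) (r : R).
Local Notation W := 'rV[C]_N.
Variable kap : W -> W -> C.
Variables (mu : seq nat) (u : nat -> C).
Local Notation n := (size mu).
Local Notation fmul := (@fmul R N logq r).
Local Notation wt := (wt R N).
Hypothesis N1 : (1 < N)%N.
Hypothesis hmu : all (fun m => 1 <= m <= N)%N mu.
Implicit Type V : nat * nat -> C.

Definition vop V (k : nat) : fop R N :=
  fop_prod logq r [:: PhiN logq r kap (V (N, k));
    fop_prod logq r [seq Fcur logq r kap m (V (m, k)) | m <- rev (index_iota (nth 0 mu k) N)];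
    fzero (phi_fun logq r (nth 0 mu k) (fun m => V (m, k)))]%N.

Lemma phi_fun_eq m (v v' : nat -> C) (x y : W) : (forall j, (m <= j <= N)%N -> v j = v' j) ->
  phi_fun logq r m v x y = phi_fun logq r m v' x y.
Proof.
move=> h; rewrite /phi_fun big_nat [RHS]big_nat; apply: eq_bigr => j /andP[mj jN].
by rewrite !h // ?mj ?(ltnW jN) // jN ltnW.
Qed.

Lemma vopE V k : vop V k = zright (word logq r kap [seq (c.1, V c) | c <- block N mu k])
  (phi_fun logq r (nth 0 mu k) (fun m => V (m, k)))%N.
Proof.
have -> : word logq r kap [seq (c.1, V c) | c <- block N mu k] =
    fmul (PhiN logq r kap (V (N, k)))
      (fop_prod logq r [seq Fcur logq r kap m (V (m, k)) | m <- rev (index_iota (nth 0 mu k)%N N)]).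
  rewrite /word /block -map_comp map_cons -map_comp PhiN_cur.
  apply: (congr1 (fun s => fmul (cur logq r kap (N, V (N, k))) (fop_prod logq r s))).
  apply/eq_in_map => m; rewrite mem_rev mem_index_iota => /andP[_ mN].
  by rewrite Fcur_cur.
by rewrite /vop /= fmulf1 fmul_fzero fmul_zright_r.
Qed.

Definition vops V (ks : seq nat) : fop R N := foldr fmul (fone R N) [seq vop V k | k <- ks].

Lemma vops_cons V k ks : vops V (k :: ks) = fmul (vop V k) (vops V ks).
Proof. by []. Qed.

Lemma eq_vops V V' ks :
  (forall c, c.2 \in ks -> (nth 0 mu c.2 <= c.1 <= N)%N -> V c = V' c) ->
  all (fun k => k < n)%N ks -> vops V ks = vops V' ks.
Proof.
elim: ks => [|k ks IH]; first by [].
move=> h /andP[kn hks]; rewrite vops_cons [RHS]vops_cons.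
rewrite (IH _ hks); last by move=> c ck hc; apply: h; rewrite ?inE ?ck ?orbT.
apply: (congr1 (fun A => fmul A (vops V' ks))); rewrite vopE [RHS]vopE.
have -> : [seq (c.1, V c) | c <- block N mu k] = [seq (c.1, V' c) | c <- block N mu k].
  clear IH hks; apply/eq_in_map => c; rewrite (mem_block hmu _ kn) => /andP[/eqP e hc].
  have -> // : V c = V' c; apply: h; first by rewrite e inE eqxx.
  by rewrite e.
clear IH; congr (zright _ _); apply/funext => x; apply/funext => y; apply: phi_fun_eq => m hm.
by apply: h => //=; rewrite inE eqxx.
Qed.

Lemma sum_block k : (k < n)%N -> \sum_(c <- block N mu k) wt c.1 = epsbar R N (nth 0 mu k)%N.
Proof.
move=> kn; have /andP[m1 mN] := mu_range hmu kn.
rewrite big_cons big_map (perm_big (index_iota (nth 0 mu k) N)%N) /=; last by rewrite perm_rev.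
rewrite wtN big_nat (eq_bigr (fun m => alpha R N m)); last by move=> m /andP[_ mN']; rewrite wtF.
by rewrite -big_nat sum_alpha // /epsbar addrC addrA subrK.
Qed.

Lemma sum_labelsL ks : all (fun k => k < n)%N ks ->
  \sum_(c <- labelsL N mu ks) wt c.1 = \sum_(k <- ks) epsbar R N (nth 0 mu k)%N.
Proof.
elim: ks => [|k ks IH]; first by rewrite !big_nil.
by move=> /andP[kn /IH e]; rewrite labelsL_cons big_cat [RHS]big_cons -e sum_block.
Qed.

(** The values of the dynamical factors are shifted by the weights of the vertex
   operators standing to the right. *)
Lemma zcoef_vops V j m x y : (j + m <= n)%N ->
  let A := word logq r kap [seq (c.1, V c) | c <- labelsL N mu (iota j m)] in
  [/\ letters (vops V (iota j m)) = letters A, wshift (vops V (iota j m)) = wshift A &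
   zcoef (vops V (iota j m)) x y = zcoef A x y *
     \prod_(j <= k < j + m) phi_fun logq r (nth 0 mu k)%N (fun l => V (l, k))
        (x - \sum_(k.+1 <= i < j + m) epsbar R N (nth 0 mu i)%N) y].
Proof.
move=> + A; rewrite {}/A; elim: m j x => [|m IH] j x jm.
  by split=> //=; rewrite addn0 big_geq ?mulr1.
have jm' : (j.+1 + m <= n)%N by rewrite addSnnS.
have al : all (fun k => k < n)%N (iota j.+1 m).
  by apply/allP => k; rewrite mem_iota => /andP[_ /leq_trans]; apply.
rewrite (_ : iota j m.+1 = j :: iota j.+1 m) // labelsL_cons map_cat word_cat vops_cons.
have [h1 h2 _] := IH _ x jm'; rewrite vopE; split.
- by rewrite /= h1.
- by rewrite /= h2.
have [_ _ h3] := IH _ x jm'; rewrite /= h1 h2 h3.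
have lt1 : (j < j.+1 + m)%N by rewrite addSn ltnS leq_addr.
rewrite (_ : j + m.+1 = j.+1 + m)%N; last by rewrite addnS.
rewrite [X in _ = _ * X](big_ltn lt1) wshift_word big_map.
have -> : \sum_(j.+1 <= i < j.+1 + m) epsbar R N (nth 0 mu i)%N = \sum_(c <- labelsL N mu (iota j.+1 m)) wt c.1.
  by rewrite sum_labelsL // /index_iota addKn.
ring.
Qed.

Lemma Ph_shift x y k l : (k < n)%N -> (1 <= l <= N)%N ->
  Ph (x - \sum_(k.+1 <= i < n) epsbar R N (nth 0 mu i)%N) y (nth 0 mu k)%N l =
  Ph x y (nth 0 mu k)%N l - Cshift R mu (nth 0 mu k)%N l k.
Proof.
move=> kn hl; have hm := mu_range hmu kn.
rewrite /Ph /Cshift addrAC dotBr; congr (_ - _); rewrite dot_sumr; apply: eq_bigr => i _.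
by rewrite dotBl !dot_eps_epsbar // opprB addrA subrK !(eq_sym (nth 0 mu i)%N).
Qed.

(** Integration variables of the composition, in the order of the integrals. *)
Definition ivars (ks : seq nat) : seq (nat * nat) :=
  flatten [seq [seq (m, k) | m <- index_iota (nth 0 mu k) N] | k <- ks]%N.

Lemma mem_ivars ks c : (c \in ivars ks) = (c.2 \in ks) && (nth 0 mu c.2 <= c.1 < N)%N.
Proof.
case: c => l k; apply/flattenP/andP => [ [_ /mapP[k' kks ->] /mapP[m]]|[kks hl]].
  by rewrite mem_index_iota => hm [-> ->].
exists [seq (m, k) | m <- index_iota (nth 0 mu k) N]%N; first by apply/mapP; exists k.
by apply/mapP; exists l => //; rewrite mem_index_iota.
Qed.

Lemma ivars_uniq ks : uniq ks -> uniq (ivars ks).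
Proof.
elim: ks => [|k ks IH] //= /andP[kks /IH hu]; rewrite /ivars /= -/(ivars ks) cat_uniq hu andbT.
rewrite map_inj_uniq ?iota_uniq //=; last by move=> a b [].
apply/hasPn => c; rewrite mem_ivars => /andP[ck _]; apply/mapP => -[m _ e].
by rewrite e (negbTE kks) in ck.
Qed.

Variable aN : nat -> C.

(** The t of F_m in the k-th vertex operator is the variable with label (m, k). *)
Lemma phi_comp_iop ks : uniq ks -> all (fun k => k < n)%N ks ->
  let A := foldr (iop_mul logq r) (iop_one R N)
    [seq Phi logq r kap aN (nth 0 mu k)%N (u k) | k <- ks] in
  [/\ iop_dim A = size (ivars ks), iop_coef A = \prod_(k <- ks) aN (nth 0 mu k)%N &
   forall th, iop_fun A th = vops
     (fun c => if c.1 == N then u c.2 else vang logq (th (index c (ivars ks)))) ks].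
Proof.
elim: ks => [|k ks IH] /=; first by rewrite big_nil.
move=> /andP[kks uks] /andP[kn hks]; have [h1 h2 h3] := IH uks hks.
have /andP[m1 mN] := mu_range hmu kn.
have sz : size [seq (m, k) | m <- index_iota (nth 0 mu k) N]%N = (N - nth 0 mu k)%N.
  by rewrite size_map size_iota.
split.
- by rewrite h1 /ivars /= size_cat sz.
- by rewrite h2 big_cons.
move=> th; rewrite vops_cons.
have iE m : (nth 0 mu k <= m < N)%N -> index (m, k) (ivars (k :: ks)) = (m - nth 0 mu k)%N.
    move=> /andP[hm hN]; rewrite /ivars /= index_cat map_f ?mem_index_iota ?hm //.
    rewrite index_map; last by move=> a b [].
    by rewrite index_iota_sub // hm subnKC // ltnW // (leq_ltn_trans hm).
pose V c := if c.1 == N then u c.2 else vang logq (th (index c (ivars (k :: ks)))).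
rewrite -[RHS]/(fmul (vop V k) (vops V ks)).
have -> : vop V k = iop_fun (Phi logq r kap aN (nth 0 mu k)%N (u k)) th.
  rewrite /vop /Phi /= {1}/V eqxx.
  have -> : [seq Fcur logq r kap m (V (m, k)) | m <- rev (index_iota (nth 0 mu k)%N N)] =
      [seq Fcur logq r kap m (if m == N then u k else vang logq (th (m - nth 0 mu k)%N))
       | m <- rev (index_iota (nth 0 mu k)%N N)].
    by apply/eq_in_map => m; rewrite mem_rev mem_index_iota => hm; rewrite /V /= iE //; case: eqP.
  have -> // : phi_fun (N := N) logq r (nth 0 mu k)%N (fun m => V (m, k)) =
     phi_fun logq r (nth 0 mu k)%N (fun m => if m == N then u k else vang logq (th (m - nth 0 mu k)%N)).
  apply/funext => x; apply/funext => y; apply: phi_fun_eq => m /andP[hm hN]; rewrite /V /=.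
  by case: eqP => // /eqP nN; rewrite iE // hm ltn_neqAle nN.
apply: (congr1 (fun A => fmul _ A)); rewrite h3.
apply: eq_vops => // c ck /andP[hc1 hc2]; rewrite /V; case: eqP => // /eqP nN.
rewrite /ivars /= -/(ivars ks) index_cat ifF ?sz //.
by apply: contraNF kks => /mapP[m _ e]; rewrite e in ck.
Qed.

End VertexWords.

(** * The integrands before symmetrization *)

Section PointwiseIdentity.
Variable R : realType.
Local Notation C := R[i].
Variables (N : nat) (logq : C) (r : R).
Local Notation W := 'rV[C]_N.
Variable kap : W -> W -> C.
Variables (mu : seq nat) (u : nat -> C).
Local Notation n := (size mu).
Local Notation qpow := (qpow logq).
Local Notation q := (qq logq).
Local Notation p := (pp logq r).
Local Notation "[[ x ]]" := (br logq r x).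
Local Notation wt := (wt R N).
Local Notation psi := (lat_coef N logq r).
Local Notation gL := (pair_coef N logq r).
Local Notation gN := (nord_coef N logq r).
Local Notation lam := (lam mu).
Local Notation Iset := (Iset mu).
Local Notation ipos := (ipos mu).
Local Notation zz := (zz logq u).
Local Notation vx := (vx N u).
Hypothesis N1 : (1 < N)%N.
Hypothesis hq : complex.Re logq < 0.
Hypothesis hr : 1 < r.
Hypothesis hgen : forall s : rat, r != ratr s.
Hypothesis hkap : lattice_rep logq r kap.
Hypothesis hmu : all (fun m => 1 <= m <= N)%N mu.
Hypothesis hpole1 : forall k l, (k < l < n)%N ->
  dpoch N logq r (q ^+ 2 * (zz k / zz l)) != 0.
Hypothesis hpole2 : forall k l, (k < n)%N -> (l < n)%N -> k <> l ->
  dpoch N logq r (q ^+ (2 * N) * (zz k / zz l)) != 0.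

Implicit Type v : nat -> nat -> C.

(** The variable of level l that comes from the vertex operator k. *)
Definition Vlab v (c : nat * nat) : C := vx v c.1 (index c.2 (Iset c.1)).

Lemma Vlab_N v k : (k < n)%N -> Vlab v (N, k) = u k.
Proof. by move=> kn; rewrite /Vlab /= /Defs.vx eqxx (IsetN hmu) index_iota_sub ?subn0. Qed.

Lemma Vlab_ipos v l a : (a < lam l)%N -> Vlab v (l, ipos l a) = vx v l a.
Proof. by move=> al; rewrite /Vlab /= index_ipos. Qed.

(** Poles have the value 0, so that the exchange of Phi_N and F_(N-1) fails at the finitely
   many points of the circle where one of these products vanishes. *)
Definition regular v : Prop :=
  (forall l a, (1 <= l < N)%N -> (a < lam l)%N -> cabs (qpow (2 * v l a)) = 1) /\
  (forall a k, (a < lam N.-1)%N -> (k < n)%N ->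
     poch1 (q * (qpow (2 * v N.-1 a) / zz k)) p != 0 /\
     poch1 (p / q * (qpow (2 * v N.-1 a) / zz k)) p != 0).

Definition NN_factor (k l : nat) : C := PhiSym N logq r (zz k) (zz l) *
  (sgnpow ((N%:R - 1) / N%:R)
     * qpow (2 * u k * ((r - 1)%:C * (N%:R - 1) / (r%:C * N%:R)))
     * (eGamma (q ^+ 2 * (zz k / zz l)) p (q ^+ (2 * N))
        / eGamma (q ^+ (2 * N) * (zz k / zz l)) p (q ^+ (2 * N)))).

(** What is left of a pair of currents after normal ordering, for the order by level. *)
Definition pair_factor v (c d : nat * nat) : C :=
  if c.1 == d.1 then
    (if c.1 == N then NN_factor c.2 d.2
     else FSym logq r (Vlab v c) (Vlab v d) *
          ([[Vlab v c - Vlab v d - 1]] / [[Vlab v c - Vlab v d]]))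
  else if (c.1 == d.1.+1) && (d.2 < c.2)%N
  then [[Vlab v c - Vlab v d - 2^-1]] / [[Vlab v c - Vlab v d + 2^-1]] else 1.

Lemma index_lam l k : k \in Iset l -> (index k (Iset l) < lam l)%N.
Proof. by move=> kl; rewrite /lam index_mem. Qed.

Lemma psi_ge l l' : (l' <= l)%N -> psi l l' = 1.
Proof. by move=> h; rewrite /lat_coef ltnNge h. Qed.

Lemma psi_far l l' : (l.+1 < l')%N -> psi l l' = 1.
Proof. by move=> h; rewrite /lat_coef ifT; [rewrite /kapex ifN //|]; lia. Qed.

(** Two currents occur in opposite orders only if the one of higher level comes from a later
   vertex operator: this is the condition on positions in the factors
   [v - w - 1/2] / [v - w + 1/2]. *)
Lemma pair_factorE v c d : regular v -> c \in labelsR N mu -> d \in labelsR N mu -> ltR c d ->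
  let g c d := gL (c.1, Vlab v c) (d.1, Vlab v d) * psi c.1 d.1 in
  (if ltL c d then g c d else g d c) =
  gN (c.1, Vlab v c) (d.1, Vlab v d) * pair_factor v c d.
Proof.
case: c d => [l k] [l' k'] [hv1 hv2]; rewrite !(mem_labelsR N1 hmu) /=.
move=> /and3P[kn kl lN] /and3P[kn' kl' lN'] hlt.
have l0 : (1 <= l)%N by apply: leq_trans kl; case/andP: (mu_range hmu kn).
have l0' : (1 <= l')%N by apply: leq_trans kl'; case/andP: (mu_range hmu kn').
have hk : k \in Iset l by rewrite mem_Iset kn.
have hk' : k' \in Iset l' by rewrite mem_Iset kn'.
have Vcirc m j : (1 <= m < N)%N -> j \in Iset m -> cabs (qpow (2 * Vlab v (m, j))) = 1.
  move=> hm hj; rewrite /Vlab /Defs.vx ifN ?hv1 ?index_lam //.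
  by case/andP: hm => _ /ltn_eqF ->.
rewrite /pair_factor /nord_coef /=; case: (eqVneq l l') => [e|ne].
  move: hlt; rewrite -{}e in lN' hk' kl' l0' *; rewrite /ltR /ltL /= ltnn eqxx /= => kk.
  rewrite kk psi_ge // mulr1 /=; case: eqP => [e|/eqP nN].
    rewrite e /nord_const eqxx mul1r !Vlab_N // NN_pair //; first by apply: hpole1; rewrite kk.
    by apply: hpole2 => // e'; rewrite e' ltnn in kk.
  have hl : (1 <= l < N)%N by rewrite l0 ltn_neqAle nN.
  by rewrite same_level //= ?Vcirc // mulrC.
have ll' : (l' < l)%N by move: hlt; rewrite /ltR /= (negbTE ne) orbF.
rewrite /ltL /=; case: (ltngtP k k') => [kk|kk|kk] /=.
- by rewrite psi_ge ?(ltnW ll') // andbF mulr1.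
- case: eqP => [e|/eqP ne1] /=; last first.
    have far : (l'.+1 < l)%N by rewrite ltn_neqAle eq_sym ne1.
    by rewrite psi_far // !far_exchange ?l0 ?l0' ?lN ?lN' ?far ?orbT.
  have hl' : (1 <= l' < N)%N by rewrite l0' -e.
  have V'1 := Vcirc _ _ hl' hk'.
  suff [A0 B0] : poch1 (q * (qpow (2 * Vlab v (l', k')) / qpow (2 * Vlab v (l, k)))) p != 0 /\
     poch1 (p / q * (qpow (2 * Vlab v (l', k')) / qpow (2 * Vlab v (l, k)))) p != 0.
    by rewrite -(adj_exchange N1 hq hr hgen e l0' lN A0 B0).
  case: (eqVneq l N) => [eN|nN].
    have el' : l' = N.-1 by rewrite -eN e.
    rewrite {1 3}/Vlab /Defs.vx /= ifN ?ltn_eqF ?(andP hl').2 // eN Vlab_N //.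
    by rewrite el'; apply: hv2 => //; rewrite -el' index_lam.
  have hl : (1 <= l < N)%N by rewrite l0 ltn_neqAle nN.
  have c1 : cabs (qpow (2 * Vlab v (l', k')) / qpow (2 * Vlab v (l, k))) = 1.
    by rewrite cabsM cabsV V'1 Vcirc // mul1r invr1.
  split; apply: poch1_neq0_lt1 => //; rewrite cabsM c1 mulr1; first exact: cabs_q_lt1.
  rewrite cabsM cabsV ltr_pdivrMr ?cabs_q_gt0 // mul1r.
  apply: lt_le_trans (cabs_p_lt_q2 hq hr) _.
  by rewrite expr2 ler_piMr ?cabs_ge0 // ltW // cabs_q_lt1.
- by rewrite ll' psi_ge ?(ltnW ll') // andbF mulr1.
Qed.


Definition vlev v (l : nat) : seq C := [seq vx v l a | a <- iota 0 (lam l)].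

Definition sym_factor v : C :=
  (\prod_(0 <= l < n) \prod_(0 <= k < l) PhiSym N logq r (zz k) (zz l))
  * \prod_(1 <= l < N) \prod_(0 <= b < lam l) \prod_(0 <= a < b) FSym logq r (v l a) (v l b).

Lemma Phi_tildeE v : Phi_tilde logq r kap mu u v =
  fscal (sym_factor v) (fop_prod logq r [seq nX logq r kap l (vlev v l) | l <- levels N]).
Proof.
rewrite /Phi_tilde; congr fscal; rewrite /levels map_cons /=.
have -> : nX logq r kap N (vlev v N) = nPhi logq r kap [seq u k | k <- iota 0 n].
  rewrite /nX eqxx /vlev (lamN hmu); congr nPhi; apply/eq_map => a.
  by rewrite /Defs.vx eqxx.
apply: (congr1 (fun s => Defs.fmul logq r _ (fop_prod logq r s))); apply/eq_in_map => l.
rewrite mem_rev mem_index_iota => /andP[_ lN]; rewrite /nX ltn_eqF //; congr nF.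
by rewrite /vlev; apply/eq_map => a; rewrite /Defs.vx ltn_eqF.
Qed.

Lemma vlev_labels v : flatten [seq [seq (l, w) | w <- vlev v l] | l <- levels N] =
  [seq (c.1, Vlab v c) | c <- labelsR N mu].
Proof.
rewrite /labelsR map_flatten -map_comp; congr flatten; apply/eq_map => l /=.
rewrite -!map_comp IsetE -map_comp; apply/eq_in_map => a; rewrite mem_iota add0n /= => al.
by rewrite Vlab_ipos.
Qed.

Lemma pairprod_one (T : eqType) (lt : rel T) (g : T -> T -> C) s : pairwise lt s ->
  {in s &, forall c d, lt c d -> g c d = 1} -> pairprod g s = 1.
Proof. by move=> hs h; rewrite (eq_pairprod hs h) pairprod_const expr1n. Qed.

Lemma pairprod_psi_R : pairprod psi [seq c.1 | c <- labelsR N mu] = 1.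
Proof.
rewrite pairprod_map; apply: (pairprod_one (pairwise_labelsR mu N1)) => c d _ _.
by rewrite /ltR => h; apply: psi_ge; case/orP: h => [/ltnW //|/andP[/eqP -> _] ].
Qed.

Definition mid_factor v : C := \prod_(1 <= l < N) \prod_(0 <= a < lam l)
  ((\prod_(0 <= b < lam l.+1 | (ipos l.+1 b > ipos l a)%N)
     ([[vx v l.+1 b - vx v l a - 2^-1]] / [[vx v l.+1 b - vx v l a + 2^-1]]))
   * \prod_(a.+1 <= b < lam l) ([[vx v l a - vx v l b - 1]] / [[vx v l a - vx v l b]])).

(** Sorted by level, the pair factors are the symmetric contractions, mu^+ and the factors of
   U without the zero modes P + h. *)
Lemma pairprod_factor v : pairprod (pair_factor v) (labelsR N mu) =
  sym_factor v * mu_plus N logq r mu u * mid_factor v.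
Proof.
rewrite /labelsR pairprod_flatten.
have -> : pairprod (fun l l' => \prod_(c <- [seq (l, k) | k <- Iset l])
    \prod_(d <- [seq (l', k) | k <- Iset l']) pair_factor v c d) (levels N)
  = \prod_(1 <= l < N) \prod_(0 <= a < lam l) \prod_(0 <= b < lam l.+1 | (ipos l.+1 b > ipos l a)%N)
     ([[vx v l.+1 b - vx v l a - 2^-1]] / [[vx v l.+1 b - vx v l a + 2^-1]]).
  pose h l l' := if l == l'.+1 then \prod_(c <- [seq (l, k) | k <- Iset l])
    \prod_(d <- [seq (l', k) | k <- Iset l']) pair_factor v c d else 1.
  rewrite levelsE // (@eq_pairprod _ _ _ _ h _ (pairwise_rev_iota 1 N.+1)); last first.
    move=> l l' _ _ /= ll'; rewrite /h; case: eqP => // nl.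
    rewrite big1_seq // => c /andP[_ /mapP[k _ ->] ]; rewrite big1_seq // => d /andP[_ /mapP[k' _ ->] ].
    by rewrite /pair_factor /= gtn_eqF //; case: eqP.
  rewrite pairprod_adjacent; last by move=> l l' /negbTE e; rewrite /h e.
  rewrite big_nat [RHS]big_nat; apply: eq_bigr => l /andP[l0 lN].
  rewrite /h eqxx exchange_big big_map big_Iset /= big_nat [RHS]big_nat.
  apply: eq_bigr => a /andP[_ al]; rewrite big_map big_Iset /= [RHS]big_mkcond big_nat [RHS]big_nat.
  apply: eq_bigr => b /andP[_ bl].
  by rewrite /pair_factor /= gtn_eqF // eqxx /= !Vlab_ipos //; case: ifP.
rewrite /levels big_cons (perm_big (index_iota 1 N)) /=; last by rewrite perm_rev.
have -> : pairprod (pair_factor v) [seq (N, k) | k <- Iset N] =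
  (\prod_(0 <= l < n) \prod_(0 <= k < l) PhiSym N logq r (zz k) (zz l)) * mu_plus N logq r mu u.
  rewrite pairprod_map (IsetN hmu) pairprod_iota /mu_plus -big_split; apply: eq_bigr => l _.
  by rewrite -big_split; apply: eq_bigr => k _; rewrite /pair_factor /= !eqxx.
have -> : \prod_(1 <= l < N) pairprod (pair_factor v) [seq (l, k) | k <- Iset l] =
  (\prod_(1 <= l < N) \prod_(0 <= b < lam l) \prod_(0 <= a < b) FSym logq r (v l a) (v l b)) *
  \prod_(1 <= l < N) \prod_(0 <= a < lam l)
    \prod_(a.+1 <= b < lam l) ([[vx v l a - vx v l b - 1]] / [[vx v l a - vx v l b]]).
  rewrite -big_split big_nat [RHS]big_nat; apply: eq_bigr => l /andP[l0 lN] /=.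
  rewrite pairprod_map IsetE pairprod_map -pairprod_iota -pairprod_iota_l -pairprodM.
  apply: (@eq_pairprod _ _ ltn).
    by rewrite -sorted_pairwise; [exact: iota_ltn_sorted|exact: ltn_trans].
  move=> a b; rewrite !mem_iota !add0n => al bl _.
  by rewrite /pair_factor /= eqxx !Vlab_ipos // /Defs.vx ltn_eqF.
rewrite /sym_factor /mid_factor.
under [X in _ = _ * X]eq_bigr do rewrite big_split.
rewrite [X in _ = _ * X]big_split /=; ring.
Qed.

Lemma prod_Iset (F : nat -> nat -> C) :
  \prod_(0 <= k < n) \prod_(nth 0%N mu k <= l < N) F l k =
  \prod_(1 <= l < N) \prod_(0 <= a < lam l) F l (ipos l a).
Proof.
transitivity (\prod_(0 <= k < n) \prod_(1 <= l < N | (nth 0%N mu k <= l)%N) F l k).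
  rewrite [LHS]big_nat [RHS]big_nat; apply: eq_bigr => k /andP[_ kn].
  by rewrite (big_nat_widenl _ 1%N) //; case/andP: (mu_range hmu kn).
rewrite (exchange_big_dep_nat xpredT) //; apply: eq_bigr => l _.
rewrite -big_Iset /Defs.Iset big_filter /index_iota subn0.
by apply: eq_bigl.
Qed.

Lemma phi_factor v x y :
  \prod_(0 <= k < n) phi_fun logq r (nth 0%N mu k) (fun l => Vlab v (l, k))
     (x - \sum_(k.+1 <= i < n) epsbar R N (nth 0%N mu i)) y =
  \prod_(1 <= l < N) \prod_(0 <= a < lam l)
    (let s := ipos l a in let b := index s (Iset l.+1) in let ms := nth 0%N mu s in
     let D := Ph x y ms l.+1 - Cshift R mu ms l.+1 s in
     ([[vx v l.+1 b - vx v l a + D - 2^-1]] * [[1]]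
      / ([[vx v l.+1 b - vx v l a + 2^-1]] * [[D]]))).
Proof.
pose F l k := let ms := nth 0%N mu k in let D := Ph x y ms l.+1 - Cshift R mu ms l.+1 k in
     ([[Vlab v (l.+1, k) - Vlab v (l, k) + D - 2^-1]] * [[1]]
      / ([[Vlab v (l.+1, k) - Vlab v (l, k) + 2^-1]] * [[D]])).
transitivity (\prod_(0 <= k < n) \prod_(nth 0%N mu k <= l < N) F l k).
  rewrite [LHS]big_nat [RHS]big_nat; apply: eq_bigr => k /andP[_ kn].
  rewrite [LHS]big_nat [RHS]big_nat; apply: eq_bigr => l /andP[_ lN].
  by rewrite Ph_shift.
rewrite prod_Iset [LHS]big_nat [RHS]big_nat; apply: eq_bigr => l _.
rewrite [LHS]big_nat [RHS]big_nat; apply: eq_bigr => a /andP[_ al].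
by rewrite /F Vlab_ipos.
Qed.

Lemma U_funE v x y : U_fun logq r mu u x y v =
  (\prod_(0 <= k < n) phi_fun logq r (nth 0%N mu k) (fun l => Vlab v (l, k))
     (x - \sum_(k.+1 <= i < n) epsbar R N (nth 0%N mu i)) y) * mid_factor v.
Proof.
rewrite phi_factor /mid_factor -big_split; apply: eq_bigr => l _.
by rewrite -big_split; apply: eq_bigr => a _; exact: esym (mulrA _ _ _).
Qed.

(** Both sides are scalar multiples of the same lattice cocycle and zero modes, once the
   currents of the left-hand side are sorted by level. *)
Lemma pointwise v :
  let A := vops logq r kap mu (Vlab v) (iota 0 n) in let B := Phi_tilde logq r kap mu u v in
  [/\ perm_eq (letters A) (letters B), wshift A = wshift B &
   forall x y, regular v -> wlat x ->
     zcoef A x y = zcoef B x y * (mu_plus N logq r mu u * U_fun logq r mu u x y v)].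
Proof.
move=> A B; rewrite /A /B Phi_tildeE.
have r0 : r != 0 by rewrite gt_eqF // (lt_trans ltr01 hr).
have ul : uniq (levels N) by rewrite levelsE // rev_uniq iota_uniq.
have [] := nX_prod logq kap (vlev v) r0 ul; rewrite vlev_labels.
set B' := fop_prod _ _ _ => b1 b2 b3; rewrite {}/A {}/B.
set sL := [seq (c.1, Vlab v c) | c <- labelsL N mu (iota 0 n)].
set sR := [seq (c.1, Vlab v c) | c <- labelsR N mu] in b1 b2 b3.
have a h y := zcoef_vops logq r kap hmu (Vlab v) h y (leqnn (0 + n)).
have sLR : perm_eq sL sR by apply: perm_map; exact: perm_labels.
split.
- have [-> _ _] := a 0 0; rewrite letters_word.
  by have -> : letters (fscal (sym_factor v) B') = sR by exact: b1.
- have [_ -> _] := a 0 0; rewrite wshift_word.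
  have -> : wshift (fscal (sym_factor v) B') = - \sum_(c <- sR) wt c.1 by exact: b2.
  by rewrite (perm_big _ sLR).
move=> x y hv hx; have [_ _ ->] := a x y; rewrite add0n zcoef_word.
have -> : zcoef (fscal (sym_factor v) B') x y = sym_factor v * zcoef B' x y by [].
rewrite b3 U_funE -/sL.
have fstE (s : seq (nat * nat)) : [seq c.1 | c <- [seq (c.1, Vlab v c) | c <- s] ] = [seq c.1 | c <- s].
  by rewrite -map_comp.
have lv : all (fun l => 1 <= l <= N)%N [seq c.1 | c <- sL].
  rewrite (perm_all _ (perm_map _ sLR)) fstE all_map; apply/allP => c.
  rewrite mem_labelsR // => /and3P[cn h1 h2] /=; rewrite h2 andbT.
  by apply: leq_trans h1; case/andP: (mu_range hmu cn).
rewrite (kapw_perm hkap lv hx (perm_map _ sLR)) (fstE (labelsR _ _)) pairprod_psi_R divr1.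
rewrite (perm_big _ sLR) /=.
suff e : pairprod gL sL * pairprod psi [seq c.1 | c <- sL] =
    pairprod gN sR * (sym_factor v * mu_plus N logq r mu u * mid_factor v).
  move: (kapw _ _ _) (pairprod psi _) (pairprod gL _) (pairprod gN _) (\prod_(c <- sR) _)
    (\prod_(0 <= k < n) _) (sym_factor v) (mu_plus _ _ _ _ _) (mid_factor v) e
    => k P1 P2 P3 Z F S M D e.
  transitivity (k * (P2 * P1) * Z * F); first by ring.
  by rewrite e; ring.
rewrite fstE -pairprod_factor !pairprod_map -pairprodM pairprod_labels // -pairprodM.
apply: eq_pairprod (pairwise_labelsR mu N1) _ => c d cR dR cd.
exact: pair_factorE.
Qed.

End PointwiseIdentity.

(** * Bounded measurable functions on the torus *)

Section Niceness.
Variable R : realType.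
Local Notation C := R[i].
Implicit Types (F G : (nat -> R) -> C) (tau : nat -> R).

Lemma measurable_invR : measurable_fun setT (fun x : R => x^-1).
Proof.
have -> : [set: R] = ~` [set 0] `|` [set 0] by rewrite setUC setUv.
apply/measurable_funU => //; first exact: measurableC.
split; last exact: measurable_fun_set1.
apply: open_continuous_measurable_fun.
  by apply: closed_openC; exact: accessible_closed_set1 (hausdorff_accessible (@norm_hausdorff _ _)) _.
move=> x; rewrite inE /= => x0; apply: inv_continuous; exact/eqP.
Qed.

Lemma mfunV F : mfun F -> mfun (fun tau => (F tau)^-1).
Proof.
move=> mF d S X mX; have [f1 f2] := mF d S X mX.
have e (z : C) : z^-1 = (complex.Re z / (complex.Re z ^+ 2 + complex.Im z ^+ 2)) +i*
    (- complex.Im z / (complex.Re z ^+ 2 + complex.Im z ^+ 2)).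
  by case: z => a b; apply: eq_ReIm; rewrite /= ?mulNr.
have mn : measurable_fun setT (fun w => (complex.Re (F (fun c => X c w)) ^+ 2
     + complex.Im (F (fun c => X c w)) ^+ 2)^-1).
  apply: measurableT_comp; first exact: measurable_invR.
  by apply: measurable_funD; exact: measurable_funX.
split.
- by under eq_fun do rewrite e; exact: measurable_funM.
- by under eq_fun do rewrite e; apply: measurable_funM => //; exact: measurable_funN.
Qed.

Lemma mfun_ccvg (G : nat -> (nat -> R) -> C) F : (forall K, mfun (G K)) ->
  (forall tau, ccvg (fun K => G K tau) (F tau)) -> mfun F.
Proof.
move=> mG h d S X mX; split.
- apply: (measurable_fun_cvg (h := fun K w => complex.Re (G K (fun c => X c w)))).
    by move=> K; have [] := mG K d S X mX.
  by move=> w _; have [] := h (fun c => X c w).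
- apply: (measurable_fun_cvg (h := fun K w => complex.Im (G K (fun c => X c w)))).
    by move=> K; have [] := mG K d S X mX.
  by move=> w _; have [] := h (fun c => X c w).
Qed.

Lemma mfun_prod (I : Type) (s : seq I) (F : I -> (nat -> R) -> C) :
  (forall i, mfun (F i)) -> mfun (fun tau => \prod_(i <- s) F i tau).
Proof.
move=> h; elim: s => [|i s IH].
  rewrite (_ : (fun _ => _) = fun=> 1); first exact: mfun_cst.
  by apply/funext => tau; rewrite big_nil.
rewrite (_ : (fun _ => _) = fun tau => F i tau * \prod_(i <- s) F i tau); first exact: mfunM.
by apply/funext => tau; rewrite big_cons.
Qed.

Lemma mfun_linf (a : nat -> seq C) F : summable a -> mfun F -> mfun (fun tau => linf a (F tau)).
Proof.
move=> sa mF; apply: (mfun_ccvg (G := fun K tau => lprod a K (F tau))) => [K|tau]; last exact: lprod_ccvg.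
apply: mfun_prod => j; apply: mfun_prod => c.
rewrite (_ : (fun _ => _) = fun tau => 1 + - c * F tau); last first.
  by apply/funext => tau; rewrite mulNr.
by apply: (mfunD (mfun_cst 1)); exact: mfunM (mfun_cst (- c)) mF.
Qed.

Lemma mfun_cexp F : mfun F -> mfun (fun tau => cexp (F tau)).
Proof.
move=> mF d S X mX; have [f1 f2] := mF d S X mX; rewrite /cexp /=.
split; apply: measurable_funM.
- by apply: measurableT_comp.
- by apply: measurableT_comp => //; exact: continuous_measurable_fun (@continuous_cos R).
- by apply: measurableT_comp.
- by apply: measurableT_comp => //; exact: continuous_measurable_fun (@continuous_sin R).
Qed.

Lemma eq_nice F G : (forall tau, F tau = G tau) -> nice G -> nice F.
Proof. by move=> /funext ->. Qed.

Lemma nice_cexp F : nice F -> nice (fun tau => cexp (F tau)).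
Proof.
move=> [mF [B hB]]; split; first exact: mfun_cexp.
exists (expR B) => tau ht; rewrite cabs_cexp ler_expR.
by apply: le_trans (hB _ ht); apply: le_trans (ler_norm _) (Re_le_cabs _).
Qed.

Lemma nice_angle (c : nat) : nice (fun tau => (tau c)%:C).
Proof.
split; first by move=> d S X mX; split => //=; exact: measurable_cst.
by exists 1 => tau ht; rewrite cabs_real ger0_norm; case/andP: (ht c).
Qed.

Lemma niceN F : nice F -> nice (fun tau => - F tau).
Proof. by move=> nF; under eq_fun do rewrite -mulN1r; apply: niceM => //; exact: nice_cst. Qed.

Lemma niceX F m : nice F -> nice (fun tau => F tau ^+ m).
Proof.
move=> nF; elim: m => [|m IH]; first exact: nice_cst.
by under eq_fun do rewrite exprS; exact: niceM.
Qed.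

(** On such functions q-products and their inverses are controlled by the modulus alone. *)
Definition circular F (rho : R) : Prop := mfun F /\ forall tau, cabs (F tau) = rho.

Lemma circularM F G a b : circular F a -> circular G b -> circular (fun tau => F tau * G tau) (a * b).
Proof. by move=> [mF hF] [mG hG]; split=> [|tau]; [exact: mfunM|rewrite cabsM hF hG]. Qed.

Lemma circularV F a : circular F a -> circular (fun tau => (F tau)^-1) a^-1.
Proof. by move=> [mF hF]; split=> [|tau]; [exact: mfunV|rewrite cabsV hF]. Qed.

Lemma circular_cst (z : C) : circular (fun=> z) (cabs z).
Proof. by split=> //; exact: mfun_cst. Qed.

Lemma circular_nice F a : circular F a -> nice F.
Proof. by move=> [mF hF]; split=> //; exists a => tau _; rewrite hF. Qed.

Lemma nice_poch1 (s c : C) F a : cabs s < 1 -> circular F a -> nice (fun tau => poch1 (c * F tau) s).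
Proof.
move=> s1 [mF hF]; have sa := summable_layers1 c s1; under eq_fun do rewrite poch1E.
split; first exact: mfun_linf.
by have [S hS] := sa; exists (expR (S * a)) => tau _; rewrite -(hF tau); exact: linf_le.
Qed.

Lemma nice_poch1V (s c : C) F a : cabs s < 1 -> circular F a ->
  (forall k, cabs (c * s ^+ k) * a != 1) -> nice (fun tau => (poch1 (c * F tau) s)^-1).
Proof.
move=> s1 [mF hF] hk; have sa := summable_layers1 c s1; under eq_fun do rewrite poch1E.
split; first by apply: mfunV; exact: mfun_linf.
have a0 : 0 <= a by rewrite -(hF (fun=> 0)) cabs_ge0.
have [|d d0 hd] := linf_circle_ge sa a0; first by move=> j c'; rewrite inE => /eqP ->.
exists d^-1 => tau _; rewrite cabsV lef_pV2 ?posrE //; first exact: hd.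
by apply: lt_le_trans (hd _ (hF tau)).
Qed.

(** The quotient is the indicator function of the points where F does not vanish. *)
Lemma nice_divff F : mfun F -> nice (fun tau => F tau / F tau).
Proof.
move=> mF; split; first by apply: mfunM => //; exact: mfunV.
exists 1 => tau _; case: (eqVneq (F tau) 0) => [->|h]; first by rewrite mul0r cabs_real normr0.
by rewrite divff // cabs1.
Qed.

End Niceness.

(** * The integrand is bounded *)

Section IntegrandNice.
Variable R : realType.
Local Notation C := R[i].
Variables (N : nat) (logq : C) (r : R).
Local Notation W := 'rV[C]_N.
Variable kap : W -> W -> C.
Variables (mu : seq nat) (u : nat -> C).
Local Notation n := (size mu).
Local Notation qpow := (qpow logq).
Local Notation q := (qq logq).
Local Notation p := (pp logq r).
Local Notation br := (br logq r).
Local Notation zz := (zz logq u).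
Local Notation contr := (contr N logq r).
Hypothesis N1 : (1 < N)%N.
Hypothesis hq : complex.Re logq < 0.
Hypothesis hr : 1 < r.
Hypothesis hgen : forall s : rat, r != ratr s.
Hypothesis hmu : all (fun m => 1 <= m <= N)%N mu.
Hypothesis hz : forall k, (k < n)%N -> cabs p < cabs (zz k) /\ cabs (zz k) < 1.
Hypothesis hcontour : forall k j, (k <= j < n)%N -> (nth 0%N mu j < N)%N ->
  cabs (zz k) != cabs q.
Variable code : nat * nat -> nat.
Implicit Types (F : (nat -> R) -> C) (tau : nat -> R) (c d : nat * nat).

Let p1 := cabs_p_lt1 hq hr.
Let q1 := cabs_q_lt1 hq.
Let p0 : 0 < cabs p. Proof. by rewrite cabs_gt0 p_neq0. Qed.
Let q0 := cabs_q_gt0 logq.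
Let pq : cabs p < cabs q ^+ 2 := cabs_p_lt_q2 hq hr.

Definition Vtau tau c : C := if c.1 == N then u c.2 else vang logq (tau (code c)).
(** The modulus of q^(2 v) for the variable v with label c. *)
Definition rad c : R := if c.1 == N then cabs (zz c.2) else 1.

Lemma logq_neq0 : logq != 0.
Proof. by apply: contraTneq hq => ->; rewrite /= ltxx. Qed.

Lemma qpow_vang (th : R) : qpow (2 * vang logq th) = cexp ('i * (2 * pi * th)%:C).
Proof.
rewrite /Defs.qpow /vang; congr cexp; rewrite mulrA mulfVK ?logq_neq0 // mulrCA; congr (_ * _).
by rewrite -(rmorph_nat (real_complex R)) -rmorphM mulrA.
Qed.

Lemma cabs_cexp_i (t : R) : cabs (cexp ('i * t%:C)) = 1.
Proof. by rewrite cabs_cexp ReM /= !(mul0r, mulr0) subr0 expR0. Qed.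

Lemma nice_V c : nice (Vtau^~ c).
Proof.
rewrite /Vtau; case: eqP => _; first exact: nice_cst.
rewrite (_ : (fun _ => _) = fun tau => ('i * pi%:C / logq) * (tau (code c))%:C).
  by apply: niceM; [exact: nice_cst|exact: nice_angle].
by apply/funext => tau; rewrite /vang rmorphM /=; ring.
Qed.

Lemma nice_qpow F : nice F -> nice (fun tau => qpow (F tau)).
Proof. by move=> nF; apply: nice_cexp; apply: niceM => //; exact: nice_cst. Qed.

Lemma nice_qpowV F : nice F -> nice (fun tau => (qpow (F tau))^-1).
Proof. by move=> nF; under eq_fun do rewrite -qpowN; apply: nice_qpow; exact: niceN. Qed.

Lemma circ_V c : circular (fun tau => qpow (2 * Vtau tau c)) (rad c).
Proof.
split=> [|tau]; first by apply: (nice_qpow (niceM (nice_cst 2) (nice_V c))).1.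
by rewrite /Vtau /rad; case: eqP => // _; rewrite qpow_vang cabs_cexp_i.
Qed.

Lemma rad_gt0 c : 0 < rad c.
Proof. by rewrite -((circ_V c).2 (fun=> 0)) cabs_gt0 qpow_neq0. Qed.

Lemma circ_ratio c d : circular (fun tau => qpow (2 * Vtau tau d) / qpow (2 * Vtau tau c)) (rad d / rad c).
Proof. by apply: circularM; [exact: circ_V|apply: circularV; exact: circ_V]. Qed.

Lemma pow_scale (a : C) (rho : R) : 0 <= rho -> cabs a * rho < 1 ->
  forall k, cabs (a * p ^+ k) * rho != 1.
Proof.
move=> r0 h k; rewrite lt_eqF //; apply: le_lt_trans h.
rewrite cabsM cabsX -mulrA [_ ^+ _ * _]mulrC mulrA ler_piMr ?mulr_ge0 ?cabs_ge0 //.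
by rewrite exprn_ile1 ?cabs_ge0 // ltW.
Qed.

Lemma nice_br F rho : nice F -> circular (fun tau => qpow (2 * F tau)) rho ->
  nice (fun tau => br (F tau)).
Proof.
move=> nF cF; rewrite /Defs.br /theta; apply: niceM.
  apply: nice_qpow; apply: niceD; last exact: niceN.
  by apply: niceM; [exact: niceX|exact: nice_cst].
apply: niceM; last exact: nice_cst.
apply: niceM; last by apply: nice_poch1 (circularV cF).
by under eq_fun do rewrite -[X in poch1 X _]mul1r; apply: nice_poch1 cF.
Qed.

Lemma nice_br_shift c d (a b : C) :
  nice (fun tau => br (Vtau tau c - Vtau tau d + a - b)).
Proof.
apply: (nice_br (rho := rad c / rad d * cabs (qpow (2 * (a - b))))).
  apply: niceD; last exact: nice_cst; apply: niceD; last exact: nice_cst.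
  by apply: niceD; [exact: nice_V|apply: niceN; exact: nice_V].
have := circularM (circ_ratio d c) (circular_cst (qpow (2 * (a - b)))).
congr circular; apply/funext => tau; rewrite -qpowB -qpowD; congr qpow; ring.
Qed.

Lemma nice_brV F rho : nice F -> circular (fun tau => qpow (2 * F tau)) rho ->
  rho < 1 -> cabs p < rho -> nice (fun tau => (br (F tau))^-1).
Proof.
move=> nF cF r1 pr; have r0 : 0 < rho by apply: le_lt_trans pr; exact: cabs_ge0.
rewrite /Defs.br /theta; under eq_fun do rewrite !invfM; apply: niceM.
  apply: nice_qpowV; apply: niceD; last exact: niceN.
  by apply: niceM; [exact: niceX|exact: nice_cst].
apply: niceM; last exact: nice_cst.
apply: niceM.
  under eq_fun do rewrite -[X in poch1 X _]mul1r; apply: (nice_poch1V p1 cF).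
  by apply: pow_scale; rewrite ?(ltW r0) // cabs1 mul1r.
apply: (nice_poch1V p1 (circularV cF)); apply: pow_scale; first by rewrite invr_ge0 ltW.
by rewrite ltr_pdivrMr // mul1r.
Qed.

Lemma q_sep (Z : R) : cabs p < Z -> Z != cabs q -> forall k, cabs (q * p ^+ k) * Z^-1 != 1.
Proof.
move=> pZ Zq k; have Z0 : Z != 0 by rewrite gt_eqF // (lt_trans p0).
rewrite -(inj_eq (mulIf Z0)) mulfVK // mul1r.
case: k => [|k]; first by rewrite expr0 mulr1 eq_sym.
rewrite lt_eqF //; apply: le_lt_trans pZ; rewrite cabsM cabsX exprS mulrCA ler_piMr ?(ltW p0) //.
by rewrite mulr_ile1 ?exprn_ge0 ?cabs_ge0 ?exprn_ile1 // ltW.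
Qed.

(** Contractions are bounded on the torus; only Phi_N F_(N-1) has a pole that may
   meet it, at |z| = |q|. *)
Lemma nice_contr c d : (1 <= c.1 <= N)%N -> (1 <= d.1 <= N)%N ->
  (c.1 = N -> (c.2 < n)%N) -> (d.1 = N -> (d.2 < n)%N) ->
  (c.1 = N -> d.1 = N.-1 -> rad c != cabs q) ->
  nice (fun tau => contr c.1 d.1 (qpow (2 * Vtau tau d) / qpow (2 * Vtau tau c))).
Proof.
move=> hc hd cN dN hcq; have cr := circ_ratio c d.
have r0 : 0 < rad d / rad c by rewrite divr_gt0 ?rad_gt0.
have radd : rad d <= 1 by rewrite /rad; case: eqP => // e; apply: ltW; exact: (hz (dN e)).2.
have [far|] := boolP ((c.1.+1 < d.1)%N || (d.1.+1 < c.1)%N).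
  by rewrite contr_far //; exact: nice_cst.
rewrite negb_or -!leqNgt => /andP[dc cd].
have [e|ne] := eqVneq c.1 d.1.
  have [eN|nN] := eqVneq c.1 N.
    rewrite /Vtau -e eN eqxx; exact: nice_cst.
  have hcN : (1 <= c.1 < N)%N by move: hc nN; clear; lia.
  rewrite -e contr_same //.
  have rr : rad d / rad c = 1 by rewrite /rad -e (negbTE nN) divr1.
  rewrite rr in cr; apply: niceM; last first.
    apply: (nice_poch1V p1 cr); apply: pow_scale; rewrite // mulr1 cabsM cabsV cabsX.
    by rewrite ltr_pdivrMr ?exprn_gt0 // mul1r.
  apply: niceM; last exact: nice_poch1 cr.
  by apply: niceD; [exact: nice_cst|apply: niceN; exact: circular_nice cr].
have adj : (d.1 == c.1.+1) || (c.1 == d.1.+1) by move: dc cd ne; clear; lia.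
rewrite contr_adj //; apply: niceM; first exact: nice_poch1 cr.
apply: (nice_poch1V p1 cr).
have [eN|nN] := eqVneq c.1 N; last first.
  apply: pow_scale; first exact: ltW.
  rewrite {2}/rad (negbTE nN) divr1; apply: le_lt_trans q1.
  by rewrite ler_piMr // ltW.
have edN : d.1 = N.-1 by move: dc cd ne eN hd; clear; lia.
have nd : d.1 != N by rewrite -eN eq_sym.
rewrite /rad eN eqxx (negbTE nd) mul1r => k; have [z1 z2] := hz (cN eN).
by apply: q_sep => //; have := hcq eN edN; rewrite /rad eN eqxx.
Qed.

Lemma nice_zm c (x y : W) : nice (fun tau => zm logq r c.1 (Vtau tau c) x y).
Proof.
have h (a : C) : nice (fun tau => 2 * Vtau tau c * a).
  by apply: niceM; [apply: niceM; [exact: nice_cst|exact: nice_V]|exact: nice_cst].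
rewrite /zm; case: (c.1 == N).
  by apply: niceM; [apply: niceM; [exact: nice_cst|]|]; apply: nice_qpow; exact: h.
apply: niceM; apply: nice_qpow; first exact: h.
by under eq_fun do rewrite mulrDl; apply: niceD; [exact: nice_cst|exact: h].
Qed.

Lemma nice_zsh c (w : W) : nice (fun tau => zsh logq r c.1 (Vtau tau c) w).
Proof.
have h (a : C) : nice (fun tau => 2 * Vtau tau c * a).
  by apply: niceM; [apply: niceM; [exact: nice_cst|exact: nice_V]|exact: nice_cst].
rewrite /zsh; case: (c.1 == N).
  by apply: niceM; [apply: niceM; [exact: nice_cst|]|]; apply: nice_qpow; exact: h.
apply: niceM; apply: nice_qpow; first exact: h.
by under eq_fun do rewrite mulrDl; apply: niceD; [exact: nice_cst|exact: h].
Qed.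

(** The only other pole that may meet the torus is that of the dynamical factor at
   |z| = |p / q|; it is cancelled by a zero of the contraction Phi_N F_(N-1). *)
Lemma nice_pole k : (k < n)%N -> rad (N, k) != cabs q ->
  nice (fun tau => contr N N.-1 (qpow (2 * Vtau tau (N.-1, k)) / qpow (2 * Vtau tau (N, k)))
    / br (Vtau tau (N, k) - Vtau tau (N.-1, k) + 2^-1)).
Proof.
move=> kn hk; have N0 : (0 < N)%N by exact: ltnW.
pose c := (N, k); pose d := (N.-1, k).
have nN : (N.-1 == N) = false by apply/eqP; move: N0; clear; lia.
have rc : rad c = cabs (zz k) by rewrite /rad eqxx.
have rd : rad d = 1 by rewrite /rad /= nN.
have [z1 z2] := hz kn; have zk0 : 0 < cabs (zz k) := lt_trans p0 z1.
have cr := circ_ratio c d; rewrite rc rd in cr.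
have cr' := circ_ratio d c; rewrite rc rd divr1 in cr'.
have [h1 h2 h3] : [/\ 1 <= N <= N, 1 <= N.-1 <= N & (N.-1 == N.+1) || (N == N.-1.+1)]%N.
  by move: N1; clear => N1; split; move: N1; lia.
rewrite (contr_adj N1 hq hr hgen h1 h2 h3).
set w := fun tau => qpow (2 * Vtau tau d) / qpow (2 * Vtau tau c) in cr *.
pose w' tau := qpow (2 * Vtau tau c) / qpow (2 * Vtau tau d).
have qd tau : qpow (2 * (Vtau tau c - Vtau tau d + 2^-1)) = q * w' tau.
  by rewrite mulrDr mulrBr mulfV ?pnatr_eq0 // qpowD qpowB /w' [RHS]mulrC.
have pw (A B : C) : p / (q * (A / B)) = p / q * (B / A) by rewrite -[RHS]mulrA invfM invf_div.
apply: (@eq_nice _ _ (fun tau =>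
   (poch1 (p / q * w tau) p / poch1 (p / q * w tau) p) * (poch1 (q * w tau) p)^-1
   * ((poch1 (q * w' tau) p)^-1 * (qpow ((Vtau tau c - Vtau tau d + 2^-1) ^+ 2 / r%:C
       - (Vtau tau c - Vtau tau d + 2^-1)) * poch1 p p)^-1))) => [tau|].
  rewrite /Defs.br /theta -/c -/d qd pw.
  by rewrite !invfM; ring.
have nV : nice (fun tau => Vtau tau c - Vtau tau d + 2^-1).
  by apply: niceD; [apply: niceD; [exact: nice_V|apply: niceN; exact: nice_V]|exact: nice_cst].
apply: niceM; last first.
  apply: niceM; last first.
    under eq_fun do rewrite invfM; apply: niceM; last exact: nice_cst.
    apply: nice_qpowV; apply: niceD; last exact: niceN.
    by apply: niceM; [exact: niceX|exact: nice_cst].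
  apply: (nice_poch1V p1 cr'); apply: pow_scale; first exact: cabs_ge0.
  by rewrite -[X in _ < X]mul1r ltr_pM ?cabs_ge0.
apply: niceM; first by apply: nice_divff; exact: (nice_poch1 (p / q) p1 cr).1.
apply: (nice_poch1V p1 cr) => j; rewrite mul1r.
by apply: q_sep => //; rewrite -rc.
Qed.


Lemma nice_phi (m : nat) k (x y : W) : (k < n)%N -> (0 < m)%N -> (m.+1 < N)%N ->
  nice (fun tau => br (Vtau tau (m.+1, k) - Vtau tau (m, k) + Ph x y (nth 0%N mu k) m.+1 - 2^-1)
    * br 1 / (br (Vtau tau (m.+1, k) - Vtau tau (m, k) + 2^-1) * br (Ph x y (nth 0%N mu k) m.+1))).
Proof.
move=> kn m0 mN.
have e1 : rad (m.+1, k) = 1 by rewrite /rad /= ltn_eqF.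
have e2 : rad (m, k) = 1 by rewrite /rad /= ltn_eqF // ltnW.
under eq_fun do rewrite invfM mulrA; apply: niceM; last exact: nice_cst.
have nV a : nice (fun tau => Vtau tau (m.+1, k) - Vtau tau (m, k) + a).
  by apply: niceD; [apply: niceD; [exact: nice_V|apply: niceN; exact: nice_V]|exact: nice_cst].
apply: niceM; first (apply: niceM; last exact: nice_cst).
  exact: nice_br_shift.
apply: (nice_brV (rho := cabs q)) => //; last first.
  by apply: lt_trans pq _; rewrite expr2 gtr_pMr.
have := circularM (circ_ratio (m, k) (m.+1, k)) (circular_cst q).
rewrite e1 e2 divr1 mul1r; congr circular; apply/funext => tau.
by rewrite mulrDr mulrBr mulfV ?pnatr_eq0 // qpowD qpowB.
Qed.

Lemma nice_pairprod (T : eqType) (g : (nat -> R) -> T -> T -> C) (s : seq T) :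
  (forall c d : T, c \in s -> d \in s -> nice (fun tau => g tau c d)) ->
  nice (fun tau => pairprod (g tau) s).
Proof.
elim: s => [|c s IH] h /=; first exact: nice_cst.
apply: niceM; last by apply: IH => c' d' cs ds; apply: h; rewrite inE ?cs ?ds orbT.
by apply: nice_prod => d ds _; apply: h; rewrite inE ?eqxx ?ds ?orbT.
Qed.

Lemma nice_vop k (x y : W) : (k < n)%N ->
  nice (fun tau => zcoef (vop logq r kap mu (Vtau tau) k) x y).
Proof.
move=> kn; have /andP[m1 mN] := mu_range hmu kn.
pose g tau c d := pair_coef N logq r (c.1, Vtau tau c) (d.1, Vtau tau d).
apply: (@eq_nice _ _ (fun tau => kapw kap [seq c.1 | c <- block N mu k] x
   * pairprod (g tau) (block N mu k) * (\prod_(c <- block N mu k) zm logq r c.1 (Vtau tau c) x y)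
   * phi_fun logq r (nth 0%N mu k) (fun m => Vtau tau (m, k)) x y)) => [tau|].
  rewrite vopE; congr (_ * _); rewrite zcoef_word pairprod_map big_map; congr (kapw _ _ _ * _ * _).
  by rewrite -map_comp.
have ng c d : c \in block N mu k -> d \in block N mu k -> c.1 != N ->
    nice (fun tau => g tau c d).
  rewrite !(mem_block hmu _ kn) => /andP[/eqP c2 /andP[c1 cN]] /andP[/eqP d2 /andP[d1 dN]] cnN.
  rewrite /g /pair_coef /=; apply: niceM; last exact: nice_zsh.
  apply: nice_contr; rewrite ?cN ?dN ?andbT ?(leq_trans m1 c1) ?(leq_trans m1 d1) ?c2 ?d2 //.
  by move=> e; rewrite e eqxx in cnN.
have nzm : nice (fun tau => \prod_(c <- block N mu k) zm logq r c.1 (Vtau tau c) x y).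
  by apply: nice_prod => c _ _; exact: nice_zm.
have [eN|nN] := eqVneq (nth 0%N mu k) N.
  have eb : block N mu k = [:: (N, k)] by rewrite /block eN /index_iota subnn.
  rewrite eb in nzm *; apply: niceM; last first.
    by under eq_fun do rewrite /phi_fun eN big_geq //; exact: nice_cst.
  apply: niceM => //; apply: niceM; first exact: nice_cst.
  by apply: (@eq_nice _ _ (fun=> 1)) => [tau|]; [rewrite /= big_nil mulr1|exact: nice_cst].
have mN' : (nth 0%N mu k <= N.-1)%N by move: mN nN; clear; lia.
have N0 : (0 < N)%N by exact: ltnW.
pose s := [seq (m, k) | m <- rev (index_iota (nth 0%N mu k) N.-1)].
have eb : block N mu k = (N, k) :: (N.-1, k) :: s.
  rewrite /block /s -[in index_iota _ N](prednK N0) /index_iota subSn // -addn1 iotaD rev_cat /=.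
  by rewrite subnKC.
rewrite eb in ng nzm *.
have hk : rad (N, k) != cabs q by rewrite /rad eqxx; apply: (hcontour (j := k)); rewrite ?leqnn // ltn_neqAle nN.
have hs d : d \in s -> (nth 0%N mu k <= d.1 < N.-1)%N.
  by move=> /mapP[m]; rewrite mem_rev mem_index_iota => hm ->.
pose ph tau m := br (Vtau tau (m.+1, k) - Vtau tau (m, k) + Ph x y (nth 0%N mu k) m.+1 - 2^-1)
    * br 1 / (br (Vtau tau (m.+1, k) - Vtau tau (m, k) + 2^-1) * br (Ph x y (nth 0%N mu k) m.+1)).
have ephi tau : phi_fun logq r (nth 0%N mu k) (fun m => Vtau tau (m, k)) x y =
    \prod_(nth 0%N mu k <= m < N.-1) ph tau m * ph tau N.-1.
  transitivity (\prod_(nth 0%N mu k <= m < N.-1.+1) ph tau m); first by rewrite (prednK N0).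
  by rewrite big_nat_recr.
set K := kapw _ _ _.
apply: (@eq_nice _ _ (fun tau =>
  K * zsh logq r N (Vtau tau (N, k)) (- wt R N N.-1)
  * (contr N N.-1 (qpow (2 * Vtau tau (N.-1, k)) / qpow (2 * Vtau tau (N, k)))
    / br (Vtau tau (N, k) - Vtau tau (N.-1, k) + 2^-1))
  * (\prod_(d <- s) g tau (N, k) d)
  * (pairprod (g tau) ((N.-1, k) :: s))
  * (\prod_(c <- [:: (N, k), (N.-1, k) & s]) zm logq r c.1 (Vtau tau c) x y)
  * (\prod_(nth 0%N mu k <= m < N.-1) ph tau m)
  * (br (Vtau tau (N, k) - Vtau tau (N.-1, k) + Ph x y (nth 0%N mu k) N - 2^-1)
    * (br 1 / br (Ph x y (nth 0%N mu k) N))))) => [tau|].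
  have e1 : pairprod (g tau) [:: (N, k), (N.-1, k) & s] = g tau (N, k) (N.-1, k)
      * \prod_(d <- s) g tau (N, k) d * pairprod (g tau) ((N.-1, k) :: s).
    by rewrite -[LHS]/(\prod_(d <- (N.-1, k) :: s) g tau (N, k) d * pairprod (g tau) ((N.-1, k) :: s)) big_cons.
  have e2 : g tau (N, k) (N.-1, k) =
      contr N N.-1 (qpow (2 * Vtau tau (N.-1, k)) / qpow (2 * Vtau tau (N, k)))
      * zsh logq r N (Vtau tau (N, k)) (- wt R N N.-1) by [].
  have e3 : ph tau N.-1 = br (Vtau tau (N, k) - Vtau tau (N.-1, k) + Ph x y (nth 0%N mu k) N - 2^-1)
      * br 1 / (br (Vtau tau (N, k) - Vtau tau (N.-1, k) + 2^-1) * br (Ph x y (nth 0%N mu k) N)).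
    by rewrite /ph (prednK N0).
  rewrite ephi e1 e2 e3; clear; rewrite invfM.
  move: (pairprod _ _) (\prod_(d <- s) g tau (N, k) d)
    (\prod_(c <- [:: (N, k), (N.-1, k) & s]) zm logq r c.1 (Vtau tau c) x y)
    (\prod_(nth 0%N mu k <= m < N.-1) ph tau m)
    (contr _ _ _) (zsh _ _ _ _ _) (br _) (br 1) (br _)^-1 (br _)^-1 => *.
  by ring.
have nnN : (N.-1 == N) = false by apply/eqP; move: N0; clear; lia.
apply: niceM; last first.
  by apply: niceM; [exact: nice_br_shift|exact: nice_cst].
apply: niceM; last first.
  apply: nice_prod => m; rewrite mem_index_iota => /andP[h1 h2] _; apply: nice_phi => //.
    exact: leq_trans h1.
  by move: h2; clear; lia.
apply: niceM => //; apply: niceM; last first.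
  apply: nice_pairprod => c d cs ds; apply: ng; [by rewrite in_cons cs orbT|by rewrite in_cons ds orbT|].
  move: cs; rewrite inE => /orP[/eqP -> /=|/hs /andP[_ h]]; first by rewrite nnN.
  by rewrite ltn_eqF //; move: h; clear; lia.
apply: niceM; last first.
  apply: nice_prod => d ds _; rewrite /g /pair_coef /=; apply: niceM; last exact: (nice_zsh (N, k)).
  have /andP[h1 h2] := hs _ ds.
  have d0 : (1 <= d.1 <= N)%N by rewrite (leq_trans m1 h1) (ltnW (leq_trans h2 (leq_pred N))).
  apply: (@nice_contr (N, k) d) => //; first by rewrite /= leqnn N0.
  by move=> e; move: h2; rewrite e ltnNge leq_pred.
apply: niceM; last exact: nice_pole.
by apply: niceM; [exact: nice_cst|exact: (nice_zsh (N, k))].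
Qed.

(** The letters of a vertex operator meet those of the later ones only in contractions; the
   zeros of the dynamical denominators come from the same vertex operator. *)
Lemma nice_vops j m (x y : W) : (j + m <= n)%N ->
  nice (fun tau => zcoef (vops logq r kap mu (Vtau tau) (iota j m)) x y).
Proof.
elim: m j x => [|m IH] j x jm; first exact: nice_cst.
have jm' : (j.+1 + m <= n)%N by rewrite addSnnS.
have jn : (j < n)%N by apply: leq_trans jm'; rewrite addSn ltnS leq_addr.
set B := - \sum_(c <- labelsL N mu (iota j.+1 m)) wt R N c.1.
apply: (@eq_nice _ _ (fun tau =>
  (\prod_(c <- block N mu j) \prod_(d <- labelsL N mu (iota j.+1 m))
     contr c.1 d.1 (qpow (2 * Vtau tau d) / qpow (2 * Vtau tau c)))
  * (zcoef (vop logq r kap mu (Vtau tau) j) (x + B) y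
     * zcoef (vops logq r kap mu (Vtau tau) (iota j.+1 m)) x y))) => [tau|].
  have ei : iota j m.+1 = j :: iota j.+1 m by [].
  rewrite ei vops_cons.
  have [l2 w2 _] := zcoef_vops logq r kap hmu (Vtau tau) x y jm'.
  rewrite letters_word in l2; rewrite wshift_word big_map -/B in w2.
  have l1 : letters (vop logq r kap mu (Vtau tau) j) = [seq (c.1, Vtau tau c) | c <- block N mu j].
    by rewrite vopE [LHS]letters_word.
  move: (vop _ _ _ _ _ _) (vops _ _ _ _ _ _) l1 l2 w2 => A1 A2 l1 l2 w2.
  rewrite -[LHS]/((\prod_(c <- letters A1) \prod_(d <- letters A2)
     contr c.1 d.1 (qpow (2 * d.2) / qpow (2 * c.2))) * (zcoef A1 (x + wshift A2) y * zcoef A2 x y)).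
  rewrite l1 l2 w2 big_map; congr (_ * _); apply: eq_bigr => c _.
  by rewrite big_map.
apply: niceM; last by apply: niceM; [exact: nice_vop|exact: IH].
apply: nice_prod => c; rewrite (mem_block hmu _ jn) => /andP[/eqP c2 /andP[c1 cN]] _.
apply: nice_prod => d; rewrite mem_labelsL //; last first.
  by apply/allP => k; rewrite mem_iota => /andP[_ /leq_trans]; apply.
rewrite mem_iota => /andP[/andP[jd dm] /andP[d1 dN]] _.
have dn : (d.2 < n)%N by exact: leq_trans jm'.
have /andP[a1 _] := mu_range hmu jn; have /andP[b1 _] := mu_range hmu dn.
apply: nice_contr; rewrite ?c2 ?cN ?dN ?andbT ?(leq_trans a1 c1) ?(leq_trans b1 d1) //.
move=> eN edN; rewrite /rad eN eqxx c2; apply: (hcontour (j := d.2)); first by rewrite ltnW.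
by apply: leq_ltn_trans d1 _; rewrite edN prednK // ltnW.
Qed.

Section Acting.
Variables (X : nat -> nat -> C) (hX : finsupp X).

Lemma nice_creation (s : seq (nat * nat)) (A : (nat -> R) -> fop R N) :
  (forall tau, letters (A tau) = [seq (c.1, Vtau tau c) | c <- s]) ->
  nice (fun tau => creation logq r (A tau) X).
Proof.
move=> hA; have [K hK] := hX; rewrite /creation; apply: nice_cexp.
pose f tau (m : nat) := \sum_(1 <= j < N) \sum_(c <- letters (A tau))
   cur_coef N logq c.1 j (- m%:Z) * qpow (2 * c.2) ^+ m * prime_coef logq r (- m%:Z) * X j m.
apply: (@eq_nice _ _ (fun tau => \sum_(1 <= m < K.+1) f tau m)) => [tau|].
  apply: ccvg_clim; apply: (ccvg_unshift (n := K.+1)).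
  rewrite (_ : (fun _ => _) = fun=> \sum_(1 <= m < K.+1) f tau m); first exact: ccvg_cst.
  apply/funext => i; rewrite (big_cat_nat _ (n := K.+1)) //=; last by rewrite leq_addl.
  rewrite [X in _ + X]big1_seq ?addr0 // => m /andP[_]; rewrite mem_index_iota => /andP[Km _].
  by rewrite /f big1 // => j _; rewrite big1 // => c _; rewrite hK ?mulr0 // ltnW.
apply: nice_sum => m _; apply: nice_sum => j _; under eq_fun do rewrite hA big_map /=.
apply: nice_sum => c _; apply: niceM; last exact: nice_cst.
apply: niceM; last exact: nice_cst; apply: niceM; first exact: nice_cst.
by apply: niceX; exact: circular_nice (circ_V c).
Qed.

Lemma nice_translation (s : seq (nat * nat)) (A : (nat -> R) -> fop R N) j m :
  (forall tau, letters (A tau) = [seq (c.1, Vtau tau c) | c <- s]) ->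
  nice (fun tau => translation logq r (A tau) j m).
Proof.
move=> hA; rewrite /translation; under eq_fun do rewrite hA big_map /=.
apply: nice_sum => c _; apply: nice_sum => i _; apply: niceM; last exact: nice_cst.
apply: niceM; last exact: nice_cst; apply: niceM; first exact: nice_cst.
by under eq_fun do rewrite -exprVn; apply: niceX; exact: circular_nice (circularV (circ_V c)).
Qed.

Lemma nice_fock (f : (nat -> nat -> C) -> C) (T : (nat -> R) -> nat -> nat -> C) : fock_poly N f ->
  (forall j m, nice (fun tau => T tau j m)) -> nice (fun tau => f (T tau)).
Proof.
move=> hf hT; elim: hf => [z|j m _ _|g h _ ng _ nh|g h _ ng _ nh].
- exact: nice_cst.
- exact: hT.
- exact: niceD.
- exact: niceM.
Qed.

Lemma nice_act (Psi : state R N) (x y : W) : (forall x y, fock_poly N (Psi x y)) ->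
  nice (fun tau => act logq r (vops logq r kap mu (Vtau tau) (iota 0 n)) Psi x y X).
Proof.
move=> hP.
have hA tau : letters (vops logq r kap mu (Vtau tau) (iota 0 n)) =
    [seq (c.1, Vtau tau c) | c <- labelsL N mu (iota 0 n)].
  by have [-> _ _] := zcoef_vops logq r kap hmu (Vtau tau) x y (leqnn (0 + n)); rewrite letters_word.
have hW tau : wshift (vops logq r kap mu (Vtau tau) (iota 0 n)) =
    - \sum_(c <- labelsL N mu (iota 0 n)) wt R N c.1.
  have [_ -> _] := zcoef_vops logq r kap hmu (Vtau tau) x y (leqnn (0 + n)).
  by rewrite wshift_word big_map.
rewrite /act; under eq_fun do rewrite hW.
apply: niceM; last first.
  apply: nice_fock => // j m; apply: niceD; first exact: nice_cst.
  exact: nice_translation hA.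
by apply: niceM; [exact: nice_vops|exact: nice_creation hA].
Qed.

End Acting.

End IntegrandNice.

(** * Numbering of the integration variables *)

Section Positions.
Variables (N : nat) (mu : seq nat).
Local Notation n := (size mu).
Local Notation lam := (lam mu).
Local Notation Iset := (Iset mu).
Local Notation M := (Mdim N mu).
Hypothesis N1 : (1 < N)%N.
Hypothesis hmu : all (fun m => 1 <= m <= N)%N mu.

Definition vpos (l a : nat) : nat := (\sum_(1 <= l' < l) lam l' + a)%N.
Definition code (c : nat * nat) : nat := vpos c.1 (index c.2 (Iset c.1)).

Lemma vpos_lt l a : (1 <= l < N)%N -> (a < lam l)%N -> (vpos l a < M)%N.
Proof.
move=> /andP[l0 lN] al; rewrite /Mdim (big_cat_nat _ (n := l.+1)) //= big_nat_recr //=.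
by apply: leq_trans (leq_addr _ _); rewrite /vpos ltn_add2l.
Qed.

Lemma block_le l : (1 <= l < N)%N -> (vpos l 0 + lam l <= M)%N.
Proof.
move=> /andP[l0 lN]; rewrite /Mdim (big_cat_nat _ (n := l.+1)) //= big_nat_recr //=.
by apply: leq_trans (leq_addr _ _); rewrite /vpos addn0.
Qed.

Lemma code_levels m : (0 < m)%N ->
  [seq code c | c <- flatten [seq [seq (l, k) | k <- Iset l] | l <- index_iota 1 m]]
  = iota 0 (\sum_(1 <= l < m) lam l)%N.
Proof.
elim: m => // -[|m] IH _; first by rewrite big_geq.
have -> : (\sum_(1 <= l < m.+2) lam l = \sum_(1 <= l < m.+1) lam l + lam m.+1)%N.
  by rewrite big_nat_recr.
have -> : index_iota 1 m.+2 = rcons (index_iota 1 m.+1) m.+1.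
  by rewrite /index_iota !subSS !subn0 -[X in iota 1 X]addn1 iotaD cats1.
rewrite map_rcons -cats1 flatten_cat map_cat (IH isT) [flatten [:: _]]/= cats0.
rewrite iotaD add0n -{3}(addn0 (\sum_(1 <= l < m.+1) lam l)%N) iotaDl; congr (_ ++ _).
rewrite -map_comp IsetE -map_comp.
apply/eq_in_map => a; rewrite mem_iota add0n => /= al.
by rewrite /code /= index_ipos.
Qed.

(** Both sequences list the pairs (l, k) with mu_k <= l < N, the first one by k and the second
   one by l. *)
Lemma perm_code : perm_eq (map code (ivars N mu (iota 0 n))) (iota 0 M).
Proof.
rewrite /Mdim -code_levels ?(ltnW N1) //; apply: perm_map; apply: uniq_perm.
- exact/ivars_uniq/iota_uniq.
- apply: (@map_uniq _ _ code); rewrite code_levels ?(ltnW N1) //; exact: iota_uniq.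
move=> c; rewrite mem_ivars mem_iota add0n; case: c => l k /=.
apply/idP/flattenP => [/and3P[kn kl lN]|[S /mapP[l']]].
  exists [seq (l, k) | k <- Iset l]; last by apply/mapP; exists k => //; rewrite mem_Iset kn.
  apply/mapP; exists l => //; rewrite mem_index_iota lN andbT.
  by apply: leq_trans kl; case/andP: (mu_range hmu kn).
rewrite mem_index_iota => /andP[l0 lN] -> /mapP[k' k'l [-> ->]].
by move: k'l; rewrite mem_Iset lN andbT.
Qed.

Lemma index_code c : c \in ivars N mu (iota 0 n) ->
  index (code c) (map code (ivars N mu (iota 0 n))) = index c (ivars N mu (iota 0 n)).
Proof.
move=> cs; have us : uniq (map code (ivars N mu (iota 0 n))).
  by rewrite (perm_uniq perm_code) iota_uniq.
rewrite -{1}(nth_index c cs) -(nth_map c (code c)) ?index_mem //.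
by rewrite index_uniq ?size_map ?index_mem.
Qed.

(** Outside of the block of coordinates that starts at b and has length m it is the
   identity. *)
Definition shuffle (b m : nat) (s : 'S_m) (c : nat) : nat :=
  if (b <= c)%N then (if insub (c - b)%N is Some i then b + s (i : 'I_m) else c)%N else c.

Lemma shuffle_in b m (s : 'S_m) (i : 'I_m) : shuffle b s (b + i) = (b + s i)%N.
Proof. by rewrite /shuffle leq_addr addKn valK. Qed.

Lemma shuffle_out b m (s : 'S_m) c : ~~ (b <= c < b + m)%N -> shuffle b s c = c.
Proof.
rewrite /shuffle; case: (leqP b c) => //= bc h.
have {}h : ~~ (c - b < m)%N by rewrite ltn_subLR.
by rewrite insubN.
Qed.

Lemma shuffle_cases b m c : (exists i : 'I_m, c = b + i)%N \/ ~~ (b <= c < b + m)%N.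
Proof.
case: (boolP (b <= c < b + m)%N) => [/andP[bc cm]|]; last by right.
left; have h : (c - b < m)%N by rewrite ltn_subLR.
by exists (Ordinal h); rewrite /= subnKC.
Qed.

Lemma shuffleK b m (s : 'S_m) : cancel (shuffle b s) (shuffle b s^-1%g).
Proof.
move=> c; case: (shuffle_cases b m c) => [[i ->]|h]; last by rewrite !shuffle_out.
by rewrite !shuffle_in permK.
Qed.

Lemma shuffle_lt b m (s : 'S_m) L c : (b + m <= L)%N -> (c < L)%N -> (shuffle b s c < L)%N.
Proof.
move=> bL cL; case: (shuffle_cases b m c) => [[i ->]|h]; last by rewrite shuffle_out.
by rewrite shuffle_in; apply: leq_trans bL; rewrite ltn_add2l.
Qed.

Lemma perm_shuffle b m (s : 'S_m) L : (b + m <= L)%N ->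
  perm_eq (map (shuffle b s) (iota 0 L)) (iota 0 L).
Proof.
move=> bL; have inj (s' : 'S_m) := can_inj (@shuffleK b m s').
apply: uniq_perm; rewrite ?map_inj_uniq ?iota_uniq // => c.
apply/mapP/idP => [[d]|]; rewrite mem_iota add0n /= => h.
  by move=> ->; rewrite mem_iota add0n; exact: shuffle_lt.
exists (shuffle b s^-1%g c); first by rewrite mem_iota add0n; exact: shuffle_lt.
by rewrite -{1}(invgK s) shuffleK.
Qed.

Lemma vpos_disjoint l l' a : (1 <= l)%N -> (1 <= l')%N -> l' != l -> (a < lam l')%N ->
  ~~ (vpos l 0 <= vpos l' a < vpos l 0 + lam l)%N.
Proof.
move=> l0 l0' ne al; rewrite /vpos addn0; case: (ltngtP l' l) => [h|h|h]; last by rewrite h eqxx in ne.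
  rewrite negb_and -ltnNge; apply/orP; left.
  rewrite [X in (_ < X)%N](big_cat_nat _ (n := l'.+1)) //= big_nat_recr //=.
  by apply: leq_trans (leq_addr _ _); rewrite ltn_add2l.
rewrite negb_and -leqNgt; apply/orP; right.
rewrite [X in (_ <= X + _)%N](big_cat_nat _ (n := l.+1)) //= big_nat_recr //=.
by rewrite -addnA leq_addr.
Qed.

End Positions.

(** An entry m of mu is counted in lam l for the N - m levels l with m <= l < N. *)
Lemma Mdim_card N mu : all (fun m => 1 <= m <= N)%N mu ->
  Mdim N mu = (\sum_(1 <= l < N) (N - l) * card_I mu l)%N.
Proof.
move=> hmu; rewrite /Mdim.
have lamE l : lam mu l = (\sum_(m <- mu) (m <= l))%N.
  rewrite /lam /Iset size_filter -sum1_count big_mkcond.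
  rewrite -[in RHS](mkseq_nth 0%N mu) big_map; apply: eq_bigr => k _; by case: (_ <= _)%N.
have cardE l : card_I mu l = (\sum_(m <- mu) (m == l))%N.
  rewrite /card_I -sum1_count big_mkcond; apply: eq_bigr => m _ /=; by case: (_ == _).
under eq_bigr do rewrite lamE.
under [RHS]eq_bigr do rewrite cardE big_distrr.
rewrite exchange_big [RHS]exchange_big /= big_seq [RHS]big_seq; apply: eq_bigr => m mmu.
have /andP[m1 mN] := allP hmu _ mmu.
transitivity (N - m)%N.
  rewrite (big_cat_nat _ (n := m)) //= big_nat big1 ?add0n => [|l /andP[_ lm]].
    rewrite big_nat (eq_bigr (fun=> 1%N)) => [|l /andP[-> _] //].
    by rewrite -big_nat sum_nat_const_nat muln1.
  by rewrite leqNgt lm.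
move: mN; rewrite leq_eqVlt => /orP[/eqP e|mN].
  rewrite e subnn big_nat big1 // => l /andP[_ lN].
  by rewrite gtn_eqF // muln0.
rewrite (bigD1_seq m) ?iota_uniq ?mem_index_iota ?m1 //= eqxx muln1 big1 ?addn0 // => l ne.
by rewrite eq_sym (negbTE ne) muln0.
Qed.

(** * Operators up to reordering of the letters *)

Section OperatorSimilarity.
Variable R : realType.
Local Notation C := R[i].
Variables (N : nat) (logq : C) (r : R).
Local Notation W := 'rV[C]_N.
Variable kap : W -> W -> C.
Local Notation fmul := (@fmul R N logq r).
Implicit Types A B : fop R N.

Definition fsim A B : Prop :=
  [/\ perm_eq (letters A) (letters B), wshift A = wshift B & forall x y, zcoef A x y = zcoef B x y].

Lemma fsim_refl A : fsim A A.
Proof. by split. Qed.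

Lemma fsim_mul A A' B B' : fsim A A' -> fsim B B' -> fsim (fmul A B) (fmul A' B').
Proof.
move=> [a1 a2 a3] [b1 b2 b3]; split=> [||x y] /=.
- exact: perm_cat.
- by rewrite a2 b2.
rewrite a3 b3 b2 (perm_big _ a1) /=; congr (_ * _); apply: eq_bigr => c _.
exact: perm_big.
Qed.

Lemma fsim_prod (I : eqType) (s : seq I) (F G : I -> fop R N) :
  (forall i, i \in s -> fsim (F i) (G i)) ->
  fsim (fop_prod logq r [seq F i | i <- s]) (fop_prod logq r [seq G i | i <- s]).
Proof.
elim: s => [|i s IH] h /=; first exact: fsim_refl.
apply: fsim_mul; first by apply: h; rewrite mem_head.
by apply: IH => j js; apply: h; rewrite inE js orbT.
Qed.

Lemma fsim_scal (z z' : C) A B : z = z' -> fsim A B -> fsim (fscal z A) (fscal z' B).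
Proof. by move=> -> [h1 h2 h3]; split=> //= x y; rewrite h3. Qed.

Lemma creation_perm A B X : perm_eq (letters A) (letters B) ->
  creation logq r A X = creation logq r B X.
Proof.
move=> h; rewrite /creation; congr (cexp (clim _)); apply/funext => K.
by apply: eq_bigr => m _; apply: eq_bigr => j _; exact: perm_big.
Qed.

Lemma translation_perm A B : perm_eq (letters A) (letters B) ->
  translation logq r A = translation logq r B.
Proof. by move=> h; apply/funext => j; apply/funext => m; exact: perm_big. Qed.

Lemma act_proportional A B (z : C) Psi x y X : perm_eq (letters A) (letters B) ->
  wshift A = wshift B -> zcoef A (x - wshift A) y = zcoef B (x - wshift A) y * z ->
  act logq r A Psi x y X = act logq r B Psi x y X * z.
Proof.
move=> h1 h2 h3; rewrite /act h3 -h2 (creation_perm X h1) (translation_perm h1); ring.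
Qed.

Lemma act_fsim A B Psi x y X : fsim A B -> act logq r A Psi x y X = act logq r B Psi x y X.
Proof.
move=> [h1 h2 h3]; rewrite -[RHS]mulr1; apply: act_proportional => //.
by rewrite h3 mulr1.
Qed.

Lemma fsim_nF l (vs ws : seq C) : perm_eq vs ws ->
  fsim (nF logq r kap l vs) (nF logq r kap l ws).
Proof.
move=> h; have s := perm_size h; split=> [||x y] /=; first exact: perm_map.
  by rewrite s.
by rewrite s (perm_big _ h).
Qed.

Lemma FSymC (v w : C) : FSym logq r v w = FSym logq r w v.
Proof.
rewrite /FSym; set a := Defs.qpow _ (2 * v); set b := Defs.qpow _ (2 * w).
rewrite !invf_div; congr (- _ * (_ / _)).
- by congr Defs.qpow; ring.
- exact: mulrC.
- exact: mulrC.
Qed.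

Variables (mu : seq nat) (u : nat -> C).
Local Notation lam := (lam mu).

(** The zero modes of a normal ordered product enter through a product over its variables,
   and the contraction FSym is symmetric. *)
Lemma Phi_tilde_sym v w : (forall l, (1 <= l < N)%N ->
    perm_eq [seq v l a | a <- iota 0 (lam l)] [seq w l a | a <- iota 0 (lam l)]) ->
  fsim (Phi_tilde logq r kap mu u v) (Phi_tilde logq r kap mu u w).
Proof.
move=> h; apply: fsim_scal; last first.
  apply: fsim_mul; first exact: fsim_refl.
  apply: fsim_prod => l; rewrite mem_rev mem_index_iota => hl.
  by apply: fsim_nF; exact: h.
have key (v' : nat -> nat -> C) l : \prod_(0 <= b < lam l) \prod_(0 <= a < b)
    FSym logq r (v' l a) (v' l b) = pairprod (FSym logq r) [seq v' l a | a <- iota 0 (lam l)].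
  by rewrite pairprod_map pairprod_iota.
congr (_ * _); rewrite [LHS]big_nat [RHS]big_nat; apply: eq_bigr => l hl.
rewrite !key; apply: pairprod_perm; last exact: h.
exact: FSymC.
Qed.

End OperatorSimilarity.

Section Fibres.
Variable R : realType.
Local Notation C := R[i].
Local Notation E th := (cexp ('i * (2 * pi * th)%:C) : C).

(** cos (2 pi d) = 1 - 2 sin^2 (pi d), and the sine does not vanish between 0 and pi. *)
Lemma cexp_period_int (d : R) : -1 <= d <= 1 -> E d = 1 -> [\/ d = 0, d = 1 | d = -1].
Proof.
move=> /andP[d0 d1] e.
have c1 : cos (2 * pi * d) = 1.
  have ei : 'i%C * (2 * pi * d)%:C = 0 +i* (2 * pi * d) :> C.
    by apply: eq_ReIm; rewrite ?ReM ?ImM /=; ring.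
  by have := congr1 (@complex.Re R) e; rewrite ei /cexp /= expR0 mul1r.
have s0 : sin (pi * d) = 0.
  apply/eqP; rewrite -sqrf_eq0; have := c1.
  rewrite -mulrA mulr_natl cos_mulr2n => h; have := cos2Dsin2 (pi * d); lra.
have pi0 := pi_gt0 R.
have key (x : R) : 0 < x < 1 -> sin (pi * x) != 0.
  move=> /andP[x0 x1]; rewrite gt_eqF // sin_gt0_pi // mulr_gt0 //=.
  by rewrite gtr_pMr.
have [dn|dp|->] := ltgtP d 0; last by constructor 1.
- have [dm|dm|<-] := ltgtP (-1) d; [|lra|by constructor 3].
  have := key (- d); rewrite mulrN sinN s0 oppr0 eqxx => /(_ _)/negP; case; lra.
- have [dm|dm|->] := ltgtP d 1; [|lra|by constructor 2].
  by have := key d; rewrite s0 eqxx dp dm => /(_ isT).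
Qed.

Lemma finite_fibre (w : C) : finite_set [set th : R | 0 <= th <= 1 /\ E th = w].
Proof.
have [[t0 [h0 e0]]|none] := pselect (exists th : R, 0 <= th <= 1 /\ E th = w); last first.
  by rewrite (_ : mkset _ = set0) //; apply/seteqP; split=> // th hth; case: none; exists th.
apply: (@sub_finite_set _ _ [set t0; t0 + 1; t0 - 1]); last first.
  by rewrite !finite_setU; split; [split|]; exact: finite_set1.
move=> th [h e]; have : E (th - t0) = 1.
  rewrite (_ : 'i%C * _ = 'i * (2 * pi * th)%:C - 'i * (2 * pi * t0)%:C); last first.
    by rewrite -mulrBr -rmorphB -mulrBr.
  by rewrite cexpD cexpN e e0 divff // -e0 cexp_neq0.
case/cexp_period_int => [|||]; [move: h h0; lra|..] => d /=.
- by left; left; lra.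
- by left; right; lra.
- by right; lra.
Qed.

End Fibres.

(** * Symmetrization and conclusion *)

Lemma solve_pq (F : fieldType) (P Q Z E : F) : Q != 0 -> P != 0 -> Z != 0 ->
  P / Q * (E / Z) = 1 -> E = Z * Q / P.
Proof. by move=> Q0 P0 Z0 e; rewrite -[RHS]mul1r -e; field; rewrite Q0 P0 Z0. Qed.

Section Symmetrization.
Variable R : realType.
Local Notation C := R[i].
Variables (N : nat) (logq : C) (r : R).
Local Notation W := 'rV[C]_N.
Variable kap : W -> W -> C.
Variables (mu : seq nat) (u : nat -> C).
Local Notation n := (size mu).
Local Notation lam := (lam mu).
Local Notation Iset := (Iset mu).
Local Notation M := (Mdim N mu).
Local Notation pos := (vpos mu).
Local Notation q := (qq logq).
Local Notation p := (pp logq r).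
Local Notation zz := (zz logq u).
Hypothesis N1 : (1 < N)%N.
Hypothesis hq : complex.Re logq < 0.
Hypothesis hr : 1 < r.
Hypothesis hmu : all (fun m => 1 <= m <= N)%N mu.
Hypothesis hz : forall k, (k < n)%N -> cabs p < cabs (zz k) /\ cabs (zz k) < 1.
Implicit Types (v w : nat -> nat -> C) (tau : nat -> R) (f : (nat -> nat -> C) -> C).

Definition vtau tau (l a : nat) : C := vang logq (tau (pos l a)).

(** Since |p| < |z_k| < 1, a point of the unit circle can be a zero of the q-products of
   [regular] only through the first of their factors. *)
Definition bad : set R := \bigcup_(k in `I_n)
  ([set th | 0 <= th <= 1 /\ cexp ('i * (2 * pi * th)%:C) = zz k / q] `|`
   [set th | 0 <= th <= 1 /\ cexp ('i * (2 * pi * th)%:C) = zz k * q / p]).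

Lemma finite_bad : finite_set bad.
Proof.
apply: bigcup_finite => [|k _]; first exact: finite_II.
by rewrite finite_setU; split; exact: finite_fibre.
Qed.

Definition offbad tau : Prop := cube tau /\ forall c, c \in iota 0 M -> ~ bad (tau c).

Lemma regular_offbad tau : offbad tau -> regular N logq r mu u (vtau tau).
Proof.
move=> [ct hb]; have p1 := cabs_p_lt1 hq hr; have q1 := cabs_q_lt1 hq.
have p0 : 0 < cabs p by rewrite cabs_gt0 p_neq0.
have q0 := cabs_q_gt0 logq; have pq := cabs_p_lt_q2 hq hr.
split=> [l a _ _|a k aN kn]; first by rewrite qpow_vang // cabs_cexp_i.
have N1' : (1 <= N.-1 < N)%N by move: N1; clear; case: (N) => // m; rewrite /= ltnS leqnn andbT.
have cM : pos N.-1 a \in iota 0 M by rewrite mem_iota add0n; exact: vpos_lt.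
have nb := hb _ cM; have th01 := ct (pos N.-1 a).
rewrite /vtau qpow_vang //; set E := cexp _.
have E1 : cabs E = 1 by exact: cabs_cexp_i.
have [z1 z2] := hz kn; have z0 : zz k != 0 by exact: qpow_neq0.
have qn0 := q_neq0 logq; have pn0 := p_neq0 logq r.
have poch_E (c : C) : cabs c / cabs (zz k) * cabs p < 1 -> c * (E / zz k) != 1 ->
    poch1 (c * (E / zz k)) p != 0.
  move=> h1 h2; apply: poch1_neq0 => // -[|j]; first by rewrite expr0 mulr1.
  apply/eqP => e; have := cabs1 R; rewrite -e !cabsM cabsV cabsX E1 mul1r exprS mulrA.
  apply/eqP; rewrite lt_eqF //; apply: le_lt_trans h1.
  by rewrite ler_piMr ?mulr_ge0 ?invr_ge0 ?cabs_ge0 // exprn_ile1 ?cabs_ge0 // ltW.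
have zp : 0 < cabs (zz k) by exact: lt_trans z1.
split; apply: poch_E.
- rewrite mulrAC ltr_pdivrMr // mul1r; apply: lt_trans z1.
  by rewrite gtr_pMl.
- apply/eqP => e; apply: nb; exists k => //; left; split=> //.
  apply: (mulfI qn0); rewrite [RHS]mulrC mulfVK // -[RHS]mul1r -e.
  by rewrite mulrA mulfVK.
- rewrite cabsM cabsV mulrAC ltr_pdivrMr // mul1r mulrAC ltr_pdivrMr //.
  rewrite (@lt_trans _ _ (cabs p * cabs q)) ?ltr_pM2r //.
  by rewrite ltr_pM2l // (lt_trans pq) // expr2 gtr_pMr.
- apply/eqP => e; apply: nb; exists k => //; right; split=> //.
  exact: solve_pq e.
Qed.

Lemma offbad_shuffle tau (b m : nat) (s : 'S_m) : (b + m <= M)%N -> offbad tau ->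
  offbad (fun c => tau (shuffle b s c)).
Proof.
move=> bM [ct hb]; split=> [c|c]; first exact: ct.
by rewrite mem_iota add0n => cM; apply: hb; rewrite mem_iota add0n; exact: shuffle_lt.
Qed.

(** The numbers of the variables v l a with a >= lam l are those of variables of other
   levels, so that permutations of the coordinates make sense on such functions only. *)
Definition local f : Prop := forall v w,
  (forall l a, (1 <= l < N)%N -> (a < lam l)%N -> v l a = w l a) -> f v = f w.

Lemma local_Symt l f : local f -> local (Symt mu l f).
Proof.
move=> lf v w vw; congr (_ * _); apply: eq_bigr => s _; apply: lf => l' a hl al.
rewrite /permute_level; case: (l' =P l) => [e|_]; last exact: vw.
by rewrite e in hl al; case: insubP => [i _ _|_]; apply: vw.
Qed.

Lemma Symts_scale (z : C) f ls :
  foldr (Symt mu) (fun v => z * f v) ls = fun v => z * foldr (Symt mu) f ls v.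
Proof.
elim: ls => [|l ls IH] //=; rewrite IH; apply/funext => v.
by rewrite /Symt -mulr_sumr mulrCA.
Qed.

Lemma local_U x y : local (U_fun (N := N) logq r mu u x y).
Proof.
move=> v w vw; have vxE l a : (1 <= l <= N)%N -> (a < lam l)%N -> vx N u v l a = vx N u w l a.
  move=> /andP[l0 lN] al; rewrite /vx; case: eqP => // /eqP nN.
  by apply: vw => //; rewrite l0 ltn_neqAle nN.
rewrite /U_fun [LHS]big_nat [RHS]big_nat; apply: eq_bigr => l /andP[l0 lN].
rewrite [LHS]big_nat [RHS]big_nat; apply: eq_bigr => a /andP[_ al].
have hl : (1 <= l <= N)%N by rewrite l0 ltnW.
have e0 := vxE l a hl al; have e1 := vxE l.+1; have e2 := vxE l.
have e3 : vx N u v l.+1 (index (ipos mu l a) (Iset l.+1)) =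
    vx N u w l.+1 (index (ipos mu l a) (Iset l.+1)).
  apply: e1; rewrite ?lN // /Defs.lam index_mem mem_Iset.
  have := ipos_mem al; rewrite mem_Iset => /andP[-> h] /=; exact: leqW.
rewrite e3 e0; apply: (f_equal2 *%R); first apply: (f_equal2 *%R); first by [].
  rewrite [LHS]big_nat_cond [RHS]big_nat_cond; apply: eq_bigr => b /andP[/andP[_ bl] _].
  by rewrite (e1 b lN bl).
rewrite [LHS]big_nat_cond [RHS]big_nat_cond; apply: eq_bigr => b /andP[/andP[_ bl] _].
by rewrite (e2 b hl bl).
Qed.

Lemma permute_vtau l (s : 'S_(lam l)) tau l' a : (1 <= l < N)%N -> (1 <= l' < N)%N ->
  (a < lam l')%N ->
  permute_level l s (vtau tau) l' a = vtau (fun c => tau (shuffle (pos l 0) s c)) l' a.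
Proof.
move=> /andP[l0 lN] /andP[l0' lN'] al; rewrite /permute_level /vtau.
have [e|ne] := eqVneq l' l; last by rewrite shuffle_out //; exact: vpos_disjoint.
rewrite e in al *; rewrite (insubT (fun i => i < lam l)%N al) /=; congr (vang _ (tau _)).
have posE b : pos l b = (pos l 0 + b)%N by rewrite /vpos addn0.
rewrite (posE (s _)) (posE a); exact: esym (shuffle_in _ _ (Ordinal al)).
Qed.

Variables (Psi : state R N) (x y : W) (X : nat -> nat -> C).
Local Notation P := (fun v => act logq r (Phi_tilde logq r kap mu u v) Psi x y X).

Lemma P_local : local P.
Proof.
move=> v w vw; apply: act_fsim; apply: Phi_tilde_sym => l hl.
rewrite (_ : map (v l) _ = map (w l) (iota 0 (lam l))) //.
by apply/eq_in_map => a; rewrite mem_iota add0n => /= al; exact: vw.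
Qed.

Lemma P_permute l (s : 'S_(lam l)) v : P (permute_level l s v) = P v.
Proof.
apply: act_fsim; apply: Phi_tilde_sym => l' _.
rewrite /permute_level; have [->|ne] := eqVneq l' l; last exact: perm_refl.
have e (g : nat -> C) : [seq g a | a <- iota 0 (lam l)] = [seq g (val i) | i <- enum 'I_(lam l)].
  by rewrite -val_enum_ord -map_comp.
have E1 (g1 g2 : 'I_(lam l) -> C) t : g1 =1 g2 -> perm_eq (map g2 (enum 'I_(lam l))) t ->
    perm_eq (map g1 (enum 'I_(lam l))) t by move=> /eq_map ->.
rewrite !e; apply: (E1 _ (fun i => v l (val (s i)))) => [i|]; first by rewrite valK.
rewrite (map_comp (fun i => v l (val i)) s).
apply: perm_map; apply: uniq_perm => [||i]; [|exact: enum_uniq|].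
  by rewrite map_inj_uniq ?enum_uniq //; exact: perm_inj.
rewrite mem_enum; apply/mapP; exists (s^-1%g i); first by rewrite mem_enum.
by rewrite permKV.
Qed.

(** Because P is symmetric, symmetrizing a function amounts, under the integral of its
   product with P, to relabelling the integration variables.  Fn is a bounded
   representative of the integrand. *)
Lemma tint_Symt l f (Fn : (nat -> R) -> C) : (1 <= l < N)%N -> local f -> nice Fn ->
  (forall tau, offbad tau -> P (vtau tau) * f (vtau tau) = Fn tau) ->
  exists Fn', [/\ nice Fn',
    forall tau, offbad tau -> P (vtau tau) * Symt mu l f (vtau tau) = Fn' tau &
    tint (iota 0 M) Fn' (fun=> 0) = tint (iota 0 M) Fn (fun=> 0)].
Proof.
move=> hl lf nF hF; have bM : (pos l 0 + lam l <= M)%N by exact: block_le.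
pose z : C := ((lam l)`!%:R)^-1.
have nS (s : 'S_(lam l)) : nice (fun tau => Fn (fun c => tau (shuffle (pos l 0) s c))).
  exact: (@nice_relabel _ Fn (shuffle (pos l 0) s)).
have nsum : nice (fun tau => \sum_(s : 'S_(lam l)) Fn (fun c => tau (shuffle (pos l 0) s c))).
  by apply: nice_sum => s _.
exists (fun tau => z * \sum_(s : 'S_(lam l)) Fn (fun c => tau (shuffle (pos l 0) s c))); split.
- by apply: niceM => //; exact: nice_cst.
- move=> tau ot; rewrite /Symt mulrCA -/z big_distrr /=; congr (_ * _); apply: eq_bigr => s _.
  rewrite -(P_permute s) -(hF _ (offbad_shuffle s bM ot)).
  by congr (_ * _); [apply: P_local|apply: lf] => l' a hl' al; exact: permute_vtau.
rewrite tintZ //; last exact: cube0.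
rewrite tint_sum //; last exact: cube0.
rewrite (eq_bigr (fun=> tint (iota 0 M) Fn (fun=> 0))) => [|s _].
  rewrite sumr_const card_Sn -mulr_natl mulrA mulVf ?mul1r // pnatr_eq0 -lt0n fact_gt0 //.
apply: (tint_permute (rho := shuffle (pos l 0) s)) => //; last exact: perm_shuffle.
- exact: can_inj (@shuffleK _ _ s).
- exact: cube0.
Qed.

Lemma tint_Symts ls f (Fn : (nat -> R) -> C) : all (fun l => 1 <= l < N)%N ls -> local f -> nice Fn ->
  (forall tau, offbad tau -> P (vtau tau) * f (vtau tau) = Fn tau) ->
  exists Fn', [/\ nice Fn',
    forall tau, offbad tau -> P (vtau tau) * foldr (Symt mu) f ls (vtau tau) = Fn' tau &
    tint (iota 0 M) Fn' (fun=> 0) = tint (iota 0 M) Fn (fun=> 0)].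
Proof.
move=> + lf nF hF; elim: ls => [|l ls IH] /=; first by move=> _; exists Fn.
move=> /andP[hl hls]; have [F1 [n1 h1 t1]] := IH hls.
have ll : local (foldr (Symt mu) f ls).
  by elim: (ls) => //= l' ls' h; exact: local_Symt.
have [F2 [n2 h2 t2]] := tint_Symt hl ll n1 h1.
by exists F2; split=> //; rewrite t2.
Qed.

End Symmetrization.

Section Composition.
Variable R : realType.
Local Notation C := R[i].
Variables (N : nat) (logq : C) (r : R).
Local Notation W := 'rV[C]_N.
Variable kap : W -> W -> C.
Variables (aN : nat -> C) (mu : seq nat) (u : nat -> C).
Local Notation n := (size mu).
Local Notation M := (Mdim N mu).
Local Notation q := (qq logq).
Local Notation p := (pp logq r).
Local Notation zz := (zz logq u).
Hypothesis N1 : (1 < N)%N.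
Hypothesis hq : complex.Re logq < 0.
Hypothesis hr : 1 < r.
Hypothesis hkap : lattice_rep logq r kap.
Hypothesis hmu : all (fun m => 1 <= m <= N)%N mu.
Hypothesis hz : forall k, (k < n)%N -> cabs p < cabs (zz k) /\ cabs (zz k) < 1.
Hypothesis hgen : forall s : rat, r != ratr s.
Hypothesis hcontour : forall k j, (k <= j < n)%N -> (nth 0%N mu j < N)%N ->
  cabs (zz k) != cabs q.
Hypothesis hpole1 : forall k l, (k < l < n)%N ->
  dpoch N logq r (q ^+ 2 * (zz k / zz l)) != 0.
Hypothesis hpole2 : forall k l, (k < n)%N -> (l < n)%N -> k <> l ->
  dpoch N logq r (q ^+ (2 * N) * (zz k / zz l)) != 0.

(** The iterated integral of the composition is one over the variables in any order. *)
Lemma iact_phi_comp Psi x y X : finsupp X -> (forall x y, fock_poly N (Psi x y)) ->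
  let F tau := act logq r (vops logq r kap mu (Vtau N logq u (code mu) tau) (iota 0 n)) Psi x y X in
  nice F /\ iact logq r (phi_comp logq r kap aN mu u) Psi x y X =
    (\prod_(j <- mu) aN j) * tint (iota 0 M) F (fun=> 0).
Proof.
move=> hX hPsi F; have nF : nice F by exact: nice_act.
split=> //; rewrite /iact /phi_comp.
have [-> -> hf] := phi_comp_iop logq r kap u hmu aN (iota_uniq 0 n) (all_iota_lt mu).
congr (_ * _); first by rewrite -[in RHS](mkseq_nth 0%N mu) big_map.
rewrite -(tint_perm nF (@cube0 R) (perm_code N1 hmu)).
rewrite -torus_int_tint ?(perm_uniq (perm_code N1 hmu)) ?iota_uniq // size_map.
congr torus_int; apply/funext => th; rewrite hf /F.
apply: (congr1 (fun A => act logq r A Psi x y X)); apply: (eq_vops _ _ _ hmu); last exact: all_iota_lt.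
move=> c ck /andP[c1 c2]; rewrite /Vtau; case: eqP => // /eqP nN.
by rewrite index_code // mem_ivars ck c1 ltn_neqAle nN.
Qed.

Lemma iact_phi_integral Psi x y X :
  iact logq r (phi_integral logq r kap mu u aN) Psi x y X =
  (\prod_(j <- mu) aN j) * tint (iota 0 M) (fun tau =>
    act logq r (Phi_tilde logq r kap mu u (vtau logq mu tau)) Psi x y X *
    omega logq r mu u (vtau logq mu tau) (x - wshift (Phi_tilde logq r kap mu u (vtau logq mu tau))) y)
   (fun=> 0).
Proof.
rewrite /iact /=; congr (_ * _).
rewrite (torus_int_iota M (fun tau => act logq r (fmul logq r (Phi_tilde logq r kap mu u (vtau logq mu tau))
  (fzero (omega logq r mu u (vtau logq mu tau)))) Psi x y X)).
apply: eq_tint => [|tau _]; first exact: cube0.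
rewrite fmul_fzero; exact: act_proportional.
Qed.

(** On a component of Psi that is not 0 the weight is in the weight lattice, as the exchange of
   the lattice operators requires; on the other components both sides are 0. *)
Lemma iact_eq a nu Psi x y X : (a < N)%N -> in_Vhat a nu Psi -> finsupp X ->
  iact logq r (phi_comp logq r kap aN mu u) Psi x y X =
  iact logq r (phi_integral logq r kap mu u aN) Psi x y X.
Proof.
move=> aN' [hPsi [s hs hsupp]] hX.
have [nF ->] := iact_phi_comp x y hX hPsi; rewrite iact_phi_integral; congr (_ * _).
set F := fun tau => _ in nF *.
pose A tau := vops logq r kap mu (Vlab N mu u (vtau logq mu tau)) (iota 0 n).
pose B tau := Phi_tilde logq r kap mu u (vtau logq mu tau).
pose w := - \sum_(c <- labelsR N mu) wt R N c.1.
have FA tau : F tau = act logq r (A tau) Psi x y X.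
  apply: (congr1 (fun A => act logq r A Psi x y X)); apply: (eq_vops _ _ _ hmu); last exact: all_iota_lt.
  move=> [l k]; rewrite mem_iota add0n => /= kn /andP[c1 c2]; rewrite /Vtau /=.
  case: eqP => [->|nN]; first by rewrite Vlab_N.
  by rewrite /Vlab /vx; case: eqP.
have pw tau := pointwise N1 hq hr hgen hkap hmu hpole1 hpole2 (vtau logq mu tau).
have wB tau : wshift (B tau) = w.
  have [_ _] := pw tau; rewrite /B Phi_tildeE //.
  have r0 : r != 0 by rewrite gt_eqF // (lt_trans ltr01 hr).
  have ul : uniq (levels N) by rewrite levelsE // rev_uniq iota_uniq.
  have [_ h _] := nX_prod logq kap (vlev N mu u (vtau logq mu tau)) r0 ul.
  by move=> _; rewrite [LHS]h vlev_labels big_map.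
have [e0|ne0] := pselect (Psi (x - w) y = fun=> 0).
  transitivity (tint (iota 0 M) (fun=> 0 : C) (fun=> 0)); last symmetry.
    apply: eq_tint => [|tau _]; first exact: cube0.
    have [_ h _] := pw tau; rewrite FA /act -/(A tau) (_ : wshift (A tau) = w) ?e0 ?mulr0 //.
    by rewrite -(wB tau).
  apply: eq_tint => [|tau _]; first exact: cube0.
  by rewrite /act -/(B tau) wB e0 mulr0 mul0r.
have hx : wlat (x - w) by exists a => //; exact: (hs _ _ (hsupp _ _ ne0)).1.
pose f v := mu_plus N logq r mu u * U_fun logq r mu u (x - w) y v.
have hF tau : offbad N logq r mu u tau ->
    act logq r (B tau) Psi x y X * f (vtau logq mu tau) = F tau.
  move=> ot; have [h1 h2 h3] := pw tau; rewrite FA.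
  symmetry; apply: act_proportional => //.
  have wA : wshift (A tau) = w by rewrite -(wB tau).
  by rewrite -/(A tau) wA; apply: h3 => //; exact: regular_offbad.
have lf : local N mu f by move=> v v' vv; rewrite /f (local_U _ _ _ _ _ vv).
have hl : all (fun l => 1 <= l < N)%N (index_iota 1 N) by apply/allP => l; rewrite mem_index_iota.
have [Fn [nFn hFn tFn]] := tint_Symts hl lf nF hF.
rewrite -tFn; symmetry.
apply: (tint_finite_diff (finite_bad logq r mu u) nFn (@cube0 R)) => tau ct hb.
rewrite -(hFn _ (conj ct hb)) -/(B tau) wB; congr (_ * _).
by rewrite /omega /W_fun Symts_scale.
Qed.

End Composition.

Local Close Scope classical_set_scope.
Unset Implicit Arguments.

Theorem theorem4p2 (R : realType) (N : nat) (logq : R[i]) (r : R)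
    (kap : 'rV[R[i]]_N -> 'rV[R[i]]_N -> R[i]) (aN : nat -> R[i])
    (mu : seq nat) (u : nat -> R[i])
    (hN : (2 <= N)%N)
    (hq : complex.Re logq < 0)
    (hr : 1 < r)
    (hkap : lattice_rep logq r kap)
    (haN : aN N = 1)
    (ha0 : forall m, (1 <= m <= N)%N -> aN m != 0)
    (hmu : all (fun m => 1 <= m <= N)%N mu)
    (hz : forall k, (k < size mu)%N ->
       `|pp logq r| < `|zz logq u k| /\ `|zz logq u k| < 1)
    (* r is generic *)
    (hgen : forall s : rat, r != ratr s)
    (* T^M contains no pole of the integrand *)
    (hcontour : forall k j, (k <= j < size mu)%N -> (nth 0%N mu j < N)%N ->
       `|zz logq u k| != `|qq logq|)
    (* z is not a pole of the factors in front of the currents *)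
    (hpole1 : forall k l, (k < l < size mu)%N ->
       dpoch N logq r (qq logq ^+ 2 * (zz logq u k / zz logq u l)) != 0)
    (hpole2 : forall k l, (k < size mu)%N -> (l < size mu)%N -> k <> l ->
       dpoch N logq r (qq logq ^+ (2 * N) * (zz logq u k / zz logq u l)) != 0) :
  Mdim N mu = (\sum_(1 <= l < N) (N - l) * card_I mu l)%N /\
  forall (a : nat) (nu : 'rV[R[i]]_N) (Psi : state R N),
    (a < N)%N -> in_Vhat a nu Psi ->
    forall (x y : 'rV[R[i]]_N) (X : nat -> nat -> R[i]), finsupp X ->
      iact logq r (phi_comp logq r kap aN mu u) Psi x y X =
      iact logq r (phi_integral logq r kap mu u aN) Psi x y X.
Proof.
split; first exact: Mdim_card.
move=> a nu Psi aN' hPsi x y X hX.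
have hz' k : (k < size mu)%N ->
    cabs (pp logq r) < cabs (zz logq u k) /\ cabs (zz logq u k) < 1.
  by move=> /hz []; rewrite !cabsE -[1]/((1 : R)%:C) !ltcR; split.
have hcontour' k j : (k <= j < size mu)%N -> (nth 0%N mu j < N)%N ->
    cabs (zz logq u k) != cabs (qq logq).
  by move=> kj hj; have := hcontour k j kj hj; rewrite !cabsE (inj_eq (@complexI R)).
exact: (iact_eq aN hN hq hr hkap hmu hz' hgen hcontour' hpole1 hpole2 x y aN' hPsi hX).
Qed.
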